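(* Assume the global noise law, the edge condition, the holomorphic subspace local law, and weighted compatibility on every compact $K\subset\mathbb C\setminus[-b,b]$ (all defined in the context), and assume $r_n\to\infty$. Suppose that the restricted supercritical spike measures $H_n^+:=H_n|_{(\theta_\star,\infty)}$, where $H_n=\frac1{r_n}\sum_{i=1}^{r_n}\delta_{\theta_{n,i}}$, converge vaguely in probability on $(\theta_\star,\infty)$ to a deterministic finite measure $H^+$. Then, vaguely in probability on $(b,\infty)$, $$\nu_n^{\mathrm{out}}\to\rho_\#H^+,\qquad \omega_n^{\mathrm L}\to\rho_\#(\kappa_{\mathrm L}H^+),\qquad \omega_n^{\mathrm R}\to\rho_\#(\kappa_{\mathrm R}H^+),\qquad \omega_n^{\mathrm{LR}}\to\rho_\#(\kappa_{\mathrm{LR}}H^+).$$ Equivalently, for every $f\in C_c((b,\infty))$, in probability, $$\frac1{r_n}\sum_jf(\sigma_j(W_n))\to\int f(\rho(\theta))\,H^+(d\theta),$$ $$\frac1{r_n}\sum_jf(\sigma_j(W_n))\|U_n^*\widehat u_{n,j}\|_2^2\to\int f(\rho(\theta))\kappa_{\mathrm L}(\theta)\,H^+(d\theta),$$ $$\frac1{r_n}\sum_jf(\sigma_j(W_n))\|V_n^*\widehat v_{n,j}\|_2^2\to\int f(\rho(\theta))\kappa_{\mathrm R}(\theta)\,H^+(d\theta),$$ $$\frac1{r_n}\sum_jf(\sigma_j(W_n))\chi_{n,j}\to\int f(\rho(\theta))\kappa_{\mathrm{LR}}(\theta)\,H^+(d\theta),$$ where the sums run over all $1\le j\le n$.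
   Context: Setting. $\mathbb F\in\{\mathbb R,\mathbb C\}$; for each $n$, $m=m(n)\ge n$ is an integer and $n/m\to c\in(0,1]$. $X_n$ is a random $n\times m$ matrix over $\mathbb F$; $P_n$ is an $n\times m$ matrix of rank $r_n$ (deterministic, or random on the same probability space; independence from $X_n$ is not assumed); $W_n=X_n+P_n$. With $\mathrm{St}(N,r)=\{Q\in\mathbb F^{N\times r}:Q^*Q=I_r\}$, fix a thin singular value decomposition $P_n=U_n\Theta_nV_n^*$, $U_n\in\mathrm{St}(n,r_n)$, $V_n\in\mathrm{St}(m,r_n)$, $\Theta_n=\operatorname{diag}(\theta_{n,1},\dots,\theta_{n,r_n})$, $\theta_{n,1}\ge\dots\ge\theta_{n,r_n}>0$. $\varepsilon_n\downarrow0$ means a nonnegative sequence tending to $0$. Global noise law. There is a compactly supported probability measure $\mu$ on $[0,\infty)$ such that the empirical spectral measure of $X_nX_n^*$ converges weakly to $\mu$ in probability and $\|X_n\|_{\mathrm{op}}\to b:=\sqrt{\sup\operatorname{supp}\mu}$ in probability. Transforms. For $\zeta\in\mathbb C\setminus[-b,b]$: $\phi(\zeta)=\int\frac{\zeta}{\zeta^2-x}\,\mu(dx)$, $\widetilde\phi(\zeta)=c\,\phi(\zeta)+\frac{1-c}{\zeta}$, $d(\zeta)=\phi(\zeta)\widetilde\phi(\zeta)$. On $(b,\infty)$, $d$ is positive and strictly decreasing. Edge condition. $d(b+):=\lim_{z\downarrow b}d(z)\in(0,\infty)$. Put $\theta_\star=d(b+)^{-1/2}$; $\rho(\theta)=d^{-1}(\theta^{-2})$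 (inverse of $d$ on $(b,\infty)$) for $\theta>\theta_\star$ and $\rho(\theta)=b$ for $0\le\theta\le\theta_\star$. Overlap weights. For $\theta>\theta_\star$ and $\rho=\rho(\theta)$: $\kappa_{\mathrm L}(\theta)=-\frac{2\phi(\rho)}{\theta^2d'(\rho)}$, $\kappa_{\mathrm R}(\theta)=-\frac{2\widetilde\phi(\rho)}{\theta^2d'(\rho)}$, $\kappa_{\mathrm{LR}}(\theta)=-\frac{2}{\theta^3d'(\rho)}$. Linearization. $\mathcal X_n=\begin{pmatrix}0&X_n\\ X_n^*&0\end{pmatrix}$, $\mathcal E_n=\begin{pmatrix}U_n&0\\0&V_n\end{pmatrix}$, $\mathcal K_n=\begin{pmatrix}0&\Theta_n\\\Theta_n&0\end{pmatrix}$, $\mathcal G_n(\zeta)=\mathcal E_n^*(\zeta I-\mathcal X_n)^{-1}\mathcal E_n$, $\mathcal M(\zeta)=\begin{pmatrix}\phi(\zeta)I_{r_n}&0\\0&\widetilde\phi(\zeta)I_{r_n}\end{pmatrix}$. Holomorphic subspace local law. For every compact $K\subset\mathbb C\setminus[-b,b]$ there is a deterministic $\varepsilon_n(K)\downarrow0$ such that, with probability tending to one, $\sup_{\zeta\in K}\|\mathcal G_n(\zeta)-\mathcal M(\zeta)\|_{\mathrm{op}}\le\varepsilon_n(K)$. Weighted compatibility on a compact $K$: $\sup_{\zeta\in K}\big(\|(\mathcal G_n(\zeta)-\mathcal M(\zeta))\mathcal K_n\|_{\mathrm{op}}+\|\mathcal K_n(\mathcal G_n(\zeta)-\mathcal M(\zeta))\|_{\mathrm{op}}\big)\to0$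 in probability. (Suprema are $+\infty$ if $\mathcal G_n$ is undefined somewhere on $K$.) Empirical measures. Let $\widehat u_{n,j},\widehat v_{n,j}$ ($1\le j\le n$) be paired left/right singular vectors of $W_n$ for $\sigma_j(W_n)$ from a singular value decomposition, and let $\chi_{n,j}=\operatorname{tr}(U_n^*\widehat u_{n,j}\widehat v_{n,j}^*V_n)$. Then $\nu_n^{\mathrm{out}}=\frac1{r_n}\sum_{j=1}^n\mathbf 1_{\{\sigma_j(W_n)>b\}}\delta_{\sigma_j(W_n)}$, and $\omega_n^{\mathrm L},\omega_n^{\mathrm R},\omega_n^{\mathrm{LR}}$ are defined by the same formula with the extra factor $\|U_n^*\widehat u_{n,j}\|_2^2$, $\|V_n^*\widehat v_{n,j}\|_2^2$, $\chi_{n,j}$ respectively in the $j$-th summand ($\omega_n^{\mathrm{LR}}$ may be complex-valued). $\rho_\#$ denotes pushforward under $\rho$; $\kappa H^+$ denotes the measure with density $\kappa$ with respect to $H^+$. Vague convergence in probability on an open set $O$ means convergence in probability of integrals of every $f\in C_c(O)$. *)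

(* Defs.v *)
From HB Require Import structures.
From mathcomp Require Import all_boot all_order all_algebra.
From mathcomp Require Import all_classical all_reals all_analysis.
From mathcomp Require Import complex.

Set Implicit Arguments.
Unset Strict Implicit.
Unset Printing Implicit Defensive.

Import Order.TTheory GRing.Theory Num.Theory numFieldNormedType.Exports.
Local Open Scope classical_set_scope.
Local Open Scope complex_scope.
Local Open Scope ring_scope.
Local Open Scope sesquilinear_scope.

(* All matrices have entries in [R[i]]; the base field F is recorded by
   requiring the entries to be real when F is the field of real numbers. *)
Variant base_field := RealField | ComplexField.

Definition mx_over (R : realType) (F : base_field) n m (A : 'M[R[i]]_(n, m)) :
    Prop :=
  if F is RealField then A \is a realmx else True.

Section Matrices.
Context {R : realType}.
Local Notation C := (R[i]).

Definition norm2 n m (A : 'M[C]_(n, m)) : R :=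
  Num.sqrt (\sum_i \sum_j Normc.normc (A i j) ^+ 2).

Definition opnorm n m (A : 'M[C]_(n, m)) : R :=
  sup [set norm2 (A *m x) | x in [set x : 'cV[C]_m | norm2 x <= 1]].

Definition stiefel n k (Q : 'M[C]_(n, k)) : Prop := Q^t* *m Q = 1%:M.

Definition cdiag k (s : 'rV[R]_k) : 'M[C]_k := diag_mx (map_mx (fun x => x%:C) s).

(* [k = \rank A] with positive [s] gives the thin decomposition,
   [k = n <= m] the list of all [n] singular values with paired vectors. *)
Definition is_svd (F : base_field) n m k (A : 'M[C]_(n, m))
    (U : 'M[C]_(n, k)) (s : 'rV[R]_k) (V : 'M[C]_(m, k)) : Prop :=
  [/\ mx_over F U /\ mx_over F V, stiefel U /\ stiefel V,
      forall i, 0 <= s 0 i,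
      forall i j : 'I_k, (i <= j)%N -> s 0 j <= s 0 i
    & A = U *m cdiag s *m V^t*].

Definition is_thin_svd (F : base_field) n m k (A : 'M[C]_(n, m))
    (U : 'M[C]_(n, k)) (s : 'rV[R]_k) (V : 'M[C]_(m, k)) : Prop :=
  [/\ \rank A = k, is_svd F A U s V & forall i, 0 < s 0 i].

Definition hermitization n m (X : 'M[C]_(n, m)) : 'M[C]_(n + m) :=
  block_mx 0 X (X^t*) 0.

Definition frame n m k (U : 'M[C]_(n, k)) (V : 'M[C]_(m, k)) :
    'M[C]_(n + m, k + k) :=
  block_mx U 0 0 V.

Definition spike_block k (s : 'rV[R]_k) : 'M[C]_(k + k) :=
  block_mx 0 (cdiag s) (cdiag s) 0.

Definition compressed_resolvent n m k (X : 'M[C]_(n, m)) (U : 'M[C]_(n, k))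
    (V : 'M[C]_(m, k)) (zeta : C) : 'M[C]_(k + k) :=
  (frame U V)^t* *m invmx (zeta%:M - hermitization X) *m frame U V.

(* Supremum over [K], with values in [0, +oo], of [h], which is counted as [+oo]
   where the resolvent of the linearization of [X] does not exist. The element
   [0] makes the supremum over the empty set equal to [0]. *)
Definition sup_resolvent n m (X : 'M[C]_(n, m)) (K : set C) (h : C -> R) :
    \bar R :=
  ereal_sup (0%E |` [set (if zeta%:M - hermitization X \in unitmx
                          then (h zeta)%:E else +oo%E) | zeta in K]).

End Matrices.

(* A finite complex atomic measure is the list of its (atom, mass) pairs. *)
Section AtomicMeasures.
Context {R : realType}.

Definition atomic := seq (R * R[i]).

Definition atomic_integral (nu : atomic) (f : R -> R) : R[i] :=
  \sum_(a <- nu) a.2 * (f a.1)%:C.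

Definition atomic_restrict (nu : atomic) (A : set R) : atomic :=
  [seq a <- nu | `[< A a.1 >]].

(* [1/N \sum_j w_j \delta_(s_j)] *)
Definition weighted_atoms (N : nat) k (s : 'rV[R]_k) (w : 'I_k -> R[i]) : atomic :=
  [seq (s 0 j, (N%:R)^-1 * w j) | j <- enum 'I_k].

Definition empirical k (s : 'rV[R]_k) : atomic := weighted_atoms k s (fun=> 1).

Definition spectral_empirical n (A : 'M[R[i]]_n) : atomic :=
  empirical (map_mx (@complex.Re R) (spectral_diag A)).

(* [1/N \sum_j 1_{s_j > b} w_j \delta_(s_j)] *)
Definition outlier_measure (N : nat) (b : R) k (s : 'rV[R]_k) (w : 'I_k -> R[i]) :
    atomic :=
  atomic_restrict (weighted_atoms N s w) `]b, +oo[.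

End AtomicMeasures.
Arguments atomic : clear implicits.

Definition test_function (R : realType) (O : set R) (f : R -> R) : Prop :=
  [/\ continuous f, compact (closure [set x | f x != 0])
    & closure [set x | f x != 0] `<=` O].

(* The probability space may depend on [n]. Events and random variables are not
   required to be measurable: an event holds with probability tending to one
   when it contains measurable events of probability tending to one, which for
   measurable events is the usual notion. *)
Section Probability.
Context {R : realType} {d : nat -> measure_display}
  {T : forall n, measurableType (d n)}.
Variable Pr : forall n, probability (T n) R.

Definition whp (E : forall n, set (T n)) : Prop :=
  exists A : forall n, set (T n),
    [/\ forall n, measurable (A n), forall n, A n `<=` E n
      & (fun n => Pr n (A n)) @ \oo --> 1%E].

Definition cvg0_in_prob (Y : forall n, T n -> \bar R) : Prop :=
  forall e : R, 0 < e -> whp (fun n => [set w | (`|Y n w| < e%:E)%E]).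

Definition cvg_in_prob (Y : forall n, T n -> R[i]) (a : R[i]) : Prop :=
  cvg0_in_prob (fun n w => (Normc.normc (Y n w - a))%:E).

Definition weak_cvg_in_prob (nu : forall n, T n -> atomic R)
    (mu : set R -> \bar R) : Prop :=
  forall f : R -> R, continuous f -> (exists M, forall x, `|f x| <= M) ->
    cvg_in_prob (fun n w => atomic_integral (nu n w) f)
      (fine (\int[mu]_x (f x)%:E)%E)%:C.

Definition vague_cvg_in_prob (O : set R) (nu : forall n, T n -> atomic R)
    (mu : set R -> \bar R) : Prop :=
  forall f : R -> R, test_function O f ->
    cvg_in_prob (fun n w => atomic_integral (nu n w) f)
      (fine (\int[mu]_x (f x)%:E)%E)%:C.

End Probability.

Definition random_matrix (R : realType) (d : measure_display)
    (T : measurableType d) n m (X : T -> 'M[R[i]]_(n, m)) : Prop :=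
  forall i j, measurable_fun setT (fun w => complex.Re (X w i j) : R) /\
              measurable_fun setT (fun w => complex.Im (X w i j) : R).

Section Transforms.
Context {R : realType}.
Variables (mu : probability R R) (c : R).
Local Notation C := (R[i]).

Definition measure_support : set R :=
  [set x | forall U : set R, open U -> U x -> (0 < mu U)%E].

Definition noise_edge : R := Num.sqrt (sup measure_support).
Local Notation b := noise_edge.

Definition off_cut (K : set C) : Prop :=
  forall zeta, K zeta -> ~ exists2 x : R, - b <= x <= b & zeta = x%:C.

Definition phi (zeta : C) : C :=
  let g x := zeta / (zeta ^+ 2 - x%:C) in
  ((\int[mu]_x complex.Re (g x)) +i* (\int[mu]_x complex.Im (g x)))%C.

Definition phit (zeta : C) : C := c%:C * phi zeta + (1 - c)%:C / zeta.

Definition dtrans (zeta : C) : C := phi zeta * phit zeta.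

(* On the real half-line [(b, +oo)] the transforms are real-valued. *)
Definition phi_real (z : R) : R := complex.Re (phi z%:C).
Definition phit_real (z : R) : R := complex.Re (phit z%:C).
Definition dtrans_real (z : R) : R := complex.Re (dtrans z%:C).

Definition d_edge : R := lim (dtrans_real z @[z --> b^'+]).

Definition edge_condition : Prop :=
  cvg (dtrans_real z @[z --> b^'+]) /\ 0 < d_edge.

Definition theta_star : R := (Num.sqrt d_edge)^-1.

Definition rho (theta : R) : R :=
  if theta_star < theta
  then xget b [set z | b < z /\ dtrans_real z = (theta ^+ 2)^-1]
  else b.

Definition kappaL (theta : R) : R :=
  - (2 * phi_real (rho theta)) / (theta ^+ 2 * derive1 dtrans_real (rho theta)).
Definition kappaR (theta : R) : R :=
  - (2 * phit_real (rho theta)) / (theta ^+ 2 * derive1 dtrans_real (rho theta)).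
Definition kappaLR (theta : R) : R :=
  - 2 / (theta ^+ 3 * derive1 dtrans_real (rho theta)).

(* The measure [kappa H], for [H] carried by [(theta_star, +oo)], where the
   weights [kappa] are defined. *)
Definition with_density (H : set R -> \bar R) (kappa : R -> R) :
    set R -> \bar R :=
  fun A => (\int[H]_(x in A `&` `]theta_star, +oo[) (kappa x)%:E)%E.

Definition limit_block k (zeta : C) : 'M[C]_(k + k) :=
  block_mx (phi zeta)%:M 0 0 (phit zeta)%:M.

End Transforms.

Section Hypotheses.
Context {R : realType} {d : nat -> measure_display}
  {T : forall n, measurableType (d n)}.
Variables (Pr : forall n, probability (T n) R) (mu : probability R R) (c : R).
Variables (m r : nat -> nat).
Variables (X : forall n, T n -> 'M[R[i]]_(n, m n)).
Variables (U : forall n, T n -> 'M[R[i]]_(n, r n))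
  (theta : forall n, T n -> 'rV[R]_(r n)) (V : forall n, T n -> 'M[R[i]]_(m n, r n)).

Definition global_noise_law : Prop :=
  [/\ measure_support mu `<=` `[0, +oo[, compact (measure_support mu),
      weak_cvg_in_prob Pr
        (fun n w => spectral_empirical (X w *m (X w)^t*)) mu
    & cvg_in_prob Pr (fun n w => (opnorm (X w))%:C) (noise_edge mu)%:C].

Definition deviation n (w : T n) (zeta : R[i]) : 'M[R[i]]_(r n + r n) :=
  compressed_resolvent (X w) (U w) (V w) zeta - limit_block mu c (r n) zeta.

Definition subspace_local_law : Prop :=
  forall K : set (R[i])^o, compact K -> off_cut mu K ->
    exists eps : nat -> R,
      [/\ forall n, 0 <= eps n, eps @ \oo --> 0
        & whp Pr (fun n =>
            [set w | (sup_resolvent (X w) K (fun zeta => opnorm (deviation w zeta))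
                      <= (eps n)%:E)%E])].

Definition weighted_compatibility (K : set (R[i])^o) : Prop :=
  cvg0_in_prob Pr (fun n w =>
    sup_resolvent (X w) K (fun zeta =>
      opnorm (deviation w zeta *m spike_block (theta w)) +
      opnorm (spike_block (theta w) *m deviation w zeta))).

End Hypotheses.

Section Overlaps.
Context {R : realType}.

Definition overlap n k (U : 'M[R[i]]_(n, k)) p (Q : 'M[R[i]]_(n, p)) (j : 'I_p) :
    R[i] :=
  (norm2 (U^t* *m col j Q) ^+ 2)%:C.

Definition cross_overlap n m k (U : 'M[R[i]]_(n, k)) (V : 'M[R[i]]_(m, k)) p
    (Qu : 'M[R[i]]_(n, p)) (Qv : 'M[R[i]]_(m, p)) (j : 'I_p) : R[i] :=
  \tr (U^t* *m col j Qu *m (col j Qv)^t* *m V).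

End Overlaps.

(* Main.v *)
Require Import Defs.
From HB Require Import structures.
From mathcomp Require Import all_boot all_order all_algebra.
From mathcomp Require Import all_classical all_reals all_analysis.
From mathcomp Require Import complex ring lra measurable_realfun.
Import Order.TTheory GRing.Theory Num.Theory numFieldNormedType.Exports.
Set Implicit Arguments.
Unset Strict Implicit.
Unset Printing Implicit Defensive.
Local Open Scope classical_set_scope.
Local Open Scope complex_scope.
Local Open Scope ring_scope.
Local Open Scope sesquilinear_scope.

(** The statement reduces to deterministic estimates for one realization of the
matrices. Write [b] for the edge, [d = phi phit] and, for [x > opnorm X],
[A x = x - hermitization X], which is positive definite. The
hypotheses on the noise matrices enter through the event of [whp_local_law],
which has probability tending to one: there [opnorm X] is close to [b], and on a
compact window of [(b, +oo)] the compressed resolvent [G x = E^* (A x)^-1 E],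
where [E = frame U V], is close in operator norm to [diag (phi x, phit x)].

Outlier locations. The matrix [A x - E K E^*] of the perturbed linearization has
as many negative eigenvalues as there are singular values of [X + P] above [x].
If [G x] were exactly [diag (a, a')], this number would be the number of spikes
with [theta ^ 2 * (a a') > 1]. Form inequalities on [G x] suffice for one
direction each ([outlier_le], [outlier_gt]), by test vectors built from the
singular vectors of [X + P] and from the spikes respectively. Since [d]
decreases at a definite rate ([dtrans_sub_ge]), the error of the local law
becomes a small shift of [x]: no point of the window, up to that shift,
separates the [j]-th singular value from [rho theta_j] ([outlier_location]), and
the two sums of a test function agree up to a small multiple of the number of
spikes ([outlier_sum]).

Overlaps. Let [psi = (u, v)] be a singular pair for an outlier [lam]. Then
[E^* psi = G lam y] with [y = K E^* psi], so that, writing [y = (yL, yR)],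
[U^* u] is close to [phi yL] and [V^* v] to [phit yR]. Two relations determine
the masses of [yL] and [yR]: the symmetry of the spike block gives
[phi |yL| ^ 2 = phit |yR| ^ 2] approximately ([mass_balance]), and the
normalization of [psi], read off a difference quotient of [G]
([compressed_difference]), gives [- phi' |yL| ^ 2 - phit' |yR| ^ 2 = 2]
approximately ([mass_normalization]). Hence every single overlap is close to an
explicit continuous function of [lam] ([overlap_limits]), which at
[lam = rho theta] is the weight [kappa theta].

A weighted outlier measure tested against [f] is therefore close to the
unweighted one tested against [f] times the limiting weight
([statistic_limit]), hence to the spike measure tested against
[f (rho theta) * kappa theta]. This function is a test function on
[(theta_star, +oo)] ([test_function_rho]), and the vague convergence of the
spike measures concludes ([statistic_cvg]). *)

(** * Real inner product and operator norm *)

(** The real part of the Hermitian product: the forms below are those of Hermitian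
matrices, which take real values. *)
HB.lock Definition dot (R : realType) n (x y : 'cV[R[i]]_n) : R :=
  complex.Re ((x^t* *m y) 0 0).

Section Dot.
Variable R : realType.
Local Notation C := R[i].
Implicit Types n m k : nat.

Lemma dotE n (x y : 'cV[C]_n) : dot x y =
  \sum_i (complex.Re (x i 0) * complex.Re (y i 0)
          + complex.Im (x i 0) * complex.Im (y i 0)).
Proof.
rewrite dot.unlock mxE raddf_sum /=; apply: eq_bigr => i _; rewrite !mxE.
by case: (x i 0) => a b; case: (y i 0) => c d /=; rewrite mulNr opprK.
Qed.

Lemma dotC n (x y : 'cV[C]_n) : dot x y = dot y x.
Proof. by rewrite !dotE; apply: eq_bigr => i _; ring. Qed.

Lemma dotDr n (x y z : 'cV[C]_n) : dot x (y + z) = dot x y + dot x z.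
Proof. by rewrite dot.unlock mulmxDr mxE raddfD. Qed.

Lemma dotDl n (x y z : 'cV[C]_n) : dot (x + y) z = dot x z + dot y z.
Proof. by rewrite dotC dotDr dotC (dotC z y). Qed.

Lemma dotZr n a (x y : 'cV[C]_n) : dot x (a%:C *: y) = a * dot x y.
Proof.
rewrite !dotE mulr_sumr; apply: eq_bigr => i _; rewrite mxE.
by case: (x i 0) => ? ?; case: (y i 0) => ? ? /=; ring.
Qed.

Lemma dotZl n a (x y : 'cV[C]_n) : dot (a%:C *: x) y = a * dot x y.
Proof. by rewrite dotC dotZr dotC. Qed.

Lemma dotNr n (x y : 'cV[C]_n) : dot x (- y) = - dot x y.
Proof. by rewrite dot.unlock mulmxN mxE raddfN. Qed.

Lemma dotNl n (x y : 'cV[C]_n) : dot (- x) y = - dot x y.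
Proof. by rewrite dotC dotNr dotC. Qed.

Lemma dot0r n (x : 'cV[C]_n) : dot x 0 = 0.
Proof. by rewrite dot.unlock mulmx0 mxE. Qed.

Lemma dot0l n (x : 'cV[C]_n) : dot 0 x = 0.
Proof. by rewrite dotC dot0r. Qed.

Lemma dotBr n (x y z : 'cV[C]_n) : dot x (y - z) = dot x y - dot x z.
Proof. by rewrite dotDr dotNr. Qed.

Lemma dotBl n (x y z : 'cV[C]_n) : dot (x - y) z = dot x z - dot y z.
Proof. by rewrite dotDl dotNl. Qed.

Lemma trmxCM n m k (A : 'M[C]_(n, m)) (B : 'M[C]_(m, k)) :
  (A *m B)^t* = B^t* *m A^t*.
Proof. by rewrite trmx_mul map_mxM. Qed.

Lemma dot_mulmxr n m (A : 'M[C]_(n, m)) x y : dot x (A *m y) = dot (A^t* *m x) y.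
Proof. by rewrite dot.unlock trmxCM trmxCK mulmxA. Qed.

Lemma dot_mulmxl n m (A : 'M[C]_(n, m)) x y : dot (A *m x) y = dot x (A^t* *m y).
Proof. by rewrite dotC dot_mulmxr dotC. Qed.

Lemma dot_col n m (a c : 'cV[C]_n) (b d : 'cV[C]_m) :
  dot (col_mx a b) (col_mx c d) = dot a c + dot b d.
Proof.
rewrite !dotE big_split_ord /=; congr (_ + _); apply: eq_bigr => i _.
  by rewrite !col_mxEu.
by rewrite !col_mxEd.
Qed.

Lemma dotxx n (x : 'cV[C]_n) :
  dot x x = \sum_i (complex.Re (x i 0) ^+ 2 + complex.Im (x i 0) ^+ 2).
Proof. by rewrite dotE; apply: eq_bigr => i _; rewrite !expr2. Qed.

Lemma dot_ge0 n (x : 'cV[C]_n) : 0 <= dot x x.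
Proof. by rewrite dotxx sumr_ge0// => i _; rewrite addr_ge0 ?sqr_ge0. Qed.

Lemma dot_eq0 n (x : 'cV[C]_n) : dot x x = 0 -> x = 0.
Proof.
rewrite dotxx => /eqP; rewrite psumr_eq0; last first.
  by move=> i _; rewrite addr_ge0 ?sqr_ge0.
move=> /allP x0; apply/matrixP => i j; rewrite ord1 mxE.
have := x0 i (mem_index_enum i); rewrite /= paddr_eq0 ?sqr_ge0//.
rewrite !sqrf_eq0 => /andP[/eqP a0 /eqP b0].
by case: (x i 0) a0 b0 => a b /= -> ->.
Qed.

Lemma dot_gt0 n (x : 'cV[C]_n) : x != 0 -> 0 < dot x x.
Proof.
move=> x0; rewrite lt_neqAle dot_ge0 andbT eq_sym.
by apply: contra x0 => /eqP/dot_eq0 ->.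
Qed.

Lemma norm2_ge0 n m (A : 'M[C]_(n, m)) : 0 <= norm2 A.
Proof. exact: sqrtr_ge0. Qed.

Lemma normc_sqrE (z : C) :
  Normc.normc z ^+ 2 = complex.Re z ^+ 2 + complex.Im z ^+ 2.
Proof.
by case: z => a b; rewrite /Normc.normc sqr_sqrtr// addr_ge0 ?sqr_ge0.
Qed.

Lemma sqr_norm2 n (x : 'cV[C]_n) : norm2 x ^+ 2 = dot x x.
Proof.
rewrite /norm2 sqr_sqrtr; last first.
  by rewrite sumr_ge0// => i _; rewrite sumr_ge0// => j _; rewrite sqr_ge0.
rewrite dotxx; apply: eq_bigr => i _; rewrite big_ord1; exact: normc_sqrE.
Qed.

Lemma norm2_0 n : norm2 (0 : 'cV[C]_n) = 0.
Proof. by apply/eqP; rewrite -sqrf_eq0 sqr_norm2 dot0r. Qed.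

Lemma norm2_gt0 n (x : 'cV[C]_n) : x != 0 -> 0 < norm2 x.
Proof.
by move=> x0; rewrite lt_neqAle norm2_ge0 andbT eq_sym -sqrf_eq0 sqr_norm2 gt_eqF ?dot_gt0.
Qed.

Lemma norm2Z n (a : R) (x : 'cV[C]_n) : norm2 (a%:C *: x) = `|a| * norm2 x.
Proof.
apply/eqP; rewrite -(@eqrXn2 _ 2)// ?mulr_ge0 ?norm2_ge0// exprMn !sqr_norm2.
by rewrite dotZl dotZr real_normK ?num_real// mulrA expr2.
Qed.

(** Optimizing the free weight [t] gives the Cauchy-Schwarz inequality [dot_CS]. *)
Lemma dot_young n (t : R) (x y : 'cV[C]_n) : 0 < t ->
  2 * dot x y <= t * dot x x + t^-1 * dot y y.
Proof.
move=> t0; have := dot_ge0 ((t%:C) *: x - y).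
rewrite dotBl !dotBr !dotZl !dotZr (dotC y x) => h.
rewrite -(ler_pM2l t0) mulrDr [t * (t^-1 * _)]mulrA divff ?gt_eqF// mul1r.
lra.
Qed.

Lemma dot_CS n (x y : 'cV[C]_n) : `|dot x y| <= norm2 x * norm2 y.
Proof.
suff main (z : 'cV[C]_n) : dot z y <= norm2 z * norm2 y.
  rewrite ler_norml main andbT lerNl -dotNl.
  have -> : norm2 x = norm2 (- x).
    apply/eqP; rewrite -(@eqrXn2 _ 2)// ?norm2_ge0// !sqr_norm2.
    by rewrite dotNl dotNr opprK.
  exact: main.
have [-> |z0] := eqVneq z 0.
  by rewrite dot0l mulr_ge0 ?norm2_ge0.
have [-> |y0] := eqVneq y 0.
  by rewrite dot0r mulr_ge0 ?norm2_ge0.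
have nz := norm2_gt0 z0.
have ny := norm2_gt0 y0.
have := dot_young z y (divr_gt0 ny nz); rewrite -!sqr_norm2.
have -> : norm2 y / norm2 z * norm2 z ^+ 2 + (norm2 y / norm2 z)^-1 * norm2 y ^+ 2
  = 2 * (norm2 z * norm2 y) by field; rewrite ?gt_eqF.
lra.
Qed.

Lemma norm2D n (x y : 'cV[C]_n) : norm2 (x + y) <= norm2 x + norm2 y.
Proof.
rewrite -(@ler_pXn2r _ 2)// ?nnegrE ?addr_ge0 ?norm2_ge0//.
rewrite sqr_norm2 dotDl !dotDr (dotC y x) -!sqr_norm2.
by have := dot_CS x y; rewrite ler_norml => /andP[_ h]; lra.
Qed.

Lemma norm2_col n m (x : 'cV[C]_n) (y : 'cV[C]_m) :
  norm2 (col_mx x y) ^+ 2 = norm2 x ^+ 2 + norm2 y ^+ 2.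
Proof. by rewrite !sqr_norm2 dot_col. Qed.

Lemma norm2_colu n m (x : 'cV[C]_n) (y : 'cV[C]_m) : norm2 x <= norm2 (col_mx x y).
Proof.
by rewrite -(@ler_pXn2r _ 2)// ?nnegrE ?norm2_ge0// norm2_col lerDl sqr_ge0.
Qed.

Lemma norm2_cold n m (x : 'cV[C]_n) (y : 'cV[C]_m) : norm2 y <= norm2 (col_mx x y).
Proof.
by rewrite -(@ler_pXn2r _ 2)// ?nnegrE ?norm2_ge0// norm2_col lerDr sqr_ge0.
Qed.

Lemma normc_le_norm2 n (x : 'cV[C]_n) i : Normc.normc (x i 0) <= norm2 x.
Proof.
rewrite -(@ler_pXn2r _ 2)// ?nnegrE ?norm2_ge0//; last first.
  by case: (x i 0) => a b; rewrite sqrtr_ge0.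
rewrite sqr_norm2 dotxx normc_sqrE (bigD1 i)//= lerDl.
by rewrite sumr_ge0// => j _; rewrite addr_ge0 ?sqr_ge0.
Qed.

Lemma normc_real (x : R) : Normc.normc x%:C = `|x|.
Proof. by rewrite /Normc.normc /= expr0n addr0 sqrtr_sqr. Qed.

Lemma normc_sum (I : Type) (s : seq I) (F : I -> C) :
  Normc.normc (\sum_(i <- s) F i) <= \sum_(i <- s) Normc.normc (F i).
Proof.
elim/big_ind2 : _ => //; first by rewrite Normc.normc0.
by move=> a b c e ab ce; apply: le_trans (lerD ab ce); exact: le_normcD.
Qed.

Lemma normc_ge0 (z : C) : 0 <= Normc.normc z.
Proof. by case: z => a b; rewrite sqrtr_ge0. Qed.

Lemma opnorm_has_sup n m (A : 'M[C]_(n, m)) :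
  has_sup [set norm2 (A *m x) | x in [set x : 'cV[C]_m | norm2 x <= 1]].
Proof.
split.
  by exists (norm2 (A *m (0 : 'cV[C]_m))); exists 0; rewrite //= norm2_0 ler01.
pose B := \sum_i \sum_j Normc.normc (A i j).
have B0 : 0 <= B by rewrite sumr_ge0// => i _; rewrite sumr_ge0// => j _; exact: normc_ge0.
exists (Num.sqrt (n%:R * B ^+ 2)) => _ [x /= x1 <-].
rewrite ler_sqrt ?mulr_ge0 ?sqr_ge0//.
have -> : n%:R * B ^+ 2 = \sum_(i < n) B ^+ 2.
  by rewrite sumr_const card_ord mulr_natl.
apply: ler_sum => i _; rewrite big_ord1 ler_pXn2r ?nnegrE ?normc_ge0//.
rewrite mxE (le_trans (normc_sum _ _))//.
rewrite /B (bigD1 i)//= -[leLHS]addr0 lerD//; last first.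
  by rewrite sumr_ge0// => k _; rewrite sumr_ge0// => j _; exact: normc_ge0.
apply: ler_sum => j _; rewrite Normc.normcM ler_piMr ?normc_ge0//.
exact: le_trans (normc_le_norm2 _ _) x1.
Qed.

Lemma norm2_mulmx n m (A : 'M[C]_(n, m)) (x : 'cV[C]_m) :
  norm2 (A *m x) <= opnorm A * norm2 x.
Proof.
have [-> |x0] := eqVneq x 0.
  by rewrite mulmx0 !norm2_0 mulr0.
have nx := norm2_gt0 x0.
rewrite -ler_pdivrMr//.
have -> : norm2 (A *m x) / norm2 x = norm2 (A *m ((norm2 x)^-1%:C *: x)).
  by rewrite -scalemxAr norm2Z mulrC gtr0_norm ?invr_gt0.
apply: sup_upper_bound; first exact: opnorm_has_sup.
exists ((norm2 x)^-1%:C *: x) => //=.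
by rewrite norm2Z gtr0_norm ?invr_gt0// mulVf ?gt_eqF.
Qed.

Lemma dot_isometry n k (Q : 'M[C]_(n, k)) (x y : 'cV[C]_k) : stiefel Q ->
  dot (Q *m x) (Q *m y) = dot x y.
Proof. by move=> Q1; rewrite dot_mulmxl mulmxA Q1 mul1mx. Qed.

Lemma bessel n k (Q : 'M[C]_(n, k)) (x : 'cV[C]_n) : stiefel Q ->
  dot (Q^t* *m x) (Q^t* *m x) <= dot x x.
Proof.
move=> Q1; have := dot_ge0 (x - Q *m (Q^t* *m x)).
rewrite dotBl !dotBr dot_isometry// dot_mulmxl -dot_mulmxr.
by rewrite [dot x (Q *m _)]dot_mulmxr; lra.
Qed.

Lemma posdef_unitmx n (A : 'M[C]_n) :
  (forall x, x != 0 -> 0 < dot x (A *m x)) -> A \in unitmx.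
Proof.
move=> A0; rewrite -unitmx_tr -row_free_unit -kermx_eq0.
apply/negPn/negP => /rowV0Pn[v /sub_kermxP vA v0].
have : A *m v^T = 0 by rewrite -[A]trmxK -trmx_mul vA trmx0.
have vT0 : v^T != 0.
  by apply: contra v0 => /eqP h; rewrite -[v]trmxK h trmx0.
by move=> Av; have := A0 _ vT0; rewrite Av dot.unlock mulmx0 mxE ltxx.
Qed.

(** A dimension count: among the vectors carried by the first [j + 1] coordinates,
[j] linear equations have a nonzero solution. *)
Lemma kernel_vector n (j : 'I_n) (L : 'I_n -> 'rV[C]_n) :
  exists c : 'cV[C]_n, [/\ c != 0, forall k : 'I_n, (j < k)%N -> c k 0 = 0
    & forall i : 'I_n, (i < j)%N -> (L i *m c) 0 0 = 0].
Proof.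
(* Row [j] of this square system vanishes, so that it is singular; the rows
   below it say that the solution is carried by the first coordinates. *)
pose D : 'M[C]_n := \matrix_(i < n) (if (i < j)%N then L i
  else if i == j then 0 else delta_mx 0 i).
have : D \notin unitmx.
  rewrite -row_full_unit /row_full neq_ltn; apply/orP; left.
  rewrite -(mxrank_tr D).
  have : ~~ row_free D.
    rewrite -kermx_eq0; apply/rowV0Pn; exists (delta_mx 0 j).
      by apply/sub_kermxP; rewrite -rowE rowK ltnn eqxx.
    apply/eqP => /matrixP/(_ 0 j); rewrite !mxE !eqxx /= => /eqP.
    by rewrite oner_eq0.
  by rewrite /row_free mxrank_tr => ?; rewrite ltn_neqAle rank_leq_row andbT.
rewrite -unitmx_tr -row_free_unit -kermx_eq0 => /rowV0Pn[v /sub_kermxP vD v0].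
have Dv : D *m v^T = 0 by rewrite -[D]trmxK -trmx_mul vD trmx0.
exists v^T; split.
- by apply: contra v0 => /eqP h; rewrite -[v]trmxK h trmx0.
- move=> k jk; have := congr1 (row k) Dv.
  have kj : (k == j) = false by rewrite -val_eqE gtn_eqF.
  rewrite row_mul rowK ltnNge (ltnW jk) kj -rowE => /rowP/(_ 0).
  by rewrite !mxE.
- move=> i ij; have := congr1 (row i) Dv.
  by rewrite row_mul rowK ij row0 => ->; rewrite mxE.
Qed.
End Dot.

(** * Quadratic forms of resolvents *)

Section Resolvent.
Variable R : realType.
Local Notation C := R[i].
Implicit Types n m k : nat.

Lemma trmxC_real_scalar n (x : R) : ((x%:C)%:M : 'M[C]_n)^t* = (x%:C)%:M.
Proof. by rewrite tr_scalar_mx map_scalar_mx; congr (_%:M); exact: conjc_real. Qed.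

Lemma hermitization_herm n m (X : 'M[C]_(n, m)) :
  (hermitization X)^t* = hermitization X.
Proof.
rewrite /hermitization tr_block_mx map_block_mx !trmx0 !map_mx0.
by rewrite -/(X^t*) trmxCK.
Qed.

Lemma cdiag_herm k (s : 'rV[R]_k) : (cdiag s)^t* = cdiag s.
Proof.
rewrite /cdiag tr_diag_mx map_diag_mx; congr diag_mx; apply/rowP => i.
by rewrite !mxE; exact: conjc_real.
Qed.

Lemma dot_cdiag k (s : 'rV[R]_k) (x y : 'cV[C]_k) :
  dot x (cdiag s *m y) = \sum_i s 0 i * (complex.Re (x i 0) * complex.Re (y i 0)
          + complex.Im (x i 0) * complex.Im (y i 0)).
Proof.
rewrite dotE; apply: eq_bigr => i _; rewrite /cdiag mul_diag_mx !mxE.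
by case: (x i 0) => ? ?; case: (y i 0) => ? ? /=; ring.
Qed.

Lemma dot_cdiagC k (s : 'rV[R]_k) (x y : 'cV[C]_k) :
  dot x (cdiag s *m y) = dot (cdiag s *m x) y.
Proof. by rewrite dot_mulmxr cdiag_herm. Qed.

Lemma dot_hermitization n m (X : 'M[C]_(n, m)) (p : 'cV[C]_n) (q : 'cV[C]_m) :
  dot (col_mx p q) (hermitization X *m col_mx p q) = 2 * dot p (X *m q).
Proof.
rewrite /hermitization mul_block_col !mul0mx add0r addr0 dot_col.
by rewrite [dot q _]dot_mulmxr trmxCK [dot _ p]dotC mulr2n mulrDl mul1r.
Qed.

Definition shifted n m (X : 'M[C]_(n, m)) (x : R) : 'M[C]_(n + m) :=
  (x%:C)%:M - hermitization X.

Lemma shifted_herm n m (X : 'M[C]_(n, m)) x : (shifted X x)^t* = shifted X x.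
Proof.
rewrite /shifted linearB /= map_mxB; congr (_ - _); last exact: hermitization_herm.
exact: trmxC_real_scalar.
Qed.

Lemma dot_shifted n m (X : 'M[C]_(n, m)) x (p : 'cV[C]_n) (q : 'cV[C]_m) :
  dot (col_mx p q) (shifted X x *m col_mx p q) =
  x * (dot p p + dot q q) - 2 * dot p (X *m q).
Proof.
by rewrite /shifted mulmxBl dotBr dot_hermitization mul_scalar_mx dotZr dot_col.
Qed.

(** Since the spectrum of the hermitization lies in [[- opnorm X, opnorm X]], this
makes [shifted X x] positive definite for [x > opnorm X]. *)
Lemma shifted_ge n m (X : 'M[C]_(n, m)) x (z : 'cV[C]_(n + m)) :
  (x - opnorm X) * dot z z <= dot z (shifted X x *m z).
Proof.
rewrite -[z]vsubmxK dot_shifted dot_col.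
set p := usubmx z; set q := dsubmx z.
have h : 2 * dot p (X *m q) <= opnorm X * (dot p p + dot q q); last by lra.
have := dot_CS p (X *m q); rewrite ler_norml => /andP[_ h1].
have h2 := norm2_mulmx X q.
have h3 : norm2 p * norm2 (X *m q) <= norm2 p * (opnorm X * norm2 q).
  by rewrite ler_wpM2l ?norm2_ge0.
have h4 : 0 <= opnorm X.
  apply: sup_upper_bound; first exact: opnorm_has_sup.
  by exists 0 => /=; rewrite ?mulmx0 norm2_0// ler01.
have h5 := sqr_ge0 (norm2 p - norm2 q).
have h6 : opnorm X * (2 * (norm2 p * norm2 q)) <= opnorm X * (dot p p + dot q q).
  by rewrite ler_wpM2l// -!sqr_norm2; lra.
lra.
Qed.

(** For Hermitian positive [A], the form [y^* (E^* A^-1 E) y] is the maximum over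
[z] of [2 Re (y^* E^* z) - z^* A z], reached at [z = A^-1 E y]. Through this an
upper bound on the compressed resolvent bounds [A] itself from below. *)
Lemma resolvent_young N k (A : 'M[C]_N) (E : 'M[C]_(N, k)) y z :
  A^t* = A -> A \in unitmx -> (forall z, 0 <= dot z (A *m z)) ->
  2 * dot y (E^t* *m z) <= dot y (E^t* *m invmx A *m E *m y) + dot z (A *m z).
Proof.
move=> Ah Au A0.
pose t := invmx A *m (E *m y).
have At : A *m t = E *m y by rewrite /t mulKVmx.
have := A0 (z - t); rewrite mulmxBr At dotBl !dotBr.
have -> : dot t (A *m z) = dot (E *m y) z by rewrite dot_mulmxr Ah At.
have -> : dot y (E^t* *m invmx A *m E *m y) = dot t (E *m y).
  by rewrite -!mulmxA [LHS]dot_mulmxr trmxCK dotC.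
by rewrite [dot y (_ *m z)]dot_mulmxr trmxCK (dotC (E *m y)); lra.
Qed.

(** A finite-difference version of [- G' = E^* A^-2 E]: if [psi = A^-1 E y], the
increment of the compressed resolvent at [y] is [h] times the squared norm of
[psi], up to a second-order term. *)
Lemma resolvent_difference N k (A B : 'M[C]_N) (E : 'M[C]_(N, k)) psi y (h : R) :
  A^t* = A -> B^t* = B -> A \in unitmx -> B \in unitmx -> B = A + (h%:C)%:M ->
  A *m psi = E *m y ->
  dot y (E^t* *m invmx A *m E *m y) - dot y (E^t* *m invmx B *m E *m y) =
  h * dot psi psi - h ^+ 2 * dot psi (invmx B *m psi).
Proof.
move=> Ah Bh Au Bu BA Apsi.
have GE (D : 'M[C]_N) : dot y (E^t* *m D *m E *m y) = dot (E *m y) (D *m (E *m y)).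
  by rewrite -!mulmxA [LHS]dot_mulmxr trmxCK.
have AB : A *m psi = B *m psi - h%:C *: psi.
  by rewrite BA mulmxDl mul_scalar_mx addrK.
have Bi : invmx B *m (E *m y) = psi - h%:C *: (invmx B *m psi).
  by rewrite -Apsi AB mulmxBr mulKmx// scalemxAr.
have BBi : dot (B *m psi) (invmx B *m psi) = dot psi psi.
  by rewrite dotC dot_mulmxr Bh mulKVmx.
rewrite 2!GE Bi -Apsi mulKmx// -dotBr opprB addrC subrK dotZr AB dotBl dotZl BBi.
by rewrite mulrBr mulrA expr2.
Qed.

Lemma frameT_col n m k (U : 'M[C]_(n, k)) (V : 'M[C]_(m, k))
    (p : 'cV[C]_n) (q : 'cV[C]_m) :
  (frame U V)^t* *m col_mx p q = col_mx (U^t* *m p) (V^t* *m q).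
Proof.
rewrite /frame tr_block_mx map_block_mx !trmx0 !map_mx0 mul_block_col.
by rewrite !mul0mx addr0 add0r.
Qed.

End Resolvent.

(** * Singular values and vectors of the perturbed matrix *)

(** A subcritical spike [t] contributes no more than the noise costs. *)
Lemma weighted_young (R : realFieldType) (a a' t y z : R) : 0 < a -> 0 < a' ->
  t ^+ 2 * (a * a') <= 1 -> 2 * (t * (y * z)) <= a^-1 * y ^+ 2 + a'^-1 * z ^+ 2.
Proof.
move=> a0 a'0 ta; have b0 : 0 < a^-1 by rewrite invr_gt0.
rewrite -(ler_pM2l b0) mulrDr.
have h1 := sqr_ge0 (a^-1 * y - t * z).
have h2 : t ^+ 2 * z ^+ 2 <= a^-1 * (a'^-1 * z ^+ 2).
  by rewrite mulrA ler_wpM2r ?sqr_ge0// -invfM -[leRHS]mul1r ler_pdivlMr ?mulr_gt0.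
by move: h1; rewrite sqrrB !exprMn; lra.
Qed.

Section Outliers.
Variable R : realType.
Local Notation C := R[i].
Variables (F : base_field) (n m k : nat).
Variables (X P : 'M[C]_(n, m)) (U : 'M[C]_(n, k)) (s : 'rV[R]_k) (V : 'M[C]_(m, k)).
Variables (Q : 'M[C]_n) (sg : 'rV[R]_n) (T : 'M[C]_(m, n)).
Hypothesis P_svd : is_svd F P U s V.
Hypothesis W_svd : is_svd F (X + P) Q sg T.

Let Q1 : stiefel Q. Proof. by case: W_svd => _ []. Qed.
Let T1 : stiefel T. Proof. by case: W_svd => _ []. Qed.
Let PE : P = U *m cdiag s *m V^t*. Proof. by case: P_svd. Qed.
Let WE : X + P = Q *m cdiag sg *m T^t*. Proof. by case: W_svd. Qed.
Let s_ge0 i : 0 <= s 0 i. Proof. by case: P_svd. Qed.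
Let s_sorted (i j : 'I_k) : (i <= j)%N -> s 0 j <= s 0 i.
Proof. by case: P_svd => _ _ _ + _; exact. Qed.
Let sg_ge0 i : 0 <= sg 0 i. Proof. by case: W_svd. Qed.
Let sg_sorted (i j : 'I_n) : (i <= j)%N -> sg 0 j <= sg 0 i.
Proof. by case: W_svd => _ _ _ + _; exact. Qed.

Local Notation G x := (compressed_resolvent X U V (x%:C)).

Lemma dot_perturbed (p : 'cV[C]_n) (q : 'cV[C]_m) :
  dot p ((X + P) *m q) = dot p (X *m q) + dot (U^t* *m p) (cdiag s *m (V^t* *m q)).
Proof. by rewrite mulmxDl dotDr PE -!mulmxA [in X in _ + X]dot_mulmxr. Qed.

Lemma dot_perturbed_svd (p : 'cV[C]_n) (q : 'cV[C]_m) :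
  dot p ((X + P) *m q) = dot (Q^t* *m p) (cdiag sg *m (T^t* *m q)).
Proof. by rewrite WE -!mulmxA [LHS]dot_mulmxr. Qed.

(** [resolvent_young] at the multiple [diag (1 / a, 1 / a')] of the overlap vector
[E^* (p, q)], the optimal choice when [G x] equals [diag (a, a')]. *)
Lemma compressed_form_le (x : R) (a a' : R) (p : 'cV[C]_n) (q : 'cV[C]_m) :
  opnorm X < x -> shifted X x \in unitmx -> 0 < a -> 0 < a' ->
  (forall y z : 'cV[C]_k, dot (col_mx y z) (G x *m col_mx y z)
     <= a * dot y y + a' * dot z z) ->
  a^-1 * dot (U^t* *m p) (U^t* *m p) + a'^-1 * dot (V^t* *m q) (V^t* *m q) <=
  x * (dot p p + dot q q) - 2 * dot p (X *m q).
Proof.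
move=> xX xu a0 a'0 Gle.
set u := U^t* *m p; set v := V^t* *m q.
have A0 (z : 'cV[C]_(n + m)) : 0 <= dot z (shifted X x *m z).
  by apply: le_trans (shifted_ge X x z); rewrite mulr_ge0 ?dot_ge0 ?subr_ge0 ?ltW.
have := resolvent_young (frame U V) (col_mx (a^-1%:C *: u) (a'^-1%:C *: v))
  (col_mx p q) (shifted_herm X x) xu A0.
rewrite frameT_col dot_col dot_shifted !dotZl -/u -/v.
have := Gle (a^-1%:C *: u) (a'^-1%:C *: v).
rewrite /compressed_resolvent -/(shifted X x) !dotZl !dotZr.
have -> : a * (a^-1 * (a^-1 * dot u u)) = a^-1 * dot u u by rewrite mulVKf ?gt_eqF.
have -> : a' * (a'^-1 * (a'^-1 * dot v v)) = a'^-1 * dot v v by rewrite mulVKf ?gt_eqF.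
lra.
Qed.

(** Suppose [sg 0 j > x]. Some nonzero combination of the first [j + 1] singular
pairs of [X + P] has a left part orthogonal to the first [j] left spike vectors.
There [X + P] is at least [sg 0 j], whereas the noise is bounded by
[compressed_form_le] and the remaining spikes, all subcritical, by
[weighted_young]. *)
Lemma outlier_le (x a a' : R) (j : 'I_n) :
  opnorm X < x -> shifted X x \in unitmx -> 0 < a -> 0 < a' ->
  (forall y z : 'cV[C]_k, dot (col_mx y z) (G x *m col_mx y z)
     <= a * dot y y + a' * dot z z) ->
  (forall i : 'I_k, (j <= i)%N -> s 0 i ^+ 2 * (a * a') <= 1) ->
  sg 0 j <= x.
Proof.
move=> xX xu a0 a'0 Gle spk; rewrite leNgt; apply/negP => xj.
(* There may be fewer than [j] spikes; the missing equations are void. *)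
have [c [c0 cj Lc]] := kernel_vector j
  (fun i : 'I_n => oapp (fun i' : 'I_k => row i' (U^t* *m Q)) 0 (insub (i : nat))).
pose p := Q *m c; pose q := T *m c.
have pp : dot p p = dot c c by rewrite dot_isometry.
have qq : dot q q = dot c c by rewrite dot_isometry.
have up (i : 'I_k) : (i < j)%N -> (U^t* *m p) i 0 = 0.
  move=> ij; have := Lc (Ordinal (ltn_trans ij (ltn_ord j))) ij.
  rewrite [insub _](valK i) => <-.
  by rewrite /= -row_mul [in RHS]mxE -mulmxA.
have := compressed_form_le p q xX xu a0 a'0 Gle.
set u := U^t* *m p; set v := V^t* *m q; rewrite pp qq.
have -> : dot p (X *m q) = dot p ((X + P) *m q) - dot u (cdiag s *m v).
  by rewrite dot_perturbed addrK.
have Wpq : sg 0 j * dot c c <= dot p ((X + P) *m q).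
  rewrite dot_perturbed_svd /p /q mulmxA Q1 [T^t* *m _]mulmxA T1 !mul1mx.
  rewrite dot_cdiag dotxx mulr_sumr.
  apply: ler_sum => i _; rewrite -!expr2.
  have [ij|ji] := leqP i j; last by rewrite cj//= expr0n /= addr0 !mulr0.
  by rewrite ler_wpM2r ?sg_sorted// addr_ge0 ?sqr_ge0.
have cc := dot_gt0 c0.
have xc : x * dot c c < sg 0 j * dot c c by rewrite ltr_pM2r.
suff : 2 * dot u (cdiag s *m v) <= a^-1 * dot u u + a'^-1 * dot v v by lra.
rewrite dot_cdiag !dotxx !mulr_sumr -big_split /=; apply: ler_sum => i _.
have [ji|ij] := leqP j i; last first.
  rewrite up//= !mul0r addr0 !mulr0 expr0n/= addr0 mulr0 add0r.
  by rewrite mulr_ge0 ?addr_ge0 ?sqr_ge0// invr_ge0 ltW.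
move: (spk i ji) (s_ge0 i); move: (s 0 i) (u i 0) (v i 0) => t [ur ui] [vr vi] /= ta t0.
have := weighted_young ur vr a0 a'0 ta; have := weighted_young ui vi a0 a'0 ta.
by lra.
Qed.

Lemma compressed_form_ge_unitmx (x a a' : R) : 0 < a -> 0 < a' ->
  (forall y z : 'cV[C]_k, a * dot y y + a' * dot z z <=
     dot (col_mx y z) (G x *m col_mx y z)) ->
  G x \in unitmx.
Proof.
move=> a0 a'0 Gge; apply: posdef_unitmx => y y0; rewrite -[y]vsubmxK.
apply: lt_le_trans (Gge _ _).
have := dot_gt0 y0; rewrite -{1 2}[y]vsubmxK dot_col.
move: (dot_ge0 (usubmx y)) (dot_ge0 (dsubmx y)).
move: (dot (usubmx y) _) (dot (dsubmx y) _) => b c b0 c0.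
have [-> |ne _] := eqVneq b 0; first by rewrite add0r mulr0 add0r; exact: mulr_gt0.
by rewrite ltr_pwDl ?mulr_ge0 ?(ltW a'0)// mulr_gt0// lt_neqAle eq_sym ne.
Qed.

(** The columns of [Z] are the vectors [A^-1 E y] with prescribed projections
[E^* Z] to the spike directions; among all vectors with these projections they
minimize the form of [A]. *)
Lemma compressed_lift (x : R) (S : 'M[C]_(k + k, k)) :
  shifted X x \in unitmx -> G x \in unitmx ->
  exists Z Y, [/\ shifted X x *m Z = frame U V *m Y, G x *m Y = S
                & (frame U V)^t* *m Z = S].
Proof.
move=> xu Gu; exists (invmx (shifted X x) *m (frame U V *m (invmx (G x) *m S))).
exists (invmx (G x) *m S); rewrite !mulKVmx//; split => //.
by rewrite [LHS]mulmxA [LHS]mulmxA -/(compressed_resolvent X U V (x%:C)) mulKVmx.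
Qed.

(** Trial vectors [psi = (p, q)] with [E^* psi = (sqrt a al, sqrt a' al)], where
[al] is carried by the first [i + 1] spikes. On them the lower bound on [G x]
makes the form of [A x] at most [2 |al| ^ 2], and the supercritical spikes
contribute more than that; hence the perturbed linearization exceeds [x] at
[psi]. The dimension count allows [p] to be orthogonal to the first [j] left
singular vectors of [X + P], where the perturbed linearization is at most
[sg 0 j]. *)
Lemma outlier_gt (x a a' : R) (i : 'I_k) (j : 'I_n) : (i = j :> nat) ->
  opnorm X < x -> shifted X x \in unitmx -> 0 < a -> 0 < a' ->
  (forall y z : 'cV[C]_k, a * dot y y + a' * dot z z <=
     dot (col_mx y z) (G x *m col_mx y z)) ->
  (forall l : 'I_k, (l <= i)%N -> 1 < s 0 l ^+ 2 * (a * a')) ->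
  x < sg 0 j.
Proof.
move=> ij xX xu a0 a'0 Gge spk; rewrite ltNge; apply/negP => jx.
have Gu := compressed_form_ge_unitmx a0 a'0 Gge.
have [ra ra0 raE] : exists2 r : R, 0 < r & r ^+ 2 = a.
  by exists (Num.sqrt a); rewrite ?sqrtr_gt0// sqr_sqrtr// ltW.
have [ra' ra'0 ra'E] : exists2 r : R, 0 < r & r ^+ 2 = a'.
  by exists (Num.sqrt a'); rewrite ?sqrtr_gt0// sqr_sqrtr// ltW.
have [Z [Y [AZ GY FZ]]] := compressed_lift (col_mx (ra%:C)%:M (ra'%:C)%:M) xu Gu.
have [al [al0 ali Lal]] := kernel_vector i
  (fun l : 'I_k => oapp (fun l' : 'I_n => row l' (Q^t* *m usubmx Z)) 0
     (insub (l : nat))).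
have [p [q [pE qE]]] : exists p q, p = usubmx Z *m al /\ q = dsubmx Z *m al.
  by eexists; eexists.
have psiE : Z *m al = col_mx p q by rewrite pE qE -mul_col_mx vsubmxK.
have [y yE] : exists y, y = Y *m al by eexists.
have Sal : col_mx (ra%:C)%:M (ra'%:C)%:M *m al = col_mx (ra%:C *: al) (ra'%:C *: al).
  by rewrite mul_col_mx !mul_scalar_mx.
have Apsi : shifted X x *m col_mx p q = frame U V *m y.
  by rewrite -psiE mulmxA AZ -mulmxA yE.
have Gy : G x *m y = col_mx (ra%:C *: al) (ra'%:C *: al).
  by rewrite yE mulmxA GY Sal.
have [uE vE] : U^t* *m p = ra%:C *: al /\ V^t* *m q = ra'%:C *: al.
  by apply/eq_col_mx; rewrite -frameT_col -psiE mulmxA FZ Sal.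
have pk (l : 'I_n) : (l < j)%N -> (Q^t* *m p) l 0 = 0.
  move=> lj; have lk : (l < k)%N by rewrite (ltn_trans lj)// -ij ltn_ord.
  have li : (Ordinal lk < i)%N by rewrite /= ij.
  have := Lal (Ordinal lk) li; rewrite [insub _](valK l) => <-.
  by rewrite /= -row_mul [in RHS]mxE pE mulmxA.
have form1 : x * (dot p p + dot q q) - 2 * dot p (X *m q) =
    ra * dot (usubmx y) al + ra' * dot (dsubmx y) al.
  rewrite -dot_shifted Apsi dotC dot_mulmxl frameT_col uE vE.
  by rewrite -[y in LHS]vsubmxK dot_col !dotZr.
have form2 : ra * dot (usubmx y) al + ra' * dot (dsubmx y) al <= 2 * dot al al.
  have := Gge (usubmx y) (dsubmx y); rewrite vsubmxK Gy.
  rewrite -[y in X in _ <= X -> _]vsubmxK dot_col !dotZr.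
  move: (usubmx y) (dsubmx y) => y1 y2.
  have := dot_ge0 (ra%:C *: y1 - al); have := dot_ge0 (ra'%:C *: y2 - al).
  rewrite 2!dotBl 4!dotBr 4!dotZl 4!dotZr (dotC al y1) (dotC al y2).
  rewrite -raE -ra'E.
  move: (dot y1 y1) (dot y1 al) (dot y2 y2) (dot y2 al) (dot al al) => e1 e2 e3 e4 e5.
  lra.
have sq1 (l : 'I_k) : (ra * ra' * s 0 l) ^+ 2 = s 0 l ^+ 2 * (a * a').
  by rewrite !exprMn raE ra'E mulrC.
have sp0 (l : 'I_k) : 0 <= ra * ra' * s 0 l by rewrite !mulr_ge0// ltW.
have form3 : dot al al < ra * ra' * dot al (cdiag s *m al).
  rewrite dot_cdiag dotxx mulr_sumr.
  have ge (l : 'I_k) : complex.Re (al l 0) ^+ 2 + complex.Im (al l 0) ^+ 2 <=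
    ra * ra' * (s 0 l * (complex.Re (al l 0) * complex.Re (al l 0)
          + complex.Im (al l 0) * complex.Im (al l 0))).
    have [li|il] := leqP l i; last by rewrite ali//= expr0n /= !mul0r addr0 !mulr0.
    rewrite -!expr2 mulrA ler_peMl ?addr_ge0 ?sqr_ge0//.
    by rewrite -(@ler_pXn2r _ 2)// ?nnegrE// expr1n sq1 ltW// spk.
  have [l l0] : exists l : 'I_k, al l 0 != 0.
    by apply/existsP; apply: contraR al0; rewrite negb_exists => /forallP h;
      apply/eqP/colP => l; rewrite mxE; apply/eqP; have := h l; rewrite negbK.
  have li : (l <= i)%N by rewrite leqNgt; apply: contra l0 => il; rewrite ali.
  rewrite (bigD1 l)//= [ltRHS](bigD1 l)//= ltr_leD ?ler_sum//.
  rewrite -!expr2 mulrA ltr_pMl.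
    by rewrite -(@ltr_pXn2r _ 2)// ?nnegrE// expr1n sq1 spk.
  rewrite lt_neqAle addr_ge0 ?sqr_ge0// andbT eq_sym paddr_eq0 ?sqr_ge0//.
  rewrite !sqrf_eq0; apply: contra l0 => /andP[].
  by case: (al l 0) => ? ? /= /eqP-> /eqP->.
have form4 : 2 * dot p ((X + P) *m q) <= x * (dot p p + dot q q).
  rewrite dot_perturbed_svd dot_cdiag.
  have b1 := bessel p Q1; have b2 := bessel q T1.
  have x0 : 0 <= x by apply: le_trans (sg_ge0 j) jx.
  have b3 : x * (dot (Q^t* *m p) (Q^t* *m p) + dot (T^t* *m q) (T^t* *m q)) <=
    x * (dot p p + dot q q) by rewrite ler_wpM2l ?lerD.
  apply: le_trans b3; rewrite !dotxx -big_split !mulr_sumr /=; apply: ler_sum => l _.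
  move: (pk l); case: (leqP j l) => [jl _|_ ->//]; last first.
    by rewrite /= !mul0r addr0 !mulr0 mulr_ge0// !addr_ge0 ?sqr_ge0.
  move: ((Q^t* *m p) l 0) ((T^t* *m q) l 0) => [ur ui] [vr vi] /=.
  have slx : sg 0 l <= x := le_trans (sg_sorted jl) jx.
  have h1 := sqr_ge0 (ur - vr); have h2 := sqr_ge0 (ui - vi).
  apply: (@le_trans _ _ (sg 0 l * (ur ^+ 2 + ui ^+ 2 + (vr ^+ 2 + vi ^+ 2)))).
    rewrite mulrCA ler_wpM2l//; lra.
  by rewrite ler_wpM2r// !addr_ge0 ?sqr_ge0.
have form5 : dot (U^t* *m p) (cdiag s *m (V^t* *m q)) =
    ra * ra' * dot al (cdiag s *m al).
  by rewrite uE vE -scalemxAr dotZl dotZr mulrA.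
have := dot_perturbed p q; rewrite form5.
by lra.
Qed.

Section Eigenvector.
Variable j : 'I_n.
Let lam := sg 0 j.
Let u : 'cV[C]_k := U^t* *m col j Q.
Let v : 'cV[C]_k := V^t* *m col j T.
Let psi : 'cV[C]_(n + m) := col_mx (col j Q) (col j T).
Let y : 'cV[C]_(k + k) := col_mx (cdiag s *m v) (cdiag s *m u).

Lemma dot_stiefel_col N l (B : 'M[C]_(N, l)) (i : 'I_l) :
  stiefel B -> dot (col i B) (col i B) = 1.
Proof.
move=> B1; have -> : col i B = B *m delta_mx i 0 by rewrite colE.
rewrite dot_isometry// dotxx (bigD1 i)//= big1 ?addr0 => [|l' /negPf li].
  by rewrite mxE !eqxx /= expr1n expr0n addr0.
by rewrite mxE li /= expr0n addr0.
Qed.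

(** The equations of a singular pair, with the noise on the left and the
perturbation, written in terms of the overlaps [u] and [v], on the right. *)
Lemma singular_equation : shifted X lam *m psi = frame U V *m y.
Proof.
have Wt : (X + P) *m col j T = lam%:C *: col j Q.
  have e : (X + P) *m T = Q *m cdiag sg by rewrite WE -!mulmxA T1 mulmx1.
  rewrite !colE mulmxA e -!colE /cdiag mul_mx_diag; apply/colP => i.
  by rewrite !mxE mulrC.
have Wq : (X + P)^t* *m col j Q = lam%:C *: col j T.
  have e : (X + P)^t* *m Q = T *m cdiag sg.
    by rewrite WE !trmxCM trmxCK cdiag_herm -!mulmxA Q1 mulmx1.
  rewrite !colE mulmxA e -!colE /cdiag mul_mx_diag; apply/colP => i.
  by rewrite !mxE mulrC.
have e1 : X *m col j T = lam%:C *: col j Q - U *m (cdiag s *m v).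
  by rewrite -Wt mulmxDl PE /v !mulmxA addrK.
have e2 : X^t* *m col j Q = lam%:C *: col j T - V *m (cdiag s *m u).
  rewrite -Wq linearD /= map_mxD mulmxDl PE !trmxCM trmxCK cdiag_herm.
  by rewrite /u !mulmxA addrK.
rewrite /shifted /psi mulmxBl mul_scalar_mx /hermitization /frame.
rewrite !mul_block_col !mul0mx !addr0 !add0r e1 e2 scale_col_mx.
by rewrite opp_col_mx add_col_mx !opprB; congr col_mx; rewrite addrC subrK.
Qed.

Hypothesis lam_unit : shifted X lam \in unitmx.

Lemma psi_resolvent : psi = invmx (shifted X lam) *m (frame U V *m y).
Proof. by rewrite -singular_equation mulKmx. Qed.

(** Projecting [singular_equation] to the spike directions gives a closed equation
for the overlaps, since [y] depends on them only. *)
Lemma compressed_eigenvector : G lam *m y = col_mx u v.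
Proof.
rewrite /compressed_resolvent -/(shifted X lam) -!mulmxA -psi_resolvent.
by rewrite frameT_col.
Qed.

(** This is the normalization of the singular pair, [dot psi psi = 2], as seen by
the compressed resolvent. A difference quotient is used instead of a derivative
because the approximation of [G] is only uniform. *)
Lemma compressed_difference (h b : R) : 0 < h -> 0 < b -> b <= lam + h - opnorm X ->
  shifted X (lam + h) \in unitmx ->
  2 * h - 2 * (h ^+ 2 / b) <= dot y (G lam *m y) - dot y (G (lam + h) *m y)
    <= 2 * h.
Proof.
move=> h0 b0 hb hu.
have psi2 : dot psi psi = 2 by rewrite dot_col !dot_stiefel_col.
have [z zE] : exists z, shifted X (lam + h) *m z = psi.
  by exists (invmx (shifted X (lam + h)) *m psi); rewrite mulKVmx.
have BA : shifted X (lam + h) = shifted X lam + (h%:C)%:M.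
  by rewrite /shifted rmorphD /= raddfD /= addrAC.
have := resolvent_difference (shifted_herm X lam) (shifted_herm X (lam + h))
  lam_unit hu BA singular_equation.
rewrite -zE (mulKmx hu) zE psi2 [h * 2]mulrC /compressed_resolvent => ->.
have zp : b * dot z z <= dot psi z.
  rewrite -[in leRHS]zE [leRHS]dotC; apply: le_trans (shifted_ge X (lam + h) z).
  by rewrite ler_wpM2r ?dot_ge0.
have zp0 : 0 <= dot psi z by apply: le_trans zp; rewrite mulr_ge0 ?dot_ge0 ?ltW.
have := dot_young z psi b0; rewrite psi2 (dotC z) => yg.
have zb : dot psi z <= 2 / b by rewrite mulrC; lra.
apply/andP; split; last by rewrite gerBl mulr_ge0 ?sqr_ge0.
rewrite lerD2l lerN2 mulrCA ler_wpM2l ?sqr_ge0//.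
Qed.
End Eigenvector.

End Outliers.

(** * Overlap estimates for one outlier *)

(** The masses nearly solve the linear system [a A1 = a' A2],
[d1 A1 + d2 A2 = 2], of determinant [d1 a' + a d2]. The second equation is
available only with the divided differences [D1], [D2] at step [h] in place of
[d1], [d2], and after a division by [h]; an error [e <= h ^ 2] in the compressed
resolvent then costs [O(h)]. Errors are relative to the total mass [A1 + A2],
which is bounded because [D1], [D2] are bounded below. *)
Lemma mass_estimate (R : realFieldType) (B k be : R) : 0 < B -> 0 < k -> 0 < be ->
  exists C h0 : R, [/\ 0 < C, 0 < h0 & forall a a' d1 d2 D1 D2 A1 A2 h e : R,
    0 < h -> h <= h0 -> 0 <= e -> e <= h ^+ 2 ->
    0 <= a -> 0 <= a' -> a <= B -> a' <= B ->
    0 <= d1 -> 0 <= d2 -> d1 <= B -> d2 <= B -> k <= D1 -> k <= D2 ->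
    `|D1 - d1| <= B * h -> `|D2 - d2| <= B * h -> 0 <= A1 -> 0 <= A2 ->
    `|a * A1 - a' * A2| <= 2 * e * (A1 + A2) ->
    `|h * D1 * A1 + h * D2 * A2 - 2 * h| <= 2 * (h ^+ 2 / be) + 2 * e * (A1 + A2) ->
    [/\ A1 + A2 <= C, `|(d1 * a' + a * d2) * A1 - 2 * a'| <= C * h
      & `|(d1 * a' + a * d2) * A2 - 2 * a| <= C * h]].
Proof.
move=> B0 k0 be0; pose Y0 := 8 / k.
have Y00 : 0 < Y0 by rewrite divr_gt0.
pose c1 := 2 / be + (2 + B) * Y0.
have c10 : 0 < c1.
  by rewrite addr_gt0 ?divr_gt0// mulr_gt0// addr_gt0.
pose C := Y0 + B * c1 + B * (2 * Y0).
have C0 : 0 < C.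
  by apply: addr_gt0; [apply: addr_gt0 => //|]; apply: mulr_gt0 => //; exact: mulr_gt0.
(* For [h <= be] and [h <= k / 4] the normalization gives [k Y <= 4 + k Y / 2] for
   the total mass [Y], hence the bound [Y0]. *)
exists C, (Num.min 1 (Num.min (k / 4) be)); split => //.
  by rewrite !lt_min ltr01 be0 andbT divr_gt0.
move=> a a' d1 d2 D1 D2 A1 A2 h e h0; rewrite !le_min => /and3P[h1 hk hbe] e0 eh.
move=> a0 a'0 aB a'B d10 d20 d1B d2B kD1 kD2 Dd1 Dd2 A10 A20 H1 H2.
set Y := A1 + A2 in H1 H2 *.
have Yp : 0 <= Y by rewrite addr_ge0.
have hbe' : h / be <= 1 by rewrite ler_pdivrMr// mul1r.
have eY : e * Y <= h ^+ 2 * Y by rewrite ler_wpM2r.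
have h2h : h ^+ 2 * Y <= h * Y.
  by rewrite ler_wpM2r// expr2 ler_piMr// ltW.
(* The normalization divided by [h]. *)
have H3 : `|D1 * A1 + D2 * A2 - 2| <= 2 * (h / be) + 2 * h * Y.
  rewrite -(ler_pM2l h0) -{1}(gtr0_norm h0) -normrM.
  have -> : h * (D1 * A1 + D2 * A2 - 2) = h * D1 * A1 + h * D2 * A2 - 2 * h by ring.
  apply: le_trans H2 _.
  have -> : h * (2 * (h / be) + 2 * h * Y) = 2 * (h ^+ 2 / be) + 2 * (h ^+ 2 * Y).
    by ring.
  lra.
have kY : k * Y <= D1 * A1 + D2 * A2.
  by rewrite /Y mulrDr lerD// ler_wpM2r.
have hkY : h * Y <= k / 4 * Y by rewrite ler_wpM2r.
have YY0 : Y <= Y0.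
  rewrite /Y0 ler_pdivlMr//; move: H3; rewrite ler_norml => /andP[_ H3]; lra.
have hY : h * Y <= h * Y0 by rewrite ler_wpM2l// ltW.
have E1 : `|d1 * A1 + d2 * A2 - 2| <= c1 * h.
  have -> : d1 * A1 + d2 * A2 - 2 = (D1 * A1 + D2 * A2 - 2)
     - ((D1 - d1) * A1 + (D2 - d2) * A2) by ring.
  apply: le_trans (ler_normB _ _) _.
  have : `|(D1 - d1) * A1 + (D2 - d2) * A2| <= B * h * Y.
    apply: le_trans (ler_normD _ _) _; rewrite !normrM (ger0_norm A10) (ger0_norm A20).
    by rewrite /Y mulrDr lerD// ler_wpM2r.
  have : B * (h * Y) <= B * (h * Y0) by rewrite ler_wpM2l// ltW.
  have -> : c1 * h = 2 * (h / be) + 2 * (h * Y0) + B * (h * Y0) by rewrite /c1; ring.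
  lra.
have F1 : `|a * A1 - a' * A2| <= 2 * Y0 * h by lra.
have BE : B * `|d1 * A1 + d2 * A2 - 2| <= B * (c1 * h) by rewrite ler_wpM2l// ltW.
have BF : B * `|a * A1 - a' * A2| <= B * (2 * Y0 * h) by rewrite ler_wpM2l// ltW.
have CE : C * h = Y0 * h + B * (c1 * h) + B * (2 * Y0 * h) by rewrite /C; ring.
have Yh : 0 <= Y0 * h by rewrite mulr_ge0// ltW.
split.
- have Bc1 := mulr_gt0 B0 c10; have BY0 := mulr_gt0 B0 Y00.
  by apply: le_trans YY0 _; rewrite /C; lra.
- have -> : (d1 * a' + a * d2) * A1 - 2 * a' =
    a' * (d1 * A1 + d2 * A2 - 2) + d2 * (a * A1 - a' * A2) by ring.
  apply: le_trans (ler_normD _ _) _; rewrite !normrM (ger0_norm a'0) (ger0_norm d20).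
  have h3 : a' * `|d1 * A1 + d2 * A2 - 2| <= B * `|d1 * A1 + d2 * A2 - 2|.
    by rewrite ler_wpM2r.
  have h4 : d2 * `|a * A1 - a' * A2| <= B * `|a * A1 - a' * A2| by rewrite ler_wpM2r.
  rewrite CE; lra.
- have -> : (d1 * a' + a * d2) * A2 - 2 * a =
    a * (d1 * A1 + d2 * A2 - 2) - d1 * (a * A1 - a' * A2) by ring.
  apply: le_trans (ler_normB _ _) _; rewrite !normrM (ger0_norm a0) (ger0_norm d10).
  have h3 : a * `|d1 * A1 + d2 * A2 - 2| <= B * `|d1 * A1 + d2 * A2 - 2|.
    by rewrite ler_wpM2r.
  have h4 : d1 * `|a * A1 - a' * A2| <= B * `|a * A1 - a' * A2| by rewrite ler_wpM2r.
  rewrite CE; lra.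
Qed.

Lemma difference_bound (R : realFieldType) (g1 g2 a a' b b' A1 A2 h q e : R) :
  2 * h - 2 * q <= g1 - g2 <= 2 * h ->
  `|g1 - (a * A1 + a' * A2)| <= e * (A1 + A2) ->
  `|g2 - (b * A1 + b' * A2)| <= e * (A1 + A2) ->
  `|(a - b) * A1 + (a' - b') * A2 - 2 * h| <= 2 * q + 2 * e * (A1 + A2).
Proof.
move=> /andP[p5 p6]; rewrite !ler_norml => /andP[p1 p2] /andP[p3 p4].
by apply/andP; split; lra.
Qed.

Section ComplexDot.
Variable R : realType.
Local Notation C := R[i].

Lemma normc_le_ReIm (z : C) : Normc.normc z <= `|complex.Re z| + `|complex.Im z|.
Proof.
rewrite -(@ler_pXn2r _ 2)// ?nnegrE ?normc_ge0 ?addr_ge0// normc_sqrE sqrrD.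
rewrite !real_normK ?num_real//.
by rewrite -addrA lerD2l lerDr mulrn_wge0// mulr_ge0.
Qed.

Lemma normc_form_le n (x y : 'cV[C]_n) :
  Normc.normc ((x^t* *m y) 0 0) <= 2 * (norm2 x * norm2 y).
Proof.
apply: le_trans (normc_le_ReIm _) _.
have h1 : `|complex.Re ((x^t* *m y) 0 0)| <= norm2 x * norm2 y.
  by have := dot_CS x y; rewrite dot.unlock.
have h2 : `|complex.Im ((x^t* *m y) 0 0)| <= norm2 x * norm2 y.
  have -> : norm2 y = norm2 ('i%C *: y).
    apply/eqP; rewrite -(@eqrXn2 _ 2)// ?norm2_ge0// !sqr_norm2 !dotxx.
    apply/eqP/eq_bigr => i _; rewrite mxE; case: (y i 0) => ? ? /=; ring.
  have := dot_CS x ('i%C *: y); rewrite dot.unlock -scalemxAr mxE.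
  by case: ((x^t* *m y) 0 0) => p q /=; rewrite mul0r mul1r sub0r normrN.
lra.
Qed.

Lemma form_dotxx n (x : 'cV[C]_n) : (x^t* *m x) 0 0 = (dot x x)%:C.
Proof.
rewrite dot.unlock; have : complex.Im ((x^t* *m x) 0 0) = 0; last first.
  by case: ((x^t* *m x) 0 0) => ? ? /= ->.
rewrite mxE raddf_sum big1//= => i _; rewrite !mxE.
by case: (x i 0) => p q /=; ring.
Qed.
End ComplexDot.

Section Overlap_estimates.
Variable R : realType.
Local Notation C := R[i].
Variables (k : nat) (s : 'rV[R]_k) (u v yL yR : 'cV[C]_k) (e a a' : R).
Hypotheses (s_ge0 : forall i, 0 <= s 0 i) (yLE : yL = cdiag s *m v)
  (yRE : yR = cdiag s *m u).
Hypotheses (e0 : 0 <= e) (a0 : 0 < a) (a'0 : 0 < a').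
Local Notation A1 := (dot yL yL).
Local Notation A2 := (dot yR yR).
Local Notation Y := (norm2 (col_mx yL yR)).
Local Notation err1 := (u - a%:C *: yL).
Local Notation err2 := (v - a'%:C *: yR).
Hypotheses (E1 : norm2 err1 <= e * Y) (E2 : norm2 err2 <= e * Y).

Lemma mass_sqr : Y ^+ 2 = A1 + A2. Proof. by rewrite norm2_col !sqr_norm2. Qed.

Lemma norm2_mass : norm2 yL <= Y /\ norm2 yR <= Y.
Proof. by split; [exact: norm2_colu|exact: norm2_cold]. Qed.

Lemma dot_error_le (x w : 'cV[C]_k) : norm2 x <= e * Y -> norm2 w <= Y ->
  `|dot x w| <= e * (A1 + A2).
Proof.
move=> H1 H2; apply: le_trans (dot_CS _ _) _.
by rewrite -mass_sqr expr2 mulrA ler_pM ?norm2_ge0.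
Qed.

(** Exactly [dot u yL = dot v yR], both being equal to [dot u (cdiag s *m v)];
inserting the approximations of [u] and [v] leaves the two masses. *)
Lemma mass_balance : `|a * A1 - a' * A2| <= 2 * e * (A1 + A2).
Proof.
have [n1 n2] := norm2_mass.
have key : dot u yL = dot v yR by rewrite yLE yRE dot_cdiagC dotC.
have e1 : dot u yL = dot err1 yL + a * A1 by rewrite dotBl dotZl subrK.
have e2 : dot v yR = dot err2 yR + a' * A2 by rewrite dotBl dotZl subrK.
have -> : a * A1 - a' * A2 = dot err2 yR - dot err1 yL by lra.
apply: le_trans (ler_normB _ _) _.
have := dot_error_le E1 n1; have := dot_error_le E2 n2; lra.
Qed.

Lemma sqr_overlap (x y : 'cV[C]_k) (c : R) : 0 <= c ->
  norm2 (x - c%:C *: y) <= e * Y -> norm2 y <= Y ->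
  `|dot x x - c ^+ 2 * dot y y| <= (2 * c * e + e ^+ 2) * (A1 + A2).
Proof.
move=> c0 + H2; have [er erE] : exists er, er = x - c%:C *: y by eexists.
have xE : x = er + c%:C *: y by rewrite erE subrK.
rewrite -erE => H1.
have -> : dot x x - c ^+ 2 * dot y y = dot er er + 2 * c * dot er y.
  by rewrite xE dotDl !dotDr !dotZl !dotZr (dotC y er); ring.
apply: le_trans (ler_normD _ _) _;
have -> : (2 * c * e + e ^+ 2) * (A1 + A2) = e ^+ 2 * (A1 + A2) + 2 * c * (e * (A1 + A2)).
  by ring.
rewrite lerD//; last first.
  rewrite normrM ger0_norm ?mulr_ge0// ler_wpM2l ?mulr_ge0//.
  exact: dot_error_le.
by rewrite ger0_norm ?dot_ge0// -sqr_norm2 -mass_sqr -exprMn lerXn2r// ?nnegrE ?mulr_ge0 ?norm2_ge0.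
Qed.

Lemma left_overlap : `|dot u u - a ^+ 2 * A1| <= (2 * a * e + e ^+ 2) * (A1 + A2).
Proof. by apply: sqr_overlap; [exact: ltW| |case: norm2_mass]. Qed.

Lemma right_overlap : `|dot v v - a' ^+ 2 * A2| <= (2 * a' * e + e ^+ 2) * (A1 + A2).
Proof. by apply: sqr_overlap; [exact: ltW| |case: norm2_mass]. Qed.

(** The spikes enter the two compressed equations symmetrically, so the rescaled
overlap vectors [r' u] and [r v] agree: their difference [z] solves
[z + r r' Theta z = error] with [Theta] nonnegative, so that [z] is at most the
error, however large the spikes are. *)
Lemma cross_overlap_dev (r r' : R) : 0 < r -> 0 < r' -> r ^+ 2 = a -> r' ^+ 2 = a' ->
  Normc.normc ((v^t* *m u) 0 0 - (r / r' * dot v v)%:C) <=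
  2 * (norm2 v * ((r + r') / r' * (e * Y))).
Proof.
move=> r0 r'0 ra r'a.
have [z zdef] : exists z, z = r'%:C *: u - r%:C *: v by eexists.
have [er erdef] : exists er, er = r'%:C *: err1 - r%:C *: err2 by eexists.
have zE : z + (r * r')%:C *: (cdiag s *m z) = er.
  rewrite zdef erdef mulmxBr -!scalemxAr -yLE -yRE -ra -r'a.
  rewrite !scalerBr !scalerA -!rmorphM /= !opprB.
  rewrite [r' * r ^+ 2](_ : _ = r * r' * r); last by ring.
  rewrite [r * r' ^+ 2](_ : _ = r * r' * r'); last by ring.
  by rewrite addrACA [RHS]addrACA; congr (_ + _); rewrite addrC.
have zer : norm2 z <= norm2 er.
  have [-> |/norm2_gt0 zp] := eqVneq z 0; first by rewrite norm2_0 norm2_ge0.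
  rewrite -(ler_pM2l zp) -expr2 sqr_norm2.
  have h1 := dot_CS z er; have h2 := ler_norm (dot z er).
  apply: le_trans (le_trans h2 h1); rewrite -zE dotDr dotZr lerDl.
  rewrite mulr_ge0 ?mulr_ge0 ?(ltW r0) ?(ltW r'0)// dot_cdiag sumr_ge0// => i _.
  by rewrite mulr_ge0 ?s_ge0// -!expr2 addr_ge0 ?sqr_ge0.
have ern : norm2 er <= (r + r') * (e * Y).
  rewrite erdef; apply: le_trans (norm2D _ _) _.
  have -> : norm2 (- (r%:C *: err2)) = r * norm2 err2.
    rewrite -scaleNr -rmorphN norm2Z normrN gtr0_norm//.
  rewrite norm2Z gtr0_norm// mulrDl addrC lerD//.
    by rewrite ler_wpM2l// ltW.
  by rewrite ler_wpM2l// ltW.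
have uE : u = (r / r')%:C *: v + (r'^-1)%:C *: z.
  rewrite zdef scalerBr !scalerA -!rmorphM /= mulVf ?gt_eqF// scale1r.
  by rewrite [r'^-1 * r]mulrC addrC subrK.
have -> : (v^t* *m u) 0 0 - (r / r' * dot v v)%:C = (v^t* *m ((r'^-1)%:C *: z)) 0 0.
  rewrite uE mulmxDr mxE -scalemxAr [X in X + _ - _]mxE form_dotxx rmorphM /=.
  by rewrite -!rmorphM addrAC subrr add0r.
apply: le_trans (normc_form_le _ _) _.
rewrite ler_wpM2l// ler_wpM2l ?norm2_ge0// norm2Z gtr0_norm ?invr_gt0//.
rewrite [_ / r']mulrC -mulrA ler_wpM2l ?invr_ge0 ?(ltW r'0)//.
exact: le_trans zer ern.
Qed.

End Overlap_estimates.

Section Eigen_estimates.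
Variable R : realType.
Local Notation C := R[i].
Variables (F : base_field) (n m k : nat).
Variables (X P : 'M[C]_(n, m)) (U : 'M[C]_(n, k)) (s : 'rV[R]_k) (V : 'M[C]_(m, k)).
Variables (Q : 'M[C]_n) (sg : 'rV[R]_n) (T : 'M[C]_(m, n)).
Hypothesis P_svd : is_svd F P U s V.
Hypothesis W_svd : is_svd F (X + P) Q sg T.
Local Notation G x := (compressed_resolvent X U V (x%:C)).

Lemma form_dev (e x c c' : R) :
  (forall y z : 'cV[C]_k, norm2 (G x *m col_mx y z - col_mx (c%:C *: y) (c'%:C *: z))
    <= e * norm2 (col_mx y z)) ->
  forall y z : 'cV[C]_k, `|dot (col_mx y z) (G x *m col_mx y z)
    - (c * dot y y + c' * dot z z)| <= e * (dot y y + dot z z).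
Proof.
move=> H y z; have -> : c * dot y y + c' * dot z z =
    dot (col_mx y z) (col_mx (c%:C *: y) (c'%:C *: z)) by rewrite dot_col !dotZr.
rewrite -dotBr; apply: le_trans (dot_CS _ _) _.
rewrite -[dot y y + _]dot_col -sqr_norm2 expr2 mulrCA ler_wpM2l ?norm2_ge0//.
Qed.

Lemma mass_normalization j (lam h be e a a' b b' : R) (u v yL yR : 'cV[C]_k) :
  lam = sg 0 j -> 0 < h -> 0 < be -> be <= lam + h - opnorm X ->
  shifted X (lam) \in unitmx -> shifted X (lam + h) \in unitmx ->
  (forall y z : 'cV[C]_k, norm2 (G (lam) *m col_mx y z
     - col_mx (a%:C *: y) (a'%:C *: z)) <= e * norm2 (col_mx y z)) ->
  (forall y z : 'cV[C]_k, norm2 (G (lam + h) *m col_mx y z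
     - col_mx (b%:C *: y) (b'%:C *: z)) <= e * norm2 (col_mx y z)) ->
  u = U^t* *m col j Q -> v = V^t* *m col j T -> yL = cdiag s *m v -> yR = cdiag s *m u ->
  `|(a - b) * dot yL yL + (a' - b') * dot yR yR - 2 * h| <=
    2 * (h ^+ 2 / be) + 2 * e * (dot yL yL + dot yR yR).
Proof.
move=> -> h0 be0 be_le unit1 unit2 dev1 dev2 uE vE yLE yRE.
have D := compressed_difference P_svd W_svd unit1 h0 be0 be_le unit2.
rewrite -uE -vE -yLE -yRE in D.
exact: difference_bound D (form_dev dev1 yL yR) (form_dev dev2 yL yR).
Qed.
End Eigen_estimates.

(** * Transforms of the noise law *)

Section MeasurableInv.
Variable R : realType.
Lemma measurable_inv : measurable_fun [set: R] (@GRing.inv R).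
Proof.
have -> : [set: R] = [set 0] `|` ~` [set 0] by rewrite setUv.
apply/measurable_funU => //; first exact: measurableC.
split; first exact: measurable_fun_set1.
apply: open_continuous_measurable_fun; first by apply: closed_openC; exact: closed_eq.
by move=> x; rewrite inE /= => /eqP x0; exact: inv_continuous.
Qed.

Lemma measurable_funV (f : R -> R) : measurable_fun [set: R] f ->
  measurable_fun [set: R] (fun t => (f t)^-1).
Proof. by move=> mf; exact: (measurableT_comp measurable_inv mf). Qed.
End MeasurableInv.

Section Support.
Variables (R : realType) (mu : probability R R).
Local Notation S := (measure_support mu).

Lemma support_closed : closed S.
Proof.
move=> x xS V oV Vx; have [y [Sy Vy]] := xS V (open_nbhs_nbhs (conj oV Vx)).
exact: Sy.
Qed.

(** The complement of the support is covered by the null ones among the countably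
many intervals with rational endpoints. *)
Lemma support_null : mu (~` S) = 0%E.
Proof.
pose J (p : rat * rat) : set R := `]ratr p.1, ratr p.2[%classic.
pose F k : set R := if unpickle k is Some p then
  (if `[< mu (J p) = 0%E >] then J p else set0) else set0.
have mS : measurable (~` S).
  by apply: measurableC; apply: closed_measurable; exact: support_closed.
apply/negligibleP => //; apply: (@negligibleS _ _ _ _ (\bigcup_k F k)); last first.
  apply: negligible_bigcup => k; rewrite /F; case: unpickle => [p|]; last exact: negligible_set0.
  case: asboolP => [p0|_]; last exact: negligible_set0.
  by apply/negligibleP; [exact: measurable_itv|exact: p0].
move=> x; rewrite /measure_support /= => /existsNP[V /not_implyP[oV /not_implyP[Vx /negP]]].
rewrite -leNgt => V0.
have /nbhs_ballP[e /= e0 eV] : nbhs x V by exact: open_nbhs_nbhs.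
have /rat_in_itvoo[p] : x - e < x by rewrite ltrBlDr ltrDl.
have /rat_in_itvoo[q] : x < x + e by rewrite ltrDl.
rewrite !in_itv /= => /andP[xq qe] /andP[ep px].
exists (pickle (p, q)); [exact: Logic.I|rewrite /F pickleK].
have JV : J (p, q) `<=` V.
  move=> y; rewrite /J /= in_itv /= => /andP[py yq]; apply: eV.
  by rewrite /ball /= ltr_norml; apply/andP; split; lra.
case: asboolP => [_|]; first by rewrite /J /= in_itv /= px xq.
move=> []; apply/eqP; rewrite eq_le measure_ge0 andbT (le_trans _ V0)//.
by apply: le_measure => //; rewrite inE//; exact: open_measurable.
Qed.

Hypothesis S_ge0 : S `<=` `[0, +oo[.
Hypothesis S_compact : compact S.
Local Notation b := (noise_edge mu).

Lemma edge_ge0 : 0 <= b. Proof. exact: sqrtr_ge0. Qed.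

Definition noise_range : set R := `[0, b ^+ 2]%classic.
Local Notation D := noise_range.

Lemma noise_range_measurable : measurable D. Proof. exact: measurable_itv. Qed.

Lemma support_range : S `<=` D.
Proof.
move=> x Sx; have := S_ge0 Sx; rewrite /noise_range /= !in_itv /= andbT => x0.
have [M [_ SM]] := compact_bounded S_compact.
have hs : has_sup S.
  split; first by exists x.
  exists (M + 1) => y Sy; apply: le_trans (ler_norm _) _; apply: SM => //.
  by rewrite ltrDl.
have xs : x <= sup S by exact: sup_upper_bound.
by rewrite x0 /noise_edge sqr_sqrtr// (le_trans x0).
Qed.

Lemma noise_range_null : mu (~` D) = 0%E.
Proof.
apply/eqP; rewrite eq_le measure_ge0 andbT -support_null le_measure ?inE//.
- by apply: measurableC; exact: noise_range_measurable.
- by apply: measurableC; apply: closed_measurable; exact: support_closed.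
- exact: subsetC support_range.
Qed.

Lemma noise_range_full : mu D = 1%E.
Proof.
have := probability_setC mu noise_range_measurable.
rewrite noise_range_null; have := probability_le1 mu noise_range_measurable.
have := measure_ge0 mu D; case: (mu D) => //= r _ _ /esym/eqP.
by rewrite -EFinB eqe subr_eq0 => /eqP <-.
Qed.

Lemma integrable_range (f : R -> R) M : measurable_fun setT f ->
  (forall t, D t -> `|f t| <= M) -> mu.-integrable D (EFin \o f).
Proof.
move=> mf fM; apply: measurable_bounded_integrable.
- exact: noise_range_measurable.
- exact: (le_lt_trans (probability_le1 mu noise_range_measurable) (ltry 1)).
- exact: measurable_funTS.
- exists M; split; first exact: num_real.
  by move=> N MN t Dt; exact: le_trans (fM t Dt) (ltW MN).
Qed.

Lemma Rintegral_range (f : R -> R) : measurable_fun setT f ->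
  \int[mu]_t f t = \int[mu]_(t in D) f t.
Proof.
move=> mf; rewrite [RHS]Rintegral_mkcond; congr fine.
apply: ae_eq_integral => //.
- exact/measurable_EFinP.
- apply/measurable_EFinP; apply/(measurable_restrictT _ noise_range_measurable).
  exact: measurable_funTS.
- exists (~` D); split => //.
  + by apply: measurableC; exact: noise_range_measurable.
  + exact: noise_range_null.
  + move=> t /=; apply: contra_not => Dt _; rewrite patchE.
    by rewrite mem_set.
Qed.

(** The kernel [z / (z ^ 2 - t)] of [phi], split at its poles [sqrt t] and
[- sqrt t]: in this form its divided differences are visibly positive and
bounded. *)
Definition ker (z t : R) : R :=
  2^-1 * ((z - Num.sqrt t)^-1 + (z + Num.sqrt t)^-1).
Definition ker2 (x y t : R) : R :=
  2^-1 * ((x - Num.sqrt t)^-1 * (y - Num.sqrt t)^-1 +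
          (x + Num.sqrt t)^-1 * (y + Num.sqrt t)^-1).

Lemma measurable_sqrt : measurable_fun [set: R] (@Num.sqrt R).
Proof. by apply: continuous_measurable_fun; exact: sqrt_continuous. Qed.

Lemma measurable_pole (z : R) :
  measurable_fun [set: R] (fun t => (z - Num.sqrt t)^-1) /\
  measurable_fun [set: R] (fun t => (z + Num.sqrt t)^-1).
Proof.
split; apply: measurable_funV.
  by apply: measurable_funB => //; exact: measurable_sqrt.
by apply: measurable_funD => //; exact: measurable_sqrt.
Qed.

Lemma measurable_ker z : measurable_fun [set: R] (ker z).
Proof.
have [m1 m2] := measurable_pole z.
by apply: measurable_funM => //; exact: measurable_funD.
Qed.

Lemma measurable_ker2 x y : measurable_fun [set: R] (ker2 x y).
Proof.
have [m1 m2] := measurable_pole x; have [m3 m4] := measurable_pole y.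
by apply: measurable_funM => //; apply: measurable_funD; exact: measurable_funM.
Qed.

Lemma sqrt_range t : D t -> 0 <= Num.sqrt t <= b /\ t = Num.sqrt t ^+ 2.
Proof.
rewrite /noise_range /= in_itv /= => /andP[t0 tb].
rewrite sqr_sqrtr// sqrtr_ge0; split => //=.
by rewrite -(@ler_pXn2r _ 2)// ?nnegrE ?sqrtr_ge0// sqr_sqrtr.
Qed.

Lemma kerE z t : b < z -> D t -> ker z t = z / (z ^+ 2 - t).
Proof.
move=> bz /sqrt_range[/andP[s0 sb] {2}->]; rewrite /ker.
move: (Num.sqrt t) s0 sb => s s0 sb.
have zs : z - s != 0 by rewrite gt_eqF// subr_gt0; lra.
have zs' : z + s != 0 by rewrite gt_eqF//; lra.
have zz : z ^+ 2 - s ^+ 2 != 0 by rewrite subr_sqr mulf_neq0.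
by field; rewrite zz zs zs'.
Qed.

Lemma ker_sub x y t : b < x -> b < y -> D t ->
  ker x t - ker y t = (y - x) * ker2 x y t.
Proof.
move=> bx yx /sqrt_range[/andP[s0 sb] _]; rewrite /ker /ker2.
move: (Num.sqrt t) s0 sb => s s0 sb.
have h1 : x - s != 0 by rewrite gt_eqF// subr_gt0; lra.
have h2 : x + s != 0 by rewrite gt_eqF//; lra.
have h3 : y - s != 0 by rewrite gt_eqF// subr_gt0; lra.
have h4 : y + s != 0 by rewrite gt_eqF//; lra.
by field; rewrite h1 h2 h3 h4.
Qed.

Lemma ker2_ge x y t : b < x -> b < y -> D t -> (x * y)^-1 <= ker2 x y t.
Proof.
move=> bx by_ /sqrt_range[/andP[s0 sb] _]; rewrite /ker2.
move: (Num.sqrt t) s0 sb => s s0 sb.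
have h1 : 0 < x - s by rewrite subr_gt0; lra.
have h2 : 0 < x + s by lra.
have h3 : 0 < y - s by rewrite subr_gt0; lra.
have h4 : 0 < y + s by lra.
have x0 : 0 < x by lra. have y0 : 0 < y by lra.
have -> : 2^-1 * ((x - s)^-1 * (y - s)^-1 + (x + s)^-1 * (y + s)^-1) =
  (x * y + s ^+ 2) / ((x - s) * (x + s) * ((y - s) * (y + s))).
  by field; rewrite !gt_eqF.
rewrite ler_pdivlMr ?mulr_gt0// mulrC ler_pdivrMr ?mulr_gt0//.
have : 0 <= s ^+ 2 * (x * y + y ^+ 2 + (x - s) * (x + s)).
  by rewrite mulr_ge0 ?sqr_ge0// !addr_ge0 ?sqr_ge0// mulr_ge0// ltW.
by lra.
Qed.

Lemma ker_ge z t : b < z -> D t -> z^-1 <= ker z t.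
Proof.
move=> bz /sqrt_range[/andP[s0 sb] _]; rewrite /ker.
move: (Num.sqrt t) s0 sb => s s0 sb.
have h1 : 0 < z - s by rewrite subr_gt0; lra.
have h2 : 0 < z + s by lra.
have z0 : 0 < z by lra.
have -> : 2^-1 * ((z - s)^-1 + (z + s)^-1) = z / ((z - s) * (z + s)).
  by field; rewrite !gt_eqF.
rewrite ler_pdivlMr ?mulr_gt0// mulrC ler_pdivrMr//.
by have := sqr_ge0 s; lra.
Qed.

Section Gap.
Variable g : R.
Hypothesis g0 : 0 < g.

Lemma pole_bounds z t : b + g <= z -> D t ->
  [/\ 0 < (z - Num.sqrt t)^-1, (z - Num.sqrt t)^-1 <= g^-1,
      0 < (z + Num.sqrt t)^-1 & (z + Num.sqrt t)^-1 <= g^-1].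
Proof.
move=> gz /sqrt_range[/andP[s0 sb] _]; move: (Num.sqrt t) s0 sb => s s0 sb.
have h1 : g <= z - s by lra. have h2 : g <= z + s by have := edge_ge0; lra.
by rewrite !invr_gt0 !lef_pV2 ?posrE ?(lt_le_trans g0)// h1 h2.
Qed.

Lemma ker_bound z t : b + g <= z -> D t -> `|ker z t| <= g^-1.
Proof.
move=> gz Dt; have [p1 p2 p3 p4] := pole_bounds gz Dt.
by rewrite /ker ger0_norm; lra.
Qed.

Lemma ker2_bound x y t : b + g <= x -> b + g <= y -> D t ->
  `|ker2 x y t| <= g^-1 ^+ 2.
Proof.
move=> gx gy Dt; have [p1 p2 p3 p4] := pole_bounds gx Dt.
have [q1 q2 q3 q4] := pole_bounds gy Dt.
have h1 : (x - Num.sqrt t)^-1 * (y - Num.sqrt t)^-1 <= g^-1 * g^-1 by rewrite ler_pM// ltW.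
have h2 : (x + Num.sqrt t)^-1 * (y + Num.sqrt t)^-1 <= g^-1 * g^-1 by rewrite ler_pM// ltW.
have h3 := mulr_gt0 p1 q1; have h4 := mulr_gt0 p3 q3.
by rewrite (expr2 (g^-1)) /ker2 ger0_norm; lra.
Qed.

Lemma ker2_lip x y t : b + g <= x -> b + g <= y -> D t ->
  `|ker2 x y t - ker2 x x t| <= g^-1 ^+ 3 * `|x - y|.
Proof.
move=> gx gy Dt; have [p1 p2 p3 p4] := pole_bounds gx Dt.
have [q1 q2 q3 q4] := pole_bounds gy Dt.
have e : ker2 x y t - ker2 x x t = (x - y) * (2^-1 *
    ((x - Num.sqrt t)^-1 * (x - Num.sqrt t)^-1 * (y - Num.sqrt t)^-1 +
     (x + Num.sqrt t)^-1 * (x + Num.sqrt t)^-1 * (y + Num.sqrt t)^-1)).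
  rewrite /ker2; move: p1 p3 q1 q3; rewrite !invr_gt0 => p1 p3 q1 q3.
  by field; rewrite !gt_eqF.
have h1 : (x - Num.sqrt t)^-1 * (x - Num.sqrt t)^-1 * (y - Num.sqrt t)^-1 <= g^-1 ^+ 3.
  by rewrite !exprSr expr0 mul1r !ler_pM ?mulr_ge0// ltW.
have h2 : (x + Num.sqrt t)^-1 * (x + Num.sqrt t)^-1 * (y + Num.sqrt t)^-1 <= g^-1 ^+ 3.
  by rewrite !exprSr expr0 mul1r !ler_pM ?mulr_ge0// ltW.
have h3 := mulr_gt0 (mulr_gt0 p1 p1) q1; have h4 := mulr_gt0 (mulr_gt0 p3 p3) q3.
rewrite e normrM mulrC ler_wpM2r// ger0_norm; lra.
Qed.
End Gap.

(** The opposite of the divided difference of [phi], see [phi_sub]. As an integral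
it gives bounds on increments and slopes without differentiation under the
integral sign. *)
Definition phi_dd (x y : R) : R := \int[mu]_(t in D) ker2 x y t.

Lemma integrable_ker z : b < z -> mu.-integrable D (EFin \o ker z).
Proof.
move=> bz; have g0 : 0 < z - b by rewrite subr_gt0.
apply: (integrable_range (measurable_ker z)) => t Dt.
by apply: (ker_bound g0) => //; rewrite addrC subrK.
Qed.

Lemma integrable_ker2 x y : b < x -> b < y -> mu.-integrable D (EFin \o ker2 x y).
Proof.
move=> bx b_y; have g0 : 0 < Num.min (x - b) (y - b).
  by rewrite lt_min !subr_gt0 bx.
apply: (integrable_range (measurable_ker2 x y)) => t Dt.
by apply: (ker2_bound g0) => //; rewrite -lerBrDl ge_min lexx ?orbT.
Qed.

Lemma phi_integral z : b < z -> phi mu z%:C = (\int[mu]_(t in D) ker z t)%:C.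
Proof.
move=> bz; rewrite /phi.
have e t : z%:C / (z%:C ^+ 2 - t%:C) = (z / (z ^+ 2 - t))%:C.
  by rewrite -rmorphXn -rmorphB -fmorph_div.
have -> : (fun x => complex.Re (z%:C / (z%:C ^+ 2 - x%:C))) =
          (fun t => z / (z ^+ 2 - t)).
  by apply/funext => t; rewrite e.
have -> : (fun x => complex.Im (z%:C / (z%:C ^+ 2 - x%:C))) = cst 0.
  by apply/funext => t; rewrite e.
have mk : measurable_fun [set: R] (fun t => z / (z ^+ 2 - t)).
  by apply: measurable_funM => //; apply: measurable_funV; exact: measurable_funB.
rewrite (Rintegral_range mk).
have -> : \int[mu]_x cst 0 x = 0 :> R by rewrite /Rintegral integral0.
by congr (_ +i* _); apply: eq_Rintegral => t; rewrite inE => Dt; rewrite kerE.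
Qed.

Lemma phi_realE z : b < z -> phi mu z%:C = (phi_real mu z)%:C.
Proof. by move=> bz; rewrite /phi_real phi_integral. Qed.

Lemma phi_real_integral z : b < z -> phi_real mu z = \int[mu]_(t in D) ker z t.
Proof. by move=> bz; rewrite /phi_real phi_integral. Qed.

Lemma Rintegral_range_cst (r : R) : \int[mu]_(_ in D) r = r.
Proof.
rewrite (Rintegral_cst mu noise_range_measurable) -[RHS]mulr1; congr (_ * _).
by have := noise_range_full => /= ->.
Qed.

Lemma integrable_range_cst (r : R) : mu.-integrable D (EFin \o cst r).
Proof. exact: (@integrable_range _ `|r|). Qed.

Lemma phi_ge z : b < z -> z^-1 <= phi_real mu z.
Proof.
move=> bz; rewrite phi_real_integral// -[leLHS]Rintegral_range_cst.
apply: le_Rintegral; first exact: noise_range_measurable.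
- exact: integrable_range_cst.
- exact: integrable_ker.
- by move=> t; exact: ker_ge.
Qed.

Lemma phi_sub x y : b < x -> b < y ->
  phi_real mu x - phi_real mu y = (y - x) * phi_dd x y.
Proof.
move=> bx b_y; rewrite !phi_real_integral//.
rewrite -RintegralB; [|exact: noise_range_measurable|exact: integrable_ker..].
rewrite -RintegralZl; [|exact: noise_range_measurable|exact: integrable_ker2].
by apply: eq_Rintegral => t; rewrite inE => Dt; exact: ker_sub.
Qed.

Lemma phi_dd_ge x y : b < x -> b < y -> (x * y)^-1 <= phi_dd x y.
Proof.
move=> bx b_y; rewrite -[leLHS]Rintegral_range_cst.
apply: le_Rintegral; first exact: noise_range_measurable.
- exact: integrable_range_cst.
- exact: integrable_ker2.
- by move=> t; exact: ker2_ge.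
Qed.

Lemma phi_dd_lip g x y : 0 < g -> b + g <= x -> b + g <= y ->
  `|phi_dd x y - phi_dd x x| <= g^-1 ^+ 3 * `|x - y|.
Proof.
move=> g0 gx gy; have bx : b < x by lra. have b_y : b < y by lra.
rewrite -RintegralB; [|exact: noise_range_measurable|exact: integrable_ker2..].
have i1 : mu.-integrable D (EFin \o (fun t => ker2 x y t - ker2 x x t)).
  apply: (@integrable_range _ (g^-1 ^+ 3 * `|x - y|)).
    by apply: measurable_funB; exact: measurable_ker2.
  by move=> t; exact: ker2_lip.
apply: le_trans (le_normr_Rintegral noise_range_measurable i1) _.
rewrite -[leRHS]Rintegral_range_cst; apply: le_Rintegral.
- exact: noise_range_measurable.
- exact: integrable_norm.
- exact: integrable_range_cst.
- by move=> t; exact: ker2_lip.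
Qed.

End Support.

Lemma quadratic_derive1 (R : realType) (f : R -> R) (x l C e : R) : 0 < e ->
  (forall y, `|y - x| < e -> `|f x - f y - (y - x) * l| <= C * (y - x) ^+ 2) ->
  derive1 f x = - l.
Proof.
move=> e0 fx; rewrite /derive1; apply: cvg_lim => //.
apply/cvgrPdist_le => eps eps0.
have C0 : 0 < `|C| + 1 by rewrite ltr_wpDl.
near=> h.
have h0 : h != 0 by near: h; exact: nbhs_dnbhs_neq.
have he : `|h| < e by near: h; apply: dnbhs0_lt.
have hC : `|h| <= eps / (`|C| + 1) by near: h; apply: dnbhs0_le; rewrite divr_gt0.
have := fx (h + x); rewrite addrK => /(_ he) H.
rewrite -(@ler_pM2l _ `|h|) ?normr_gt0// -normrM mulrBr.
rewrite [h * (_ *: _)]mulrA divff// mul1r.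
have -> : h * - l - (f (h + x) - f x) = f x - f (h + x) - h * l by ring.
apply: le_trans H _; rewrite -[h ^+ 2]real_normK ?num_real// expr2 mulrCA.
rewrite ler_wpM2l//; apply: (@le_trans _ _ ((`|C| + 1) * `|h|)).
  by rewrite ler_wpM2r// (le_trans (ler_norm _))// lerDl.
by rewrite mulrC -ler_pdivlMr.
Unshelve. all: by end_near. Qed.

Section Transform.
Variables (R : realType) (mu : probability R R) (c : R).
Local Notation S := (measure_support mu).
Hypothesis S_ge0 : S `<=` `[0, +oo[.
Hypothesis S_compact : compact S.
Hypotheses (c_gt0 : 0 < c) (c_le1 : c <= 1).
Local Notation b := (noise_edge mu).
Local Notation phi1 := (phi_real mu).
Local Notation phi2 := (phit_real mu c).
Local Notation D := (dtrans_real mu c).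

Lemma gt_edge_gt0 z : b < z -> 0 < z.
Proof. by apply: le_lt_trans; exact: edge_ge0. Qed.

Lemma gt_edge_ge0 z : b < z -> 0 <= z.
Proof. by move=> bz; rewrite ltW// gt_edge_gt0. Qed.

Lemma phit_complexE z : b < z ->
  phit mu c z%:C = (c * phi1 z + (1 - c) / z)%:C.
Proof.
move=> bz; rewrite /phit phi_realE//.
by rewrite -rmorphM -fmorph_div -rmorphD.
Qed.

Lemma phit_real_eq z : b < z -> phi2 z = c * phi1 z + (1 - c) / z.
Proof. by move=> bz; rewrite /phit_real phit_complexE. Qed.

Lemma phit_realE z : b < z -> phit mu c z%:C = (phi2 z)%:C.
Proof. by move=> bz; rewrite phit_complexE// phit_real_eq. Qed.

Lemma dtrans_realE z : b < z -> D z = phi1 z * phi2 z.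
Proof.
by move=> bz; rewrite /dtrans_real /dtrans phi_realE// phit_realE// -rmorphM.
Qed.

Definition phit_dd (x y : R) : R := c * phi_dd mu x y + (1 - c) / (x * y).

Lemma phit_ge z : b < z -> z^-1 <= phi2 z.
Proof.
move=> bz; rewrite phit_real_eq//.
have h : c * z^-1 <= c * phi1 z by rewrite ler_wpM2l ?(ltW c_gt0)// phi_ge.
lra.
Qed.

Lemma phit_sub x y : b < x -> b < y -> phi2 x - phi2 y = (y - x) * phit_dd x y.
Proof.
move=> bx b_y; rewrite !phit_real_eq// /phit_dd mulrDr mulrCA -phi_sub//.
have x0 := gt_edge_gt0 bx; have y0 := gt_edge_gt0 b_y.
by field; rewrite !gt_eqF.
Qed.

Lemma phit_dd_ge x y : b < x -> b < y -> (x * y)^-1 <= phit_dd x y.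
Proof.
move=> bx b_y; rewrite /phit_dd.
have h : c * (x * y)^-1 <= c * phi_dd mu x y by rewrite ler_wpM2l ?(ltW c_gt0)// phi_dd_ge.
lra.
Qed.

Lemma phit_dd_lip g x y : 0 < g -> b + g <= x -> b + g <= y ->
  `|phit_dd x y - phit_dd x x| <= g^-1 ^+ 3 * `|x - y|.
Proof.
move=> g0 gx gy; have b0 := edge_ge0 mu.
have x0 : 0 < x by lra. have y0 : 0 < y by lra.
have -> : phit_dd x y - phit_dd x x = c * (phi_dd mu x y - phi_dd mu x x)
    + (1 - c) * ((x - y) * (x^-1 * x^-1 * y^-1)).
  by rewrite /phit_dd; field; rewrite !gt_eqF.
have h1 := phi_dd_lip S_ge0 S_compact g0 gx gy.
have h2 : `|(x - y) * (x^-1 * x^-1 * y^-1)| <= g^-1 ^+ 3 * `|x - y|.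
  rewrite normrM mulrC ler_wpM2r// ger0_norm ?mulr_ge0 ?invr_ge0 ?(ltW x0) ?(ltW y0)//.
  have xg : x^-1 <= g^-1 by rewrite lef_pV2 ?posrE//; lra.
  have yg : y^-1 <= g^-1 by rewrite lef_pV2 ?posrE//; lra.
  by rewrite !exprSr expr0 mul1r !ler_pM ?mulr_ge0 ?invr_ge0 ?(ltW x0) ?(ltW y0).
move: (phi_dd mu x y - phi_dd mu x x) ((x - y) * _) (g^-1 ^+ 3 * _) h1 h2 => A B N h1 h2.
apply: le_trans (ler_normD _ _) _.
rewrite 2!normrM (gtr0_norm c_gt0) [`|1 - c|]ger0_norm ?subr_ge0//.
have h3 : c * `|A| <= c * N by rewrite ler_wpM2l// ltW.
have h4 : (1 - c) * `|B| <= (1 - c) * N by rewrite ler_wpM2l// subr_ge0.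
by lra.
Qed.

(** [- phi'], [- phit'] and [- d'] on [(b, +oo)]; the last is [derive1_dtrans]. *)
Definition slope1 x := phi_dd mu x x.
Definition slope2 x := phit_dd x x.
Definition dslope x := slope1 x * phi2 x + phi1 x * slope2 x.

Lemma phi_gt0 z : b < z -> 0 < phi1 z.
Proof.
by move=> bz; apply: lt_le_trans (phi_ge S_ge0 S_compact bz);
  rewrite invr_gt0 gt_edge_gt0.
Qed.

Lemma phit_gt0 z : b < z -> 0 < phi2 z.
Proof.
by move=> bz; apply: lt_le_trans (phit_ge bz); rewrite invr_gt0 gt_edge_gt0.
Qed.

Lemma phi_ge0 z : b < z -> 0 <= phi1 z.
Proof. by move=> bz; rewrite ltW// phi_gt0. Qed.

Lemma phit_ge0 z : b < z -> 0 <= phi2 z.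
Proof. by move=> bz; rewrite ltW// phit_gt0. Qed.

Lemma phi_dd_ge0 x y : b < x -> b < y -> 0 <= phi_dd mu x y.
Proof.
move=> bx b_y; apply: le_trans (phi_dd_ge S_ge0 S_compact bx b_y).
by rewrite invr_ge0 mulr_ge0// gt_edge_ge0.
Qed.

Lemma phit_dd_ge0 x y : b < x -> b < y -> 0 <= phit_dd x y.
Proof.
move=> bx b_y; apply: le_trans (phit_dd_ge bx b_y).
by rewrite invr_ge0 mulr_ge0// gt_edge_ge0.
Qed.

Lemma slope1_gt0 z : b < z -> 0 < slope1 z.
Proof.
move=> bz; apply: lt_le_trans (phi_dd_ge S_ge0 S_compact bz bz).
by rewrite invr_gt0 mulr_gt0// gt_edge_gt0.
Qed.

Lemma slope2_gt0 z : b < z -> 0 < slope2 z.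
Proof.
move=> bz; apply: lt_le_trans (phit_dd_ge bz bz).
by rewrite invr_gt0 mulr_gt0// gt_edge_gt0.
Qed.

Lemma dslope_gt0 z : b < z -> 0 < dslope z.
Proof.
move=> bz; rewrite addr_gt0// mulr_gt0 ?phi_gt0 ?phit_gt0 ?slope1_gt0 ?slope2_gt0//.
Qed.

Lemma dtrans_gt0 z : b < z -> 0 < D z.
Proof. by move=> bz; rewrite dtrans_realE// mulr_gt0 ?phi_gt0 ?phit_gt0. Qed.

Lemma phi_le g z : 0 < g -> b + g <= z -> phi1 z <= g^-1.
Proof.
move=> g0 gz; have bz : b < z by lra.
rewrite phi_real_integral// -[leRHS](Rintegral_range_cst S_ge0 S_compact).
apply: le_Rintegral.
- exact: noise_range_measurable.
- exact: integrable_ker.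
- exact: integrable_range_cst.
- by move=> t Dt; apply: le_trans (ler_norm _) _; exact: ker_bound Dt.
Qed.

Lemma phi_dd_le g x y : 0 < g -> b + g <= x -> b + g <= y ->
  phi_dd mu x y <= g^-1 ^+ 2.
Proof.
move=> g0 gx gy; have bx : b < x by lra. have b_y : b < y by lra.
rewrite -[leRHS](Rintegral_range_cst S_ge0 S_compact).
apply: le_Rintegral.
- exact: noise_range_measurable.
- exact: integrable_ker2.
- exact: integrable_range_cst.
- by move=> t Dt; apply: le_trans (ler_norm _) _; exact: ker2_bound Dt.
Qed.

Lemma phit_le g z : 0 < g -> b + g <= z -> phi2 z <= g^-1.
Proof.
move=> g0 gz; have b0 := edge_ge0 mu; have bz : b < z by lra.
rewrite phit_real_eq//.
have h1 : c * phi1 z <= c * g^-1 by rewrite ler_wpM2l ?(ltW c_gt0)// phi_le.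
have h2 : (1 - c) / z <= (1 - c) * g^-1.
  by rewrite ler_wpM2l ?subr_ge0// lef_pV2 ?posrE//; lra.
lra.
Qed.

Lemma phit_dd_le g x y : 0 < g -> b + g <= x -> b + g <= y ->
  phit_dd x y <= g^-1 ^+ 2.
Proof.
move=> g0 gx gy; have b0 := edge_ge0 mu; rewrite /phit_dd.
have h1 : c * phi_dd mu x y <= c * g^-1 ^+ 2 by rewrite ler_wpM2l ?(ltW c_gt0)// phi_dd_le.
have h2 : (1 - c) / (x * y) <= (1 - c) * g^-1 ^+ 2.
  rewrite ler_wpM2l ?subr_ge0// invfM expr2 ler_pM ?invr_ge0//; try lra.
    by rewrite lef_pV2 ?posrE//; lra.
  by rewrite lef_pV2 ?posrE//; lra.
lra.
Qed.

Lemma dtrans_sub x y : b < x -> b < y -> D x - D y =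
  (y - x) * (phi_dd mu x y * phi2 x + phi1 y * phit_dd x y).
Proof.
move=> bx b_y; rewrite !dtrans_realE//.
have -> : phi1 x * phi2 x - phi1 y * phi2 y =
  (phi1 x - phi1 y) * phi2 x + phi1 y * (phi2 x - phi2 y) by ring.
by rewrite phi_sub// phit_sub//; ring.
Qed.

(** Quantitative monotonicity: this converts an error in the transforms into a
shift of the spectral parameter. *)
Lemma dtrans_sub_ge x y : b < x -> x <= y ->
  (y - x) * ((x * y)^-1 * (x^-1 + y^-1)) <= D x - D y.
Proof.
move=> bx xy; have b_y : b < y by lra.
have x0 := gt_edge_ge0 bx; have y0 := gt_edge_ge0 b_y.
rewrite dtrans_sub// ler_wpM2l ?subr_ge0// mulrDr lerD//.
  by rewrite ler_pM ?invr_ge0 ?mulr_ge0 ?phi_dd_ge ?phit_ge.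
by rewrite mulrC ler_pM ?invr_ge0 ?mulr_ge0 ?phi_ge ?phit_dd_ge.
Qed.

Lemma dtrans_lt x y : b < x -> x < y -> D y < D x.
Proof.
move=> bx xy; rewrite -subr_gt0; apply: lt_le_trans (dtrans_sub_ge bx (ltW xy)).
have x0 := gt_edge_gt0 bx; have y0 : 0 < y by lra.
by rewrite mulr_gt0 ?subr_gt0// mulr_gt0 ?addr_gt0 ?invr_gt0 ?mulr_gt0.
Qed.

Lemma dtrans_lt_mono x y : b < x -> b < y -> (D y < D x) = (x < y).
Proof.
move=> bx b_y; apply/idP/idP; last exact: dtrans_lt.
rewrite !ltNge; apply: contra; rewrite le_eqVlt => /predU1P[-> //|yx].
by rewrite ltW// dtrans_lt.
Qed.

Lemma dtrans_expansion g x y : 0 < g -> b + g <= x -> b + g <= y ->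
  `|D x - D y - (y - x) * dslope x| <= 3 * g^-1 ^+ 4 * (y - x) ^+ 2.
Proof.
move=> g0 gx gy; have bx : b < x by lra. have b_y : b < y by lra.
have gV : 0 < g^-1 by rewrite invr_gt0.
have e : D x - D y - (y - x) * dslope x = (y - x) *
  ((phi_dd mu x y - phi_dd mu x x) * phi2 x
   - (y - x) * (phi_dd mu x y * phit_dd x y)
   + phi1 x * (phit_dd x y - phit_dd x x)).
  rewrite dtrans_sub// /dslope /slope1 /slope2.
  have -> : phi1 y = phi1 x - (y - x) * phi_dd mu x y by rewrite -phi_sub//; ring.
  by ring.
have nxy : `|x - y| = `|y - x| by rewrite distrC.
have h1 : `|(phi_dd mu x y - phi_dd mu x x) * phi2 x| <= g^-1 ^+ 4 * `|y - x|.
  rewrite normrM [`|phi2 x|]ger0_norm ?phit_ge0// -nxy exprSr -mulrA [g^-1 * _]mulrC mulrA.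
  by rewrite ler_pM ?phit_ge0 ?phi_dd_lip ?phit_le.
have h2 : `|(y - x) * (phi_dd mu x y * phit_dd x y)| <= g^-1 ^+ 4 * `|y - x|.
  have p1 := phi_dd_ge0 bx b_y; have p2 := phit_dd_ge0 bx b_y.
  rewrite normrM mulrC ler_wpM2r// ger0_norm ?mulr_ge0// (_ : g^-1 ^+ 4 = g^-1 ^+ 2 * g^-1 ^+ 2); last by ring.
  by rewrite ler_pM// ?phi_dd_le ?phit_dd_le.
have h3 : `|phi1 x * (phit_dd x y - phit_dd x x)| <= g^-1 ^+ 4 * `|y - x|.
  rewrite normrM [`|phi1 x|]ger0_norm ?phi_ge0// -nxy exprS -mulrA.
  by rewrite ler_pM ?phi_ge0 ?phit_dd_lip ?phi_le.
have -> : 3 * g^-1 ^+ 4 * (y - x) ^+ 2 = `|y - x| * (3 * g^-1 ^+ 4 * `|y - x|).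
  by rewrite -[(y - x) ^+ 2]real_normK ?num_real//; ring.
rewrite e normrM ler_wpM2l//.
apply: le_trans (ler_normD _ _) _; apply: le_trans (lerD (ler_normB _ _) h3) _.
lra.
Qed.

Lemma derive1_dtrans x : b < x -> derive1 D x = - dslope x.
Proof.
move=> bx; pose g := (x - b) / 2.
have g0 : 0 < g by rewrite divr_gt0// subr_gt0.
apply: (@quadratic_derive1 _ _ _ _ (3 * g^-1 ^+ 4) g) => // y.
rewrite ltr_norml => /andP[xy _]; apply: dtrans_expansion => //; rewrite /g in xy *; lra.
Qed.

Lemma dslope_lip g x y : 0 < g -> b + g <= x -> b + g <= y ->
  `|dslope x - dslope y| <= 6 * g^-1 ^+ 4 * `|x - y|.
Proof.
move=> g0 gx gy; have h1 := dtrans_expansion g0 gx gy.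
have h2 := dtrans_expansion g0 gy gx.
have [->|xy] := eqVneq x y; first by rewrite !subrr normr0 mulr0.
rewrite -(@ler_pM2l _ `|x - y|) ?normr_gt0 ?subr_eq0// -normrM mulrCA -expr2.
rewrite real_normK ?num_real//.
have -> : (x - y) * (dslope x - dslope y) =
  (D x - D y - (y - x) * dslope x) + (D y - D x - (x - y) * dslope y) by ring.
apply: le_trans (ler_normD _ _) _; apply: le_trans (lerD h1 h2) _.
by rewrite -[(y - x) ^+ 2]sqrrN opprB; lra.
Qed.

Lemma lip_continuous (f : R -> R) x : b < x ->
  (forall g, 0 < g -> exists C, forall u v, b + g <= u -> b + g <= v ->
     `|f u - f v| <= C * `|u - v|) -> {for x, continuous f}.
Proof.
move=> bx fl; pose g := (x - b) / 2.
have g0 : 0 < g by rewrite divr_gt0// subr_gt0.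
have [C fC] := fl g g0.
have C0 : 0 < `|C| + 1 by rewrite ltr_wpDl.
apply/cvgrPdist_le => eps eps0; near=> y.
have h1 : `|x - y| < g by near: y; exact: cvgr_dist_lt.
have h2 : `|x - y| <= eps / (`|C| + 1).
  by near: y; apply: cvgr_dist_le => //; rewrite divr_gt0.
move: h1; rewrite ltr_norml => /andP[h1 h3].
have gE : g + g = x - b by rewrite /g; field.
apply: le_trans (fC _ _ _ _) _; [by clearbody g; lra..|].
apply: (@le_trans _ _ ((`|C| + 1) * `|x - y|)).
  by rewrite ler_wpM2r// (le_trans (ler_norm _))// lerDl.
by rewrite mulrC -ler_pdivlMr.
Unshelve. all: by end_near. Qed.

Lemma phi_lip g x y : 0 < g -> b + g <= x -> b + g <= y ->
  `|phi1 x - phi1 y| <= g^-1 ^+ 2 * `|x - y|.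
Proof.
move=> g0 gx gy; have bx : b < x by lra. have b_y : b < y by lra.
rewrite phi_sub// normrM mulrC distrC ler_wpM2r// ger0_norm ?phi_dd_le//.
exact: phi_dd_ge0.
Qed.

Lemma phit_lip g x y : 0 < g -> b + g <= x -> b + g <= y ->
  `|phi2 x - phi2 y| <= g^-1 ^+ 2 * `|x - y|.
Proof.
move=> g0 gx gy; have bx : b < x by lra. have b_y : b < y by lra.
rewrite phit_sub// normrM mulrC distrC ler_wpM2r// ger0_norm ?phit_dd_le//.
exact: phit_dd_ge0.
Qed.

Lemma phi_continuous x : b < x -> {for x, continuous phi1}.
Proof.
move=> bx; apply: lip_continuous => // g g0; exists (g^-1 ^+ 2) => u v.
exact: phi_lip.
Qed.

Lemma phit_continuous x : b < x -> {for x, continuous phi2}.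
Proof.
move=> bx; apply: lip_continuous => // g g0; exists (g^-1 ^+ 2) => u v.
exact: phit_lip.
Qed.

Lemma dslope_continuous x : b < x -> {for x, continuous dslope}.
Proof.
move=> bx; apply: lip_continuous => // g g0; exists (6 * g^-1 ^+ 4) => u v.
exact: dslope_lip.
Qed.

Lemma dtrans_continuous x : b < x -> {for x, continuous D}.
Proof.
move=> bx; apply: lip_continuous => // g g0.
exists (2 * g^-1 ^+ 3) => u v gu gv; have bu : b < u by lra. have bv : b < v by lra.
rewrite !dtrans_realE//.
have -> : phi1 u * phi2 u - phi1 v * phi2 v =
  (phi1 u - phi1 v) * phi2 u + phi1 v * (phi2 u - phi2 v) by ring.
apply: le_trans (ler_normD _ _) _; rewrite !normrM.
have h1 : `|phi1 u - phi1 v| * `|phi2 u| <= (g^-1 ^+ 2 * `|u - v|) * g^-1.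
  by rewrite ler_pM ?phi_lip// ger0_norm ?phit_le// ltW// phit_gt0.
have h2 : `|phi1 v| * `|phi2 u - phi2 v| <= g^-1 * (g^-1 ^+ 2 * `|u - v|).
  by rewrite ler_pM ?phit_lip// ger0_norm ?phi_le// ltW// phi_gt0.
by lra.
Qed.

End Transform.

(** * The outlier map *)

Section Outlier_map.
Variables (R : realType) (mu : probability R R) (c : R).
Local Notation S := (measure_support mu).
Hypothesis S_ge0 : S `<=` `[0, +oo[.
Hypothesis S_compact : compact S.
Hypotheses (c_gt0 : 0 < c) (c_le1 : c <= 1).
Hypothesis edge : edge_condition mu c.
Local Notation b := (noise_edge mu).
Local Notation phi1 := (phi_real mu).
Local Notation phi2 := (phit_real mu c).
Local Notation D := (dtrans_real mu c).
Local Notation d0 := (d_edge mu c).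
Local Notation th0 := (theta_star mu c).
Local Notation rho := (rho mu c).
Local Notation dslope := (dslope mu c).

Let dtrans_pos z : b < z -> 0 < D z. Proof. exact: dtrans_gt0. Qed.
Let dtrans_cont z : b < z -> {for z, continuous D}. Proof. exact: dtrans_continuous. Qed.
Let dslope_pos z : b < z -> 0 < dslope z. Proof. exact: dslope_gt0. Qed.
Let dtrans_mono x y : b < x -> b < y -> (D y < D x) = (x < y).
Proof. exact: dtrans_lt_mono. Qed.

Lemma d_edge_gt0 : 0 < d0. Proof. by case: edge. Qed.

Lemma dtrans_lt_edge z : b < z -> D z < d0.
Proof.
move=> bz; pose z' := (b + z) / 2.
have bz' : b < z' by rewrite /z' ltr_pdivlMr//; lra.
have z'z : z' < z by rewrite /z' ltr_pdivrMr//; lra.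
suff : D z' <= d0 by apply: lt_le_trans; rewrite dtrans_mono.
apply: limr_ge; first by case: edge.
near=> y.
apply/ltW/dtrans_lt => //.
Unshelve. all: by end_near. Qed.

Lemma dtrans_near_edge t : t < d0 -> exists2 z, b < z & t < D z.
Proof.
move=> td; have [cD _] := edge.
near b^'+ => z; exists z => //; near: z; exact: (cvgr_gt d0).
Unshelve. all: by end_near. Qed.

Lemma dtrans_small t : 0 < t -> exists2 z, b < z & D z < t.
Proof.
move=> t0; pose g := 1 + t^-1.
have g0 : 0 < g by rewrite addr_gt0// invr_gt0.
have bg : b < b + g by rewrite ltrDl.
exists (b + g) => //; rewrite dtrans_realE//.
have g1 : g^-1 <= 1 by rewrite invf_le1// lerDl invr_ge0 ltW.
have gt : g^-1 < t by rewrite invf_plt ?posrE// ltrDr.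
apply: le_lt_trans gt; rewrite -[leRHS]mulr1 ler_pM//.
- exact: phi_ge0.
- exact: phit_ge0.
- exact: phi_le.
- by apply: le_trans g1; exact: phit_le.
Qed.

Lemma dtrans_surj t : 0 < t -> t < d0 -> exists2 z, b < z & D z = t.
Proof.
move=> t0 td; have [x bx tx] := dtrans_near_edge td.
have [y b_y yt] := dtrans_small t0.
have xy : x < y by rewrite -dtrans_mono// (lt_trans yt).
have cD : {within `[x, y], continuous D}.
  apply: continuous_in_subspaceT => z; rewrite inE /= in_itv /= => /andP[xz _].
  by apply: dtrans_continuous => //; exact: lt_le_trans xz.
have [|z] := IVT (ltW xy) cD (v := t).
  by rewrite ge_min le_max (ltW tx) (ltW yt) /= orbT.
by rewrite in_itv /= => /andP[xz _] Dz; exists z => //; exact: lt_le_trans xz.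
Qed.

Lemma theta_star_gt0 : 0 < th0.
Proof. by rewrite invr_gt0 sqrtr_gt0 d_edge_gt0. Qed.

Lemma theta_star_lt t : 0 <= t -> (th0 < t) = (1 < t ^+ 2 * d0).
Proof.
move=> t0; have s0 : 0 < Num.sqrt d0 by rewrite sqrtr_gt0 d_edge_gt0.
rewrite /theta_star -[_^-1]mul1r ltr_pdivrMr//.
rewrite -[LHS](@ltr_pXn2r _ 2)// ?nnegrE ?mulr_ge0 ?(ltW s0)//.
by rewrite expr1n exprMn sqr_sqrtr// ltW// d_edge_gt0.
Qed.

Lemma rhoP t : th0 < t -> b < rho t /\ D (rho t) = (t ^+ 2)^-1.
Proof.
move=> ht; have t0 : 0 < t by apply: lt_trans ht; exact: theta_star_gt0.
rewrite /rho ht; have t20 : 0 < (t ^+ 2)^-1 by rewrite invr_gt0 exprn_gt0.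
have td : (t ^+ 2)^-1 < d0.
  by rewrite invf_plt ?posrE ?exprn_gt0// ?d_edge_gt0//;
    rewrite -[d0^-1]mul1r ltr_pdivrMr ?d_edge_gt0// -theta_star_lt// ltW.
have [z bz Dz] := dtrans_surj t20 td.
have : [set z | b < z /\ D z = (t ^+ 2)^-1] !=set0 by exists z.
by move=> /(xgetPex b).
Qed.

Lemma rho_sub t : t <= th0 -> rho t = b.
Proof. by move=> ht; rewrite /rho ltNge ht. Qed.

Lemma rho_ge t : b <= rho t.
Proof. by have [/rho_sub ->|/rhoP[/ltW]] := leP t th0. Qed.

(** The outlier map enters the location estimates in this form, valid for
subcritical [t] too because [rho t] is then [b] and [D z] is below [d0]. *)
Lemma rho_gt t z : 0 <= t -> b < z -> (z < rho t) = (1 < t ^+ 2 * D z).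
Proof.
move=> t0 bz; have D0 := dtrans_pos bz.
have [tl|ht] := leP t th0.
  rewrite rho_sub// [LHS]ltNge (ltW bz); apply/esym/negbTE; rewrite -leNgt.
  have tl' : t ^+ 2 * d0 <= 1 by rewrite leNgt -theta_star_lt// -leNgt.
  by apply: le_trans tl'; rewrite ler_wpM2l ?sqr_ge0// ltW// dtrans_lt_edge.
have [br Dr] := rhoP ht.
have tp : 0 < t by apply: lt_trans ht; exact: theta_star_gt0.
rewrite -dtrans_mono// Dr.
by rewrite -[X in X < _]mul1r ltr_pdivrMr ?exprn_gt0// mulrC.
Qed.

Lemma rho_lt t z : 0 <= t -> b < z -> (rho t < z) = (t ^+ 2 * D z < 1).
Proof.
move=> t0 bz; have D0 := dtrans_pos bz.
have [tl|ht] := leP t th0.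
  rewrite rho_sub// bz; apply/esym.
  have tl' : t ^+ 2 * d0 <= 1 by rewrite leNgt -theta_star_lt// -leNgt.
  have [->|tn0] := eqVneq t 0; first by rewrite expr0n mul0r ltr01.
  apply: lt_le_trans tl'.
  by rewrite ltr_pM2l ?dtrans_lt_edge// exprn_gt0// lt_neqAle eq_sym tn0.
have [br Dr] := rhoP ht.
have tp : 0 < t by apply: lt_trans ht; exact: theta_star_gt0.
rewrite -dtrans_mono// Dr.
by rewrite -[X in _ < X]mul1r ltr_pdivlMr ?exprn_gt0// mulrC.
Qed.

Lemma rho_nondecreasing : {homo rho : x y / x <= y}.
Proof.
move=> x y xy; have [/rho_sub -> |hx] := leP x th0; first exact: rho_ge.
have x0 : 0 < x by apply: lt_trans hx; exact: theta_star_gt0.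
have y0 : 0 < y by exact: lt_le_trans xy.
have hy : th0 < y by exact: lt_le_trans xy.
have [bx _] := rhoP hx; have [b_y Dy] := rhoP hy.
rewrite leNgt rho_gt ?(ltW x0)// -leNgt Dy.
by rewrite ler_pdivrMr ?exprn_gt0// mul1r ler_pXn2r ?nnegrE// ltW.
Qed.

Lemma rho_continuous t : th0 < t -> {for t, continuous rho}.
Proof.
move=> ht; have [br Dr] := rhoP ht.
have t0 : 0 < t by apply: lt_trans ht; exact: theta_star_gt0.
apply/cvgrPdist_lt => e e0.
pose z1 := Num.max (rho t - e) ((b + rho t) / 2).
have mid : b < (b + rho t) / 2 < rho t.
  by rewrite ltr_pdivlMr// ltr_pdivrMr//; apply/andP; split; lra.
have bz1 : b < z1 by rewrite lt_max; case/andP: mid => -> _; rewrite orbT.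
have z1r : z1 < rho t by rewrite gt_max; case/andP: mid => _ ->; rewrite andbT; lra.
have bz2 : b < rho t + e by lra.
have rz2 : rho t < rho t + e by lra.
have c2 z : {for t, continuous (fun u : R => u ^+ 2 * z)}.
  by apply: cvgM; [exact: exprn_continuous|exact: cvg_cst].
move: z1r rz2; rewrite rho_gt ?rho_lt ?(ltW t0)// => h1 h2.
near=> u.
have u0 : 0 <= u by apply: ltW; near: u; exact: lt_nbhsr.
have hu1 : z1 < rho u.
  by rewrite rho_gt//; near: u; apply: (cvgr_gt (t ^+ 2 * D z1)) => //; exact: c2.
have hu2 : rho u < rho t + e.
  by rewrite rho_lt//; near: u; apply: (cvgr_lt (t ^+ 2 * D (rho t + e))) => //; exact: c2.
move: hu1; rewrite gt_max => /andP[hu1 _].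
by rewrite ltr_norml; apply/andP; split; lra.
Unshelve. all: by end_near. Qed.

Lemma test_functionP (a : R) (f : R -> R) : test_function `]a, +oo[%classic f <->
  continuous f /\ exists p q, [/\ a < p, p <= q & forall x, f x != 0 -> p <= x <= q].
Proof.
split=> [[cf K Ka]|[cf [p [q [ap pq fpq]]]]].
  split => //; set A := closure _ in K Ka.
  have fA x : f x != 0 -> A x by move=> fx; exact: subset_closure.
  have [A0|/set0P A0] := eqVneq A set0.
    exists (a + 1), (a + 1); split; rewrite ?ltrDl//.
    by move=> x /fA; rewrite A0.
  have ci : {within A, continuous (@id R)} by apply: continuous_subspaceT => x; exact: cvg_id.
  have [p pA pmin] := compact_EVT_min A0 K ci.
  have [q qA qmax] := compact_EVT_max A0 K ci.
  exists p, q; split.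
  - by move: pA; rewrite inE => /Ka; rewrite /= in_itv /= andbT.
  - exact: pmin.
  - by move=> x /fA Ax; rewrite pmin ?inE// qmax ?inE.
have sub : closure [set x | f x != 0] `<=` `[p, q]%classic.
  rewrite [X in _ `<=` X](_ : _ = closure `[p, q]%classic); last first.
    by apply/closure_id; exact: itv_closed.
  by apply: closure_subset => x /= fx; rewrite in_itv /= fpq.
split => //.
- apply: subclosed_compact sub; [exact: closed_closure|exact: segment_compact].
- move=> x /sub /=; rewrite !in_itv /= andbT => /andP[px _].
  exact: lt_le_trans px.
Qed.

(** The factor [k] may be singular at [a], since [f] vanishes near [a]. *)
Lemma test_functionM (a : R) (f k : R -> R) : test_function `]a, +oo[%classic f ->
  (forall x, a < x -> {for x, continuous k}) ->
  test_function `]a, +oo[%classic (fun x => f x * k x).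
Proof.
move=> /test_functionP[cf [p [q [ap pq fpq]]]] ck.
apply/test_functionP; split; last first.
  exists p, q; split => // x; rewrite mulf_eq0 negb_or => /andP[fx _]; exact: fpq.
move=> x; have [ax|xa] := ltP a x; first by apply: cvgM; [exact: cf|exact: ck].
have f0 y : y < p -> f y = 0.
  by move=> yp; apply/eqP/negPn/negP => /fpq; rewrite leNgt yp.
have xp : x < p by exact: le_lt_trans ap.
apply: (near_cst_continuous (0 : R)).
near=> y; rewrite f0 ?mul0r//; near: y; exact: lt_nbhsl.
Unshelve. all: by end_near. Qed.

(** If [f] is supported in [[p, q]], the spikes that matter are those between
[D p ^ (-1/2)] and [D q ^ (-1/2)], the preimages of [p] and [q] under [rho]; the
first exceeds [th0]. *)
Lemma test_function_rho (f : R -> R) : test_function `]b, +oo[%classic f ->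
  test_function `]th0, +oo[%classic (fun t => f (rho t)).
Proof.
move=> /test_functionP[cf [p [q [bp pq fpq]]]].
have p0 := dtrans_pos bp.
have bq : b < q by exact: lt_le_trans pq.
have q0 := dtrans_pos bq.
have f0 y : y < p -> f y = 0.
  by move=> yp; apply/eqP/negPn/negP => /fpq; rewrite leNgt yp.
pose tp := (Num.sqrt (D p))^-1; pose tq := (Num.sqrt (D q))^-1.
have inv2 z : 0 < D z -> (Num.sqrt (D z))^-1 ^+ 2 * D z = 1.
  by move=> z0; rewrite exprVn sqr_sqrtr ?(ltW z0)// mulVf// gt_eqF.
have tp0 : 0 < tp by rewrite invr_gt0 sqrtr_gt0.
have tq0 : 0 < tq by rewrite invr_gt0 sqrtr_gt0.
have tph : th0 < tp.
  rewrite theta_star_lt ?(ltW tp0)// -(inv2 _ p0) ltr_pM2l ?exprn_gt0//.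
  exact: dtrans_lt_edge.
have tlt t : 0 <= t -> t < tp -> rho t < p.
  move=> t0 tt; rewrite rho_lt// -(inv2 _ p0) ltr_pM2r//.
  by rewrite ltr_pXn2r ?nnegrE ?(ltW tp0).
have tlt' t : t < tp -> f (rho t) = 0.
  move=> tt; apply: f0; have [t0|t0] := leP 0 t; first exact: tlt.
  by rewrite rho_sub// (le_trans (ltW t0))// ltW// theta_star_gt0.
apply/test_functionP; split.
  move=> t; have [tt|tt] := ltP t tp.
    apply: (near_cst_continuous (0 : R)); near=> u; rewrite tlt'//.
    by near: u; exact: lt_nbhsl.
  apply: continuous_comp; last exact: cf.
  by apply: rho_continuous; exact: lt_le_trans tt.
exists tp, (Num.max tp tq); split => //; first by rewrite le_max lexx.
move=> t ft; have tt : tp <= t.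
  by rewrite leNgt; apply: contra ft => /tlt' ->.
rewrite tt /= le_max; apply/orP; right.
have t0 : 0 <= t by apply: le_trans tt; exact: ltW.
have /andP[_ rq] := fpq _ ft.
have : ~~ (q < rho t) by rewrite -leNgt.
rewrite rho_gt// -leNgt -(inv2 _ q0) ler_pM2r//.
by rewrite ler_pXn2r ?nnegrE ?(ltW tq0).
Unshelve. all: by end_near. Qed.

(** The overlap weights as functions of the outlier location [z = rho theta], with
[D z] in place of [theta ^ -2]. *)
Definition weightL z := 2 * phi1 z * D z / dslope z.
Definition weightR z := 2 * phi2 z * D z / dslope z.
Definition weightLR z := 2 * (D z * Num.sqrt (D z)) / dslope z.

Lemma kappaL_rho t : th0 < t -> kappaL mu c t = weightL (rho t).
Proof.
move=> ht; have [br Dr] := rhoP ht.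
have t0 : 0 < t by apply: lt_trans ht; exact: theta_star_gt0.
have s0 := dslope_pos br.
rewrite /kappaL /weightL derive1_dtrans// Dr.
by field; rewrite !gt_eqF.
Qed.

Lemma kappaR_rho t : th0 < t -> kappaR mu c t = weightR (rho t).
Proof.
move=> ht; have [br Dr] := rhoP ht.
have t0 : 0 < t by apply: lt_trans ht; exact: theta_star_gt0.
have s0 := dslope_pos br.
rewrite /kappaR /weightR derive1_dtrans// Dr.
by field; rewrite !gt_eqF.
Qed.

Lemma kappaLR_rho t : th0 < t -> kappaLR mu c t = weightLR (rho t).
Proof.
move=> ht; have [br Dr] := rhoP ht.
have t0 : 0 < t by apply: lt_trans ht; exact: theta_star_gt0.
have s0 := dslope_pos br.
rewrite /kappaLR /weightLR derive1_dtrans// Dr -exprVn sqrtr_sqr gtr0_norm ?invr_gt0//.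
by field; rewrite !gt_eqF.
Qed.

Lemma weightL_continuous z : b < z -> {for z, continuous weightL}.
Proof.
move=> bz; have s0 := dslope_pos bz.
apply: cvgM; last by apply: cvgV; [rewrite gt_eqF|exact: dslope_continuous].
apply: cvgM; last exact: dtrans_continuous.
by apply: cvgM; [exact: cvg_cst|exact: phi_continuous].
Qed.

Lemma weightR_continuous z : b < z -> {for z, continuous weightR}.
Proof.
move=> bz; have s0 := dslope_pos bz.
apply: cvgM; last by apply: cvgV; [rewrite gt_eqF|exact: dslope_continuous].
apply: cvgM; last exact: dtrans_continuous.
by apply: cvgM; [exact: cvg_cst|exact: phit_continuous].
Qed.

Lemma weightLR_continuous z : b < z -> {for z, continuous weightLR}.
Proof.
move=> bz; have s0 := dslope_pos bz.
have cD := dtrans_cont bz.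
apply: cvgM; last by apply: cvgV; [rewrite gt_eqF|exact: dslope_continuous].
apply: cvgM; first exact: cvg_cst.
apply: cvgM => //.
by apply: continuous_comp => //; exact: sqrt_continuous.
Qed.

Lemma weightL_ge0 z : b < z -> 0 <= weightL z.
Proof.
move=> bz; rewrite divr_ge0 ?(ltW (dslope_pos bz))//.
by rewrite !mulr_ge0// ?phi_ge0// ltW// dtrans_gt0.
Qed.

Lemma weightR_ge0 z : b < z -> 0 <= weightR z.
Proof.
move=> bz; rewrite divr_ge0 ?(ltW (dslope_pos bz))//.
by rewrite !mulr_ge0// ?phit_ge0// ltW// dtrans_gt0.
Qed.

Lemma weightLR_ge0 z : b < z -> 0 <= weightLR z.
Proof.
move=> bz; rewrite divr_ge0 ?(ltW (dslope_pos bz))//.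
by rewrite !mulr_ge0 ?sqrtr_ge0// ltW// dtrans_gt0.
Qed.

End Outlier_map.

(** * Location and overlaps of outliers *)

Lemma form_upper (R : realFieldType) (g a a' e A A' : R) :
  `|g - (a * A + a' * A')| <= e * (A + A') -> g <= (a + e) * A + (a' + e) * A'.
Proof. by rewrite ler_norml => /andP[_ H]; lra. Qed.

Lemma form_lower (R : realFieldType) (g a a' e A A' : R) :
  `|g - (a * A + a' * A')| <= e * (A + A') -> (a - e) * A + (a' - e) * A' <= g.
Proof. by rewrite ler_norml => /andP[H _]; lra. Qed.

Lemma sqr_comparison (R : realFieldType) (h B dk C0 a a' A Dl W Y : R) :
  0 < h -> h <= 1 -> 0 < dk -> dk <= Dl -> 0 < a -> a <= B -> 0 <= Y -> Y <= C0 ->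
  `|W - a ^+ 2 * A| <= (2 * a * h ^+ 2 + (h ^+ 2) ^+ 2) * Y ->
  `|Dl * A - 2 * a'| <= C0 * h ->
  `|W - a ^+ 2 * (2 * a') / Dl| <= ((2 * B + 1) * C0 + B ^+ 2 / dk * C0) * h.
Proof.
move=> hp h1 dk0 dkD a0 aB Y0 Yle HW HA.
have D0 : 0 < Dl by exact: lt_le_trans dkD.
have h2h : h ^+ 2 <= h by rewrite expr2 ler_piMl// ltW.
have h2p : 0 <= h ^+ 2 by exact: sqr_ge0.
have h4h : (h ^+ 2) ^+ 2 <= h.
  by apply: (le_trans _ h2h); rewrite expr2 ler_piMl// (le_trans h2h).
have -> : W - a ^+ 2 * (2 * a') / Dl = (W - a ^+ 2 * A) +
    a ^+ 2 / Dl * (Dl * A - 2 * a') by field; rewrite gt_eqF.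
apply: le_trans (ler_normD _ _) _; rewrite [leRHS]mulrDl lerD//.
  apply: le_trans HW _.
  have -> : (2 * B + 1) * C0 * h = (2 * B + 1) * h * C0 by ring.
  rewrite ler_pM//; first by rewrite addr_ge0 ?sqr_ge0// !mulr_ge0// ltW.
  rewrite [leRHS]mulrDl mul1r lerD// ler_pM//; first by rewrite mulr_ge0// ltW.
  by rewrite ler_pM2l.
rewrite normrM -mulrA ler_pM//; rewrite gtr0_norm ?divr_gt0 ?exprn_gt0//.
rewrite ler_pM ?invr_ge0 ?sqr_ge0 ?(ltW D0)//.
  by rewrite ler_pXn2r// ?nnegrE ltW// (lt_le_trans a0).
by rewrite lef_pV2 ?posrE.
Qed.

Lemma sqr_le_bound (R : realFieldType) (r M : R) : 0 <= r -> 0 <= M -> r ^+ 2 <= M ->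
  r <= 1 + M.
Proof.
move=> r0 M0 rM; have [r1|r1] := leP r 1; first by rewrite (le_trans r1)// lerDl.
apply: (@le_trans _ _ (r ^+ 2)); first by rewrite expr2 ler_peMr// ltW.
by rewrite (le_trans rM)// lerDr.
Qed.

Lemma ratio_bound (R : realFieldType) (k B r r' : R) : 0 < k -> k <= 1 -> 0 < r -> 0 < r' ->
  r ^+ 2 <= B -> k <= r' ^+ 2 -> r / r' <= (1 + B) / k.
Proof.
move=> k0 k1 r0 r'0 rB kr'.
have r'k : k <= r'.
  have [r1|r1] := leP r' 1; last by apply: le_trans k1 _; exact: ltW.
  by apply: le_trans kr' _; rewrite expr2 ler_piMl// ltW.
rewrite ler_pM ?invr_ge0 ?(ltW r0) ?(ltW r'0)//; last by rewrite lef_pV2 ?posrE.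
by apply: sqr_le_bound => //; [exact: ltW|apply: le_trans rB; exact: sqr_ge0].
Qed.

(** The error analysis of one outlier, reduced to real numbers: [a], [a'] are the
transforms there, [A1], [A2] the masses of [y] and [uu], [vv] the squared
overlaps. The step [h], and with it the accuracy [h ^ 2] required from the local
law, depends on the tolerance [eta] and on bounds that hold uniformly over a
compact window. *)
Lemma overlap_estimate (R : realFieldType) (B k be eta : R) :
  0 < B -> 0 < k -> k <= 1 -> 0 < be -> 0 < eta ->
  exists h : R, [/\ 0 < h, h <= 1 & forall a a' d1 d2 D1 D2 A1 A2 uu vv : R,
    k <= a -> k <= a' -> a <= B -> a' <= B ->
    k <= d1 -> k <= d2 -> d1 <= B -> d2 <= B -> k <= D1 -> k <= D2 ->
    `|D1 - d1| <= B * h -> `|D2 - d2| <= B * h -> 0 <= A1 -> 0 <= A2 ->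
    `|a * A1 - a' * A2| <= 2 * h ^+ 2 * (A1 + A2) ->
    `|h * D1 * A1 + h * D2 * A2 - 2 * h| <=
       2 * (h ^+ 2 / be) + 2 * h ^+ 2 * (A1 + A2) ->
    `|uu - a ^+ 2 * A1| <= (2 * a * h ^+ 2 + (h ^+ 2) ^+ 2) * (A1 + A2) ->
    `|vv - a' ^+ 2 * A2| <= (2 * a' * h ^+ 2 + (h ^+ 2) ^+ 2) * (A1 + A2) ->
    let Dl := d1 * a' + a * d2 in
    [/\ `|uu - a ^+ 2 * (2 * a') / Dl| <= eta, `|vv - a' ^+ 2 * (2 * a) / Dl| <= eta
      & forall r r' Y nv : R, 0 < r -> 0 < r' -> r ^+ 2 = a -> r' ^+ 2 = a' ->
        0 <= Y -> Y ^+ 2 = A1 + A2 -> 0 <= nv -> nv <= 1 ->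
        2 * (nv * ((r + r') / r' * (h ^+ 2 * Y))) +
        `|r / r' * vv - r / r' * (a' ^+ 2 * (2 * a) / Dl)| <= eta]].
Proof.
move=> B0 k0 k1 be0 eta0.
have [C0 [h0 [C00 h00 mass]]] := mass_estimate B0 k0 be0.
have [dk dkE] : exists dk : R, dk = 2 * (k * k) by eexists.
have dk0 : 0 < dk by rewrite dkE !mulr_gt0.
have [C1 C1E] : exists C1 : R, C1 = (2 * B + 1) * C0 + B ^+ 2 / dk * C0 by eexists.
have B11 : 0 < 1 + B by rewrite addr_gt0.
have C10 : 0 < C1.
  rewrite C1E; apply: addr_gt0; apply: mulr_gt0 => //; last first.
    by apply: divr_gt0 => //; exact: exprn_gt0.
  by apply: addr_gt0 => //; exact: mulr_gt0.
have [q qE] : exists q : R, q = (1 + B) / k by eexists.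
have q0 : 0 < q by rewrite qE divr_gt0.
have [C2 C2E] : exists C2 : R, C2 = 2 * ((q + 1) * (1 + C0)) + q * C1 by eexists.
have C20 : 0 < C2.
  rewrite C2E; apply: addr_gt0; apply: mulr_gt0 => //.
  by apply: mulr_gt0; exact: addr_gt0.
have [h hE] : exists h : R, h = Num.min (Num.min 1 h0) (Num.min (eta / C1) (eta / C2)).
  by eexists.
have hp : 0 < h by rewrite hE !lt_min ltr01 h00 !divr_gt0.
have h1 : h <= 1 by rewrite hE !ge_min lexx.
have hh0 : h <= h0 by rewrite hE !ge_min lexx !orbT.
have hC1 : C1 * h <= eta by rewrite mulrC -ler_pdivlMr// hE !ge_min lexx !orbT.
have hC2 : C2 * h <= eta by rewrite mulrC -ler_pdivlMr// hE !ge_min lexx !orbT.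
have h2p : 0 <= h ^+ 2 by exact: sqr_ge0.
exists h; split => //.
move=> a a' d1 d2 D1 D2 A1 A2 uu vv ka ka' aB a'B kd1 kd2 d1B d2B kD1 kD2 D1l D2l
  A10 A20 bal nrm lo ro Dl.
have a0 : 0 < a by exact: lt_le_trans ka. have a'0 : 0 < a' by exact: lt_le_trans ka'.
have d10 := le_trans (ltW k0) kd1; have d20 := le_trans (ltW k0) kd2.
have [Yle m1 m2] := mass _ _ _ _ _ _ _ _ _ _ hp hh0 h2p (lexx _) (ltW a0) (ltW a'0)
  aB a'B d10 d20 d1B d2B kD1 kD2 D1l D2l A10 A20 bal nrm.
have Y0 : 0 <= A1 + A2 by exact: addr_ge0.
have dkD : dk <= Dl.
  by rewrite dkE mulr_natl mulr2n lerD// ler_pM// ltW.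
have resL := sqr_comparison hp h1 dk0 dkD a0 aB Y0 Yle lo m1.
have resR := sqr_comparison hp h1 dk0 dkD a'0 a'B Y0 Yle ro m2.
rewrite -C1E in resL resR.
split; [exact: le_trans resL hC1|exact: le_trans resR hC1|].
move=> r r' Y nv r0 r'0 ra r'a Yp YE nv0 nv1.
have rq : r / r' <= q by rewrite qE; apply: ratio_bound; rewrite ?ra ?r'a.
have YC : Y <= 1 + C0 by apply: sqr_le_bound; rewrite ?YE// ltW.
have h2h : h ^+ 2 <= h by rewrite expr2 ler_piMl// ltW.
apply: le_trans hC2; rewrite C2E [leRHS]mulrDl lerD//.
  have -> : 2 * ((q + 1) * (1 + C0)) * h = 2 * (1 * ((q + 1) * (h * (1 + C0)))) by ring.
  have Yh : 0 <= h ^+ 2 * Y by exact: mulr_ge0.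
  have rr : 0 <= (r + r') / r' by rewrite divr_ge0 ?addr_ge0 ?(ltW r0) ?(ltW r'0).
  have rr' : (r + r') / r' <= q + 1 by rewrite mulrDl divff ?gt_eqF// lerD2r.
  rewrite ler_wpM2l//; apply: ler_pM => //; first exact: mulr_ge0.
  by apply: ler_pM => //; exact: ler_pM.
rewrite -mulrBr normrM gtr0_norm ?divr_gt0// -[q * C1 * h]mulrA.
by rewrite ler_pM ?divr_ge0 ?(ltW r0) ?(ltW r'0).
Qed.

Section Location.
Variables (R : realType) (mu : probability R R) (c : R).
Local Notation C := R[i].
Local Notation S := (measure_support mu).
Hypothesis S_ge0 : S `<=` `[0, +oo[.
Hypothesis S_compact : compact S.
Hypotheses (c_gt0 : 0 < c) (c_le1 : c <= 1).
Hypothesis edge : edge_condition mu c.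
Local Notation b := (noise_edge mu).
Local Notation phi1 := (phi_real mu).
Local Notation phi2 := (phit_real mu c).
Local Notation D := (dtrans_real mu c).
Local Notation rho := (rho mu c).

Let dtrans_mono x y : b < x -> b < y -> (D y < D x) = (x < y).
Proof. exact: dtrans_lt_mono. Qed.
Let dtrans_pos z : b < z -> 0 < D z. Proof. exact: dtrans_gt0. Qed.
Let phi1_gt0 z : b < z -> 0 < phi1 z. Proof. exact: phi_gt0. Qed.
Let phi2_gt0 z : b < z -> 0 < phi2 z. Proof. exact: phit_gt0. Qed.
Let dsub_ge x y : b < x -> x <= y ->
  (y - x) * ((x * y)^-1 * (x^-1 + y^-1)) <= D x - D y.
Proof. exact: dtrans_sub_ge. Qed.
Let b_ge0 : 0 <= b. Proof. exact: edge_ge0. Qed.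

Definition local_law_on n m k (X : 'M[C]_(n, m)) (U : 'M[C]_(n, k))
    (V : 'M[C]_(m, k)) (p q e : R) : Prop :=
  forall x : R, p <= x <= q -> shifted X x \in unitmx /\
    opnorm (compressed_resolvent X U V x%:C - limit_block mu c k x%:C) <= e.

Lemma local_law_vector n m k (X : 'M[C]_(n, m)) (U : 'M[C]_(n, k))
    (V : 'M[C]_(m, k)) x e (y z : 'cV[C]_k) : b < x ->
  opnorm (compressed_resolvent X U V x%:C - limit_block mu c k x%:C) <= e ->
  norm2 (compressed_resolvent X U V x%:C *m col_mx y z
    - col_mx ((phi1 x)%:C *: y) ((phi2 x)%:C *: z)) <= e * norm2 (col_mx y z).
Proof.
move=> bx He; have -> : col_mx ((phi1 x)%:C *: y) ((phi2 x)%:C *: z) =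
    limit_block mu c k x%:C *m col_mx y z.
  rewrite /limit_block (phi_realE S_ge0 S_compact bx) phit_realE//.
  by rewrite mul_block_col !mul0mx !mul_scalar_mx addr0 add0r.
rewrite -mulmxBl; apply: le_trans (norm2_mulmx _ _) _.
by rewrite ler_wpM2r ?norm2_ge0.
Qed.

(** On a compact window a shift of [x] by [dl] changes [d] by a definite amount, by
[dtrans_sub_ge]; this absorbs an error [e0] in both transforms. *)
Lemma dtrans_window p q dl : b < p - dl -> p <= q -> 0 < dl ->
  exists2 e0 : R, 0 < e0 & forall x : R, p <= x <= q ->
    [/\ e0 < phi1 x, e0 < phi2 x, (phi1 x + e0) * (phi2 x + e0) <= D (x - dl)
      & D (x + dl) <= (phi1 x - e0) * (phi2 x - e0)].
Proof.
move=> bp pq dl0; have [g gE] : exists g : R, g = p - dl - b by eexists.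
have g0 : 0 < g by rewrite gE subr_gt0.
have q0 : 0 < q by have := b_ge0; lra.
have [Q QE] : exists Q : R, Q = q + dl by eexists.
have Q0 : 0 < Q by rewrite QE addr_gt0.
have [w wE] : exists w : R, w = dl * ((Q * Q)^-1 * (Q^-1 + Q^-1)) by eexists.
(* [w] bounds the drop of [d] over a step [dl] from below, and [e0 * K] the effect
   of the error [e0] on the product of the transforms from above. *)
have w0 : 0 < w by rewrite wE !mulr_gt0 ?addr_gt0 ?invr_gt0 ?mulr_gt0.
have gV : 0 < g^-1 by rewrite invr_gt0.
have [K KE] : exists K : R, K = 2 * g^-1 + 1 by eexists.
have K0 : 0 < K by rewrite KE addr_gt0 ?mulr_gt0.
pose e0 := Num.min 1 (Num.min (q^-1 / 2) (w / K)).
have e00 : 0 < e0 by rewrite !lt_min ltr01 !divr_gt0 ?invr_gt0.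
have e01 : e0 <= 1 by rewrite ge_min lexx.
have e0q : e0 <= q^-1 / 2 by rewrite !ge_min lexx !orbT.
have e0w : e0 * K <= w by rewrite -ler_pdivlMr// !ge_min lexx !orbT.
clearbody e0; exists e0 => // x /andP[px xq].
have bx : b < x by lra.
have bxd : b < x - dl by lra.
have x0 : 0 < x by have := b_ge0; lra.
have gx : b + g <= x by rewrite gE; lra.
have qx : q^-1 <= x^-1 by rewrite lef_pV2 ?posrE.
have f1 : x^-1 <= phi1 x by exact: phi_ge.
have f2 : x^-1 <= phi2 x by exact: phit_ge.
have qV : 0 < q^-1 by rewrite invr_gt0.
have g1 : phi1 x <= g^-1 by exact: phi_le.
have g2 : phi2 x <= g^-1 by exact: phit_le.
have DE : D x = phi1 x * phi2 x by exact: dtrans_realE.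
have ee : e0 * (phi1 x + phi2 x + e0) <= e0 * K.
  by rewrite ler_wpM2l ?(ltW e00)// KE; lra.
have ge_w (y z : R) : 0 < y -> 0 < z -> y <= Q -> z <= Q ->
    w <= dl * ((y * z)^-1 * (y^-1 + z^-1)).
  move=> y0 z0 yQ zQ; rewrite wE ler_wpM2l ?(ltW dl0)// ler_pM ?addr_ge0 ?invr_ge0 ?mulr_ge0 ?(ltW Q0)//.
    by rewrite lef_pV2 ?posrE ?mulr_gt0// ler_pM// ltW.
  by rewrite lerD// lef_pV2 ?posrE.
split; [lra|lra| |].
- have h1 : w <= D (x - dl) - D x.
    have := dsub_ge bxd (y := x).
    rewrite lerBlDr lerDl (ltW dl0) => /(_ isT); apply: le_trans.
    rewrite (_ : x - (x - dl) = dl); last by ring.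
    by apply: ge_w => //; rewrite ?QE; have := b_ge0; lra.
  have -> : (phi1 x + e0) * (phi2 x + e0) = D x + e0 * (phi1 x + phi2 x + e0).
    by rewrite DE; ring.
  lra.
- have h1 : w <= D x - D (x + dl).
    have := dsub_ge bx (y := x + dl).
    rewrite lerDl (ltW dl0) => /(_ isT); apply: le_trans.
    rewrite (_ : x + dl - x = dl); last by ring.
    by apply: ge_w => //; rewrite ?QE; lra.
  have -> : (phi1 x - e0) * (phi2 x - e0) = D x - e0 * (phi1 x + phi2 x + e0)
      + 2 * (e0 * e0) by rewrite DE; ring.
  have := mulr_gt0 e00 e00; lra.
Qed.

(** Outliers and spikes are matched by index: [outlier_le] and [outlier_gt] compare
[G x] with [diag (phi x + e0, phit x + e0)] and [diag (phi x - e0, phit x - e0)],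
and [dtrans_window] returns from the perturbed products to [rho]. *)
Lemma outlier_location p q dl : b < p - dl -> p <= q -> 0 < dl ->
  exists2 e0 : R, 0 < e0 & forall (F : base_field) n m k (X P : 'M[C]_(n, m))
    (U : 'M[C]_(n, k)) (s : 'rV[R]_k) (V : 'M[C]_(m, k))
    (Q : 'M[C]_n) (sg : 'rV[R]_n) (T : 'M[C]_(m, n)),
  is_svd F P U s V -> is_svd F (X + P) Q sg T ->
  opnorm X < p -> local_law_on X U V p q e0 ->
  forall x : R, p <= x <= q ->
  (forall j : 'I_n, x < sg 0 j -> exists2 i : 'I_k, i = j :> nat & x - dl < rho (s 0 i))
  /\ (forall (i : 'I_k) (j : 'I_n), i = j :> nat -> x + dl < rho (s 0 i) -> x < sg 0 j).
Proof.
move=> bp pq dl0; have [e0 e00 win] := dtrans_window bp pq dl0.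
exists e0 => // F n m k X P U s V Q sg T P_svd W_svd Xp law x xpq.
have [px xq] := andP xpq; have [xu dev] := law x xpq.
have [w1 w2 w3 w4] := win x xpq.
have bx : b < x by lra.
have Xx : opnorm X < x by exact: lt_le_trans px.
have s_ge0 i : 0 <= s 0 i by case: P_svd.
have s_sorted (i i' : 'I_k) : (i <= i')%N -> s 0 i' <= s 0 i.
  by case: P_svd => _ _ _ + _; exact.
have dev1 (y z : 'cV[C]_k) := local_law_vector y z bx dev.
have fdev (y z : 'cV[C]_k) := form_dev dev1 y z.
have p1 := phi1_gt0 bx; have p2 := phi2_gt0 bx.
split.
  move=> j xj.
  have [[i ji]|no] := pselect (exists i : 'I_k,
      (j <= i)%N && (1 < s 0 i ^+ 2 * ((phi1 x + e0) * (phi2 x + e0)))).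
    have /andP[ji' si] := ji.
    have jk : (j < k)%N by apply: leq_ltn_trans (ltn_ord i).
    exists (Ordinal jk) => //.
    have sij : s 0 i <= s 0 (Ordinal jk) by exact: s_sorted.
    rewrite rho_gt//; last by lra.
    apply: lt_le_trans si _; apply: ler_pM; rewrite ?sqr_ge0//.
      by rewrite mulr_ge0// ltW// addr_gt0.
    by rewrite ler_pXn2r ?nnegrE.
  have : sg 0 j <= x.
    apply: (outlier_le P_svd W_svd Xx xu (addr_gt0 p1 e00) (addr_gt0 p2 e00)).
      by move=> y z; exact: form_upper (fdev y z).
    move=> i ji; rewrite leNgt; apply/negP => si; apply: no.
    by exists i; rewrite ji.
  by rewrite leNgt xj.
move=> i j ij xi.
apply: (outlier_gt P_svd W_svd ij Xx xu (a := phi1 x - e0) (a' := phi2 x - e0)).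
- by rewrite subr_gt0.
- by rewrite subr_gt0.
- by move=> y z; exact: form_lower (fdev y z).
- move=> l li; have := xi; rewrite rho_gt//; last by lra.
  move=> /lt_le_trans; apply; apply: ler_pM; rewrite ?sqr_ge0//.
    by rewrite ltW// dtrans_pos//; lra.
  by rewrite ler_pXn2r ?nnegrE// s_sorted.
Qed.

(** [mass_balance] and [mass_normalization] feed [overlap_estimate], whose divided
differences are taken between [lam] and [lam + h]; this is why the local law is
needed up to [q + 1]. *)
Lemma overlap_limits p q eta : b < p -> p <= q -> 0 < eta ->
  exists2 e0 : R, 0 < e0 & forall (F : base_field) n m k (X P : 'M[C]_(n, m))
    (U : 'M[C]_(n, k)) (s : 'rV[R]_k) (V : 'M[C]_(m, k))
    (Q : 'M[C]_n) (sg : 'rV[R]_n) (T : 'M[C]_(m, n)),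
  is_svd F P U s V -> is_svd F (X + P) Q sg T ->
  opnorm X <= (b + p) / 2 -> local_law_on X U V p (q + 1) e0 ->
  forall j : 'I_n, p <= sg 0 j <= q ->
  [/\ Normc.normc (overlap U Q j - (weightL mu c (sg 0 j))%:C) <= eta,
      Normc.normc (overlap V T j - (weightR mu c (sg 0 j))%:C) <= eta
    & Normc.normc (cross_overlap U V Q T j - (weightLR mu c (sg 0 j))%:C) <= eta].
Proof.
move=> bp pq eta0.
have [g gE] : exists g : R, g = p - b by eexists.
have g0 : 0 < g by rewrite gE subr_gt0.
have gV : 0 < g^-1 by rewrite invr_gt0.
have q0 : 0 < q by have := b_ge0; lra.
have B2 : 0 < g^-1 ^+ 2 by rewrite exprn_gt0.
have B3 : 0 < g^-1 ^+ 3 by rewrite exprn_gt0.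
have [B [B0 gB gB2 gB3]] : exists B : R,
    [/\ 0 < B, g^-1 <= B, g^-1 ^+ 2 <= B & g^-1 ^+ 3 <= B].
  by exists (g^-1 + g^-1 ^+ 2 + g^-1 ^+ 3); split; lra.
(* On the window [B] and [kp] are upper and lower bounds for the transforms, their
   slopes and divided differences; the cube comes from [phi_dd_lip]. *)
have [q1 q1E] : exists q1 : R, q1 = q + 1 by eexists.
have q10 : 0 < q1 by rewrite q1E addr_gt0.
have q11 : 1 <= q1 by rewrite q1E; lra.
have [kp kpE] : exists kp : R, kp = (q1 * q1)^-1 by eexists.
have kp0 : 0 < kp by rewrite kpE invr_gt0 mulr_gt0.
have kp1 : kp <= 1 by rewrite kpE invf_le1 ?mulr_gt0// mulr_ege1.
have kpq : kp <= q1^-1.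
  by rewrite kpE lef_pV2 ?posrE ?mulr_gt0// ler_peMl ?(ltW q10).
have be0 : 0 < g / 2 by rewrite divr_gt0.
have [h [hp h1 est]] := overlap_estimate B0 kp0 kp1 be0 eta0.
have e0 : 0 < h ^+ 2 by rewrite exprn_gt0.
exists (h ^+ 2) => // F n m k X P U s V Q sg T P_svd W_svd Xp law j jpq.
have [lam lamE] : exists lam, lam = sg 0 j by eexists.
have := jpq; rewrite -lamE => /andP[pj jq].
have in1 : p <= lam <= q + 1 by rewrite pj (le_trans jq)// lerDl.
have in2 : p <= lam + h <= q + 1.
  by rewrite lerD// andbT (le_trans pj)// lerDl ltW.
have bl : b < lam by exact: lt_le_trans pj.
have blh : b < lam + h by rewrite (lt_trans bl)// ltrDl.
have [un1 dv1] := law _ in1; have [un2 dv2] := law _ in2.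
have [u uE] : exists u, u = U^t* *m col j Q by eexists.
have [v vE] : exists v, v = V^t* *m col j T by eexists.
have [yL yLE] : exists yL, yL = cdiag s *m v by eexists.
have [yR yRE] : exists yR, yR = cdiag s *m u by eexists.
have s_ge0 i : 0 <= s 0 i by case: P_svd.
have vec1 (y z : 'cV[C]_k) := local_law_vector y z bl dv1.
have vec2 (y z : 'cV[C]_k) := local_law_vector y z blh dv2.
have eig : compressed_resolvent X U V lam%:C *m col_mx yL yR = col_mx u v.
  rewrite lamE yLE yRE uE vE; apply: (compressed_eigenvector P_svd W_svd).
  by rewrite -lamE.
have := vec1 yL yR; rewrite eig opp_col_mx add_col_mx => Ev.
have E1 := le_trans (norm2_colu _ _) Ev; have E2 := le_trans (norm2_cold _ _) Ev.
have be_le : g / 2 <= lam + h - opnorm X.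
  rewrite lerBrDl; apply: (@le_trans _ _ ((b + p) / 2 + g / 2)); first by rewrite lerD2r.
  rewrite -mulrDl gE (_ : b + p + (p - b) = p * 2) ?mulfK ?(le_trans pj) ?lerDl ?ltW//.
  by ring.
have p1 := phi1_gt0 bl; have p2 := phi2_gt0 bl.
have bal := mass_balance yLE yRE E1 E2.
have nrm := mass_normalization P_svd W_svd lamE hp be0 be_le un1 un2 vec1 vec2 uE vE yLE yRE.
have lo := left_overlap (ltW e0) p1 E1.
have ro := right_overlap (ltW e0) p2 E2.
have gl : b + g <= lam by rewrite gE addrC subrK.
have glh : b + g <= lam + h by rewrite (le_trans gl)// lerDl ltW.
have lamp : 0 < lam by exact: le_lt_trans bl.
have lamhp : 0 < lam + h by exact: le_lt_trans blh.
have lamq : lam <= q1 by case/andP: in1; rewrite q1E.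
have lamhq : lam + h <= q1 by case/andP: in2; rewrite q1E.
have kle (y z : R) : 0 < y -> 0 < z -> y <= q1 -> z <= q1 -> kp <= (y * z)^-1.
  move=> y0 z0 yq zq; rewrite kpE lef_pV2 ?posrE ?mulr_gt0// ler_pM//; exact: ltW.
have klam : kp <= lam^-1 by apply: le_trans kpq _; rewrite lef_pV2 ?posrE.
have f1k : kp <= phi1 lam by apply: le_trans klam _; exact: phi_ge.
have f2k : kp <= phi2 lam by apply: le_trans klam _; exact: phit_ge.
have f1B : phi1 lam <= B by apply: le_trans gB; exact: phi_le.
have f2B : phi2 lam <= B by apply: le_trans gB; exact: phit_le.
have d1k : kp <= slope1 mu lam.
  by apply: le_trans (kle _ _ lamp lamp lamq lamq) _; exact: phi_dd_ge.
have d2k : kp <= slope2 mu c lam.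
  by apply: le_trans (kle _ _ lamp lamp lamq lamq) _; exact: phit_dd_ge.
have d1B : slope1 mu lam <= B by apply: le_trans gB2; exact: phi_dd_le.
have d2B : slope2 mu c lam <= B by apply: le_trans gB2; exact: phit_dd_le.
have D1k : kp <= phi_dd mu lam (lam + h).
  by apply: le_trans (kle _ _ lamp lamhp lamq lamhq) _; exact: phi_dd_ge.
have D2k : kp <= phit_dd mu c lam (lam + h).
  by apply: le_trans (kle _ _ lamp lamhp lamq lamhq) _; exact: phit_dd_ge.
have dlt : `|lam - (lam + h)| = h by rewrite opprD addNKr normrN gtr0_norm.
have gBh : g^-1 ^+ 3 * h <= B * h by rewrite ler_wpM2r ?(ltW hp).
have D1l : `|phi_dd mu lam (lam + h) - slope1 mu lam| <= B * h.
  by apply: le_trans gBh; rewrite -[X in _ * X]dlt; exact: phi_dd_lip.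
have D2l : `|phit_dd mu c lam (lam + h) - slope2 mu c lam| <= B * h.
  by apply: le_trans gBh; rewrite -[X in _ * X]dlt; exact: phit_dd_lip.
have dh : lam + h - lam = h by rewrite addrC addKr.
rewrite phi_sub// phit_sub// dh in nrm.
have [resL resR resLR] := est _ _ _ _ _ _ _ _ _ _ f1k f2k f1B f2B d1k d2k d1B d2B D1k D2k
  D1l D2l (dot_ge0 yL) (dot_ge0 yR) bal nrm lo ro.
have DE : D lam = phi1 lam * phi2 lam by exact: dtrans_realE.
have DlE : slope1 mu lam * phi2 lam + phi1 lam * slope2 mu c lam = dslope mu c lam by [].
have D0 : 0 < dslope mu c lam by exact: dslope_gt0.
have LE : phi1 lam ^+ 2 * (2 * phi2 lam) / dslope mu c lam = weightL mu c lam.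
  by rewrite /weightL DE; congr (_ / _); ring.
have RE : phi2 lam ^+ 2 * (2 * phi1 lam) / dslope mu c lam = weightR mu c lam.
  by rewrite /weightR DE; congr (_ / _); ring.
rewrite DlE LE in resL; rewrite DlE RE in resR; rewrite DlE RE in resLR.
split.
- by rewrite /overlap -uE sqr_norm2 -rmorphB normc_real.
- by rewrite /overlap -vE sqr_norm2 -rmorphB normc_real.
have [r r0 rE] : exists2 r : R, 0 < r & r ^+ 2 = phi1 lam.
  by exists (Num.sqrt (phi1 lam)); rewrite ?sqrtr_gt0// sqr_sqrtr// ltW.
have [r' r'0 r'E] : exists2 r : R, 0 < r & r ^+ 2 = phi2 lam.
  by exists (Num.sqrt (phi2 lam)); rewrite ?sqrtr_gt0// sqr_sqrtr// ltW.
have cd := cross_overlap_dev s_ge0 yLE yRE E1 E2 r0 r'0 rE r'E.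
have -> : cross_overlap U V Q T j = (v^t* *m u) 0 0.
  rewrite /cross_overlap -uE -mulmxA (_ : (col j T)^t* *m V = v^t*); last first.
    by rewrite vE trmxCM trmxCK.
  by rewrite mxtrace_mulC trace_mx11.
have nv1 : norm2 v <= 1.
  rewrite -(@ler_pXn2r _ 2)// ?nnegrE ?norm2_ge0// expr1n sqr_norm2 vE.
  have [_ [_ V1] _ _ _] := P_svd; apply: le_trans (bessel _ V1) _.
  by rewrite dot_stiefel_col//; case: W_svd => _ [].
have LRE : weightLR mu c lam = r / r' * weightR mu c lam.
  rewrite /weightLR /weightR DE -rE -r'E -exprMn sqrtr_sqr gtr0_norm ?mulr_gt0//.
  by field; rewrite !gt_eqF.
have -> : (v^t* *m u) 0 0 - (weightLR mu c lam)%:C =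
    ((v^t* *m u) 0 0 - (r / r' * dot v v)%:C) +
    ((r / r' * dot v v)%:C - (weightLR mu c lam)%:C) by rewrite addrA subrK.
apply: le_trans (le_normcD _ _) _.
have YE : norm2 (col_mx yL yR) ^+ 2 = dot yL yL + dot yR yR by rewrite norm2_col !sqr_norm2.
apply: le_trans (resLR r r' _ _ r0 r'0 rE r'E (norm2_ge0 _) YE (norm2_ge0 v) nv1).
by rewrite -rmorphB normc_real LRE lerD2r.
Qed.

End Location.

(** * Linear statistics of outliers *)

Lemma compact_unif_continuous (R : realType) (f : R -> R) (p q eta : R) :
  continuous f -> 0 < eta ->
  exists2 d : R, 0 < d & forall x y : R, p <= x <= q -> `|x - y| < d -> `|f x - f y| <= eta.
Proof.
move=> cf eta0.
have /compact_near_coveringP cov : compact `[p, q]%classic by exact: segment_compact.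
have := cov R (0^'+) (fun d x => forall y, `|x - y| < d -> `|f x - f y| <= eta) _.
case.
- move=> x _; have eta2 : 0 < eta / 2 by rewrite divr_gt0.
  have /nbhs_ballP[r /= r0 fr] : \forall z \near x, `|f x - f z| < eta / 2.
    by move/cvgrPdist_lt : (cf x); exact.
  exists (ball x (r / 2), [set d | d < r / 2]); first split => /=.
  + by apply: nbhsx_ballx; rewrite divr_gt0.
  + by apply: nbhs_right_lt; rewrite divr_gt0.
  + move=> [x' d] /= [xx' dr] y x'y.
    have b1 : ball x r x' by apply: le_ball xx'; rewrite ler_pdivrMr//; lra.
    have b2 : ball x r y.
      rewrite /ball /= in xx' *; have := ler_distD x' x y; lra.
    have := fr _ b1; have := fr _ b2; have := ler_distD (f x) (f x') (f y).
    by rewrite (distrC (f x') (f x)) /=; lra.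
- move=> d /= d0 H; exists (d / 2); first by rewrite divr_gt0.
  move=> x y xpq; apply: H => //=.
  + by rewrite sub0r normrN gtr0_norm ?divr_gt0// ltr_pdivrMr//; lra.
  + by rewrite divr_gt0.
Qed.

Section Statistics.
Variables (R : realType) (mu : probability R R) (c : R).
Local Notation C := R[i].
Local Notation S := (measure_support mu).
Hypothesis S_ge0 : S `<=` `[0, +oo[.
Hypothesis S_compact : compact S.
Hypotheses (c_gt0 : 0 < c) (c_le1 : c <= 1).
Hypothesis edge : edge_condition mu c.
Local Notation b := (noise_edge mu).
Local Notation rho := (rho mu c).
Local Notation local_law_on := (local_law_on mu c).

Lemma local_law_onS n m k (X : 'M[C]_(n, m)) (U : 'M[C]_(n, k)) (V : 'M[C]_(m, k))
    p q e p' q' e' : p <= p' -> q' <= q -> e <= e' ->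
  local_law_on X U V p q e -> local_law_on X U V p' q' e'.
Proof.
move=> pp qq ee H x /andP[px xq].
have [|u d] := H x; first by rewrite (le_trans pp px) (le_trans xq qq).
by split => //; exact: le_trans ee.
Qed.

(** Term by term, either [sg 0 j] and [rho (s 0 j)] are close and uniform continuity
of [f] applies, or, since no point of the window can separate them, both lie on
the same side of the support of [f]. *)
Lemma outlier_sum (f : R -> R) (eta : R) :
  test_function `]b, +oo[%classic f -> 0 < eta ->
  exists p q e0 : R, [/\ b < p, p <= q, 0 < e0
    & forall (F : base_field) n m k (X P : 'M[C]_(n, m))
    (U : 'M[C]_(n, k)) (s : 'rV[R]_k) (V : 'M[C]_(m, k))
    (Q : 'M[C]_n) (sg : 'rV[R]_n) (T : 'M[C]_(m, n)),
  (k <= n)%N -> is_svd F P U s V -> is_svd F (X + P) Q sg T ->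
  opnorm X < p -> local_law_on X U V p q e0 ->
  (forall j : 'I_n, f (sg 0 j) != 0 -> (j < k)%N) /\
  `|\sum_j f (sg 0 j) - \sum_i f (rho (s 0 i))| <= k%:R * eta].
Proof.
move=> /test_functionP[cf [p0 [q0 [bp0 pq0 fpq]]]] eta0.
have [d0 d00 uc] := compact_unif_continuous (p0) (q0) cf eta0.
have [dl [dl0 dld0 dlp]] : exists dl : R, [/\ 0 < dl, dl < d0 & b < p0 - 3 * dl].
  exists (Num.min (d0 / 2) ((p0 - b) / 4)); split.
  - by rewrite lt_min !divr_gt0// subr_gt0.
  - by rewrite gt_min ltr_pdivrMr//; apply/orP; left; lra.
  - have : Num.min (d0 / 2) ((p0 - b) / 4) <= (p0 - b) / 4 by rewrite ge_min lexx orbT.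
    lra.
(* The window exceeds the support of [f] by twice the uncertainty [dl] of the
   location, so that singular values and spike images are told apart there. *)
have [p pE] : exists p : R, p = p0 - 2 * dl by eexists.
have [q qE] : exists q : R, q = q0 + 2 * dl by eexists.
have bp : b < p - dl by lra.
have pq : p <= q by lra.
have [e0 e00 loc] := outlier_location S_ge0 S_compact c_gt0 c_le1 edge bp pq dl0.
exists p, q, e0; split => //; first lra.
move=> F n m k X P U s V Q sg T kn P_svd W_svd Xp law.
have {}loc := loc F n m k X P U s V Q sg T P_svd W_svd Xp law.
have f0l x : x < p0 -> f x = 0.
  by move=> xp; apply/eqP/negPn/negP => /fpq; rewrite leNgt xp.
have f0r x : q0 < x -> f x = 0.
  by move=> xp; apply/eqP/negPn/negP => /fpq; rewrite andbC leNgt xp.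
have out (j : 'I_n) : f (sg 0 j) != 0 -> (j < k)%N.
  move=> /fpq /andP[pj _]; have pp : p <= p <= q by rewrite lexx.
  have pj' : p < sg 0 j by lra.
  by have [i <- _] := (loc p pp).1 j pj'.
split => //.
have -> : \sum_j f (sg 0 j) = \sum_(i < k) f (sg 0 (widen_ord kn i)).
  rewrite (bigID (fun j : 'I_n => (j < k)%N)) /= [X in _ + X]big1 ?addr0; last first.
    by move=> j jk; apply/eqP/negPn; apply: contra jk; exact: out.
  by rewrite (big_ord_narrow kn).
rewrite -sumrB.
apply: le_trans (ler_norm_sum _ _ _) _.
have -> : k%:R * eta = \sum_(i < k) eta by rewrite sumr_const card_ord mulr_natl.
apply: ler_sum => i _; set j := widen_ord kn i.
have ij : i = j :> nat by [].
have main1 x : p <= x <= q -> x < sg 0 j -> x - dl < rho (s 0 i).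
  move=> xpq /((loc x xpq).1 j)[i' i'j]; suff -> : i' = i by [].
  by apply: val_inj; rewrite /= i'j.
have main2 x : p <= x <= q -> x + dl < rho (s 0 i) -> x < sg 0 j.
  by move=> xpq; exact: (loc x xpq).2.
move: (sg 0 j) (rho (s 0 i)) main1 main2 => x y main1 main2.
have [near|far] := ltP `|x - y| d0.
  have [xin|xout] := boolP (p0 <= x <= q0); first exact: uc.
  have [yin|yout] := boolP (p0 <= y <= q0); first by rewrite distrC uc// distrC.
  have -> : f x = 0 by apply/eqP/negPn; apply: contra xout; exact: fpq.
  have -> : f y = 0 by apply/eqP/negPn; apply: contra yout; exact: fpq.
  by rewrite subrr normr0 ltW.
suff [-> ->] : f x = 0 /\ f y = 0 by rewrite subrr normr0 ltW.
have [xy|yx] := leP x y.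
  have far' : dl < y - x by rewrite distrC ger0_norm ?subr_ge0// in far; lra.
  have [xp|xp] := ltP x p.
    have yp : y <= p + dl.
      rewrite leNgt; apply/negP => yp.
      by have := main2 p; rewrite lexx pq yp => /(_ isT isT); lra.
    by split; apply: f0l; lra.
  have [xq|xq] := leP x q.
    by have := main2 x; rewrite xp xq => /(_ isT); rewrite ltxx => H; have := H; lra.
  by split; apply: f0r; lra.
have far' : dl < x - y by rewrite gtr0_norm ?subr_gt0// in far; lra.
have [yp|yp] := ltP (y + dl) p.
  have xp : x <= p.
    rewrite leNgt; apply/negP => xp.
    by have := main1 p; rewrite lexx pq xp => /(_ isT isT); lra.
  by split; apply: f0l; lra.
have [yq|yq] := leP (y + dl) q.
  have := main1 (y + dl); rewrite yp yq => /(_ isT).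
  have -> : y + dl < x by lra.
  by move=> /(_ isT); rewrite addrK ltxx.
by split; apply: f0r; lra.
Qed.

(** A weight [w] of the singular vectors with a deterministic limit [W] at the
outliers, uniformly over matrices of all sizes. The four families of measures
correspond to four pairs [w], [W]. *)
Definition overlap_law
    (w : forall n m k, 'M[C]_(n, k) -> 'M[C]_(m, k) -> 'M[C]_n -> 'M[C]_(m, n) -> 'I_n -> C)
    (W : R -> R) : Prop :=
  forall p q eta : R, b < p -> p <= q -> 0 < eta ->
  exists2 e0 : R, 0 < e0 & forall (F : base_field) n m k (X P : 'M[C]_(n, m))
    (U : 'M[C]_(n, k)) (s : 'rV[R]_k) (V : 'M[C]_(m, k))
    (Q : 'M[C]_n) (sg : 'rV[R]_n) (T : 'M[C]_(m, n)),
  is_svd F P U s V -> is_svd F (X + P) Q sg T ->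
  opnorm X <= (b + p) / 2 -> local_law_on X U V p (q + 1) e0 ->
  forall j : 'I_n, p <= sg 0 j <= q ->
  Normc.normc (w n m k U V Q T j - (W (sg 0 j))%:C) <= eta.

Lemma overlap_law_one : overlap_law (fun _ _ _ _ _ _ _ _ => 1) (fun=> 1).
Proof.
move=> p q eta bp pq eta0; exists 1 => // F n m k X P U s V Q sg T _ _ _ _ j _.
by rewrite subrr Normc.normc0 ltW.
Qed.

Lemma overlap_law_left : overlap_law (fun _ _ _ U _ Q _ => overlap U Q) (weightL mu c).
Proof.
move=> p q eta bp pq eta0.
have [e0 e00 H] := overlap_limits S_ge0 S_compact c_gt0 c_le1 bp pq eta0.
exists e0 => // F n m k X P U s V Q sg T h1 h2 h3 h4 j h5.
by have [] := H F n m k X P U s V Q sg T h1 h2 h3 h4 j h5.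
Qed.

Lemma overlap_law_right : overlap_law (fun _ _ _ _ V _ T => overlap V T) (weightR mu c).
Proof.
move=> p q eta bp pq eta0.
have [e0 e00 H] := overlap_limits S_ge0 S_compact c_gt0 c_le1 bp pq eta0.
exists e0 => // F n m k X P U s V Q sg T h1 h2 h3 h4 j h5.
by have [] := H F n m k X P U s V Q sg T h1 h2 h3 h4 j h5.
Qed.

Lemma overlap_law_cross :
  overlap_law (fun _ _ _ U V Q T => cross_overlap U V Q T) (weightLR mu c).
Proof.
move=> p q eta bp pq eta0.
have [e0 e00 H] := overlap_limits S_ge0 S_compact c_gt0 c_le1 bp pq eta0.
exists e0 => // F n m k X P U s V Q sg T h1 h2 h3 h4 j h5.
by have [] := H F n m k X P U s V Q sg T h1 h2 h3 h4 j h5.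
Qed.

Lemma test_function_bounded a (f : R -> R) : test_function `]a, +oo[%classic f ->
  exists2 M : R, 0 < M & forall x, `|f x| <= M.
Proof.
move=> /test_functionP[cf [p [q [ap pq fpq]]]].
have cn : {within `[p, q], continuous (fun x => `|f x|)}.
  by apply: continuous_subspaceT => x; apply: cvg_norm; exact: cf.
have [x _ xmax] := EVT_max pq cn.
exists (`|f x| + 1); first by rewrite ltr_wpDl.
move=> y; have [yin|yout] := boolP (p <= y <= q).
  by apply: (@le_trans _ _ `|f x|); [apply: xmax; rewrite in_itv|rewrite lerDl].
have -> : f y = 0 by apply/eqP/negPn; apply: contra yout; exact: fpq.
by rewrite normr0 addr_ge0.
Qed.

(** At most [k] singular values lie in the support of [f], so replacing their weights
by the limits costs a small multiple of [k]. What remains is the unweighted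
statistic of [f * W], which is a test function too. *)
Lemma statistic_limit w W (f : R -> R) (eta : R) : overlap_law w W ->
  (forall x, b < x -> {for x, continuous W}) ->
  test_function `]b, +oo[%classic f -> 0 < eta ->
  exists p q e0 : R, [/\ b < p, p <= q, 0 < e0
    & forall (F : base_field) n m k (X P : 'M[C]_(n, m))
    (U : 'M[C]_(n, k)) (s : 'rV[R]_k) (V : 'M[C]_(m, k))
    (Q : 'M[C]_n) (sg : 'rV[R]_n) (T : 'M[C]_(m, n)),
  (k <= n)%N -> is_svd F P U s V -> is_svd F (X + P) Q sg T ->
  opnorm X <= (b + p) / 2 -> local_law_on X U V p q e0 ->
  Normc.normc (k%:R^-1 * \sum_j (f (sg 0 j))%:C * w n m k U V Q T j
    - (k%:R^-1 * \sum_i (f (rho (s 0 i)) * W (rho (s 0 i))))%:C) <= eta].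
Proof.
move=> wW cW tf eta0; have eta2 : 0 < eta / 2 by rewrite divr_gt0.
have [p1 [q1 [e1 [bp1 pq1 e10 sum1]]]] := outlier_sum (test_functionM tf cW) eta2.
have [p1' [q1' [e1' [bp1' pq1' e10' sum1']]]] := outlier_sum tf eta2.
have [M M0 fM] := test_function_bounded tf.
have etaM : 0 < eta / 2 / M by rewrite divr_gt0.
have [cf [p0 [q0 [bp0 pq0 fpq]]]] := (test_functionP b f).1 tf.
have [e2 e20 ov] := wW p0 q0 _ bp0 pq0 etaM.
pose p := Num.min p1 (Num.min p1' p0); pose q := Num.max q1 (Num.max q1' (q0 + 1)).
pose e0 := Num.min e1 (Num.min e1' e2).
have bp : b < p by rewrite !lt_min bp1 bp1'.
have p_1 : p <= p1 by rewrite !ge_min lexx.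
have p_1' : p <= p1' by rewrite !ge_min lexx !orbT.
have p_0 : p <= p0 by rewrite !ge_min lexx !orbT.
have q_1 : q1 <= q by rewrite !le_max lexx.
have q_1' : q1' <= q by rewrite !le_max lexx !orbT.
have q_0 : q0 + 1 <= q by rewrite !le_max lexx !orbT.
have e_1 : e0 <= e1 by rewrite !ge_min lexx.
have e_1' : e0 <= e1' by rewrite !ge_min lexx !orbT.
have e_2 : e0 <= e2 by rewrite !ge_min lexx !orbT.
have e00 : 0 < e0 by rewrite !lt_min e10 e10'.
clearbody p q e0.
exists p, q, e0; split => //.
  by apply: le_trans p_1 _; apply: le_trans pq1 _.
move=> F n m k X P U s V Q sg T kn P_svd W_svd Xp law.
have Xltp : opnorm X < p by apply: le_lt_trans Xp _; rewrite ltr_pdivrMr//; lra.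
have law1 := local_law_onS p_1 q_1 e_1 law.
have law1' := local_law_onS p_1' q_1' e_1' law.
have law2 := local_law_onS p_0 q_0 e_2 law.
have [_ s1] := sum1 F n m k X P U s V Q sg T kn P_svd W_svd (lt_le_trans Xltp p_1) law1.
have [out _] := sum1' F n m k X P U s V Q sg T kn P_svd W_svd (lt_le_trans Xltp p_1') law1'.
have Xp0 : opnorm X <= (b + p0) / 2.
  by apply: le_trans Xp _; rewrite ler_pM2r ?invr_gt0// lerD2l.
have {}ov := ov F n m k X P U s V Q sg T P_svd W_svd Xp0 law2.
have [kz|k0] := eqVneq k 0%N.
  have -> : (k%:R : C) = 0 by rewrite kz.
  have -> : (k%:R : R) = 0 by rewrite kz.
  by rewrite !invr0 !mul0r subrr Normc.normc0 ltW.
have kp : 0 < k%:R :> R by rewrite ltr0n lt0n.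
set A := \sum_j _ * _; set B := \sum_i _ * _.
pose D := \sum_j f (sg 0 j) * W (sg 0 j).
have -> : (k%:R : C) = (k%:R : R)%:C by rewrite rmorph_nat.
have -> : (k%:R : R)%:C^-1 = (k%:R^-1 : R)%:C by rewrite fmorphV.
rewrite rmorphM /= -mulrBr Normc.normcM.
have -> : Normc.normc ((k%:R^-1 : R)%:C) = k%:R^-1.
  by rewrite normc_real gtr0_norm ?invr_gt0.
rewrite mulrC ler_pdivrMr//.
have -> : A - B%:C = (A - D%:C) + (D - B)%:C by rewrite rmorphB /= addrA subrK.
apply: le_trans (le_normcD _ _) _.
have -> : eta * k%:R = k%:R * (eta / 2) + k%:R * (eta / 2) by field.
apply: lerD; last first.
  by rewrite normc_real.
have -> : A - D%:C = \sum_j (f (sg 0 j))%:C * (w n m k U V Q T j - (W (sg 0 j))%:C).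
  rewrite /A /D rmorph_sum -sumrB; apply: eq_bigr => j _.
  by rewrite mulrBr rmorphM.
apply: le_trans (normc_sum _ _) _.
rewrite (bigID (fun j : 'I_n => (j < k)%N)) /= [X in _ + X]big1 ?addr0; last first.
  move=> j jk; rewrite (_ : f (sg 0 j) = 0) ?mul0r ?Normc.normc0//.
  by apply/eqP/negPn; apply: contra jk; exact: out.
rewrite (big_ord_narrow kn) /=.
have -> : k%:R * (eta / 2) = \sum_(i < k) (eta / 2) by rewrite sumr_const card_ord mulr_natl.
apply: ler_sum => i _; set j := widen_ord kn i.
rewrite Normc.normcM normc_real.
have [-> |fj] := eqVneq (f (sg 0 j)) 0; first by rewrite normr0 mul0r ltW.
have ovj := ov j (fpq _ fj).
apply: le_trans (ler_pM (normr_ge0 _) (normc_ge0 _) (fM _) ovj) _.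
by rewrite mulrC divfK// gt_eqF.
Qed.

End Statistics.

(** * Events of probability tending to one *)

Section HighProbability.
Context {R : realType} {d : nat -> measure_display}
  {T : forall n, measurableType (d n)}.
Variable Pr : forall n, probability (T n) R.
Implicit Types E : forall n, set (T n).

Lemma whp_near E E' : (\forall n \near \oo, E n `<=` E' n) -> whp Pr E -> whp Pr E'.
Proof.
move=> [N _ sub] [A [mA AE PA]].
exists (fun n => if (N <= n)%N then A n else set0); split.
- by move=> n; case: ifP => _; [exact: mA|exact: measurable0].
- by move=> n; case: ifP => // Nn w Aw; apply: sub => //=; exact: AE.
- apply: cvg_trans PA; apply: near_eq_cvg; exists N => // n /= Nn.
  by rewrite Nn.
Qed.

Lemma whpS E E' : (forall n, E n `<=` E' n) -> whp Pr E -> whp Pr E'.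
Proof. by move=> sub; apply: whp_near; exists 0%N => // n _; exact: sub. Qed.

(** By [Pr (A & B) >= Pr A + Pr B - 1]. *)
Lemma whpI E E' : whp Pr E -> whp Pr E' -> whp Pr (fun n => E n `&` E' n).
Proof.
move=> [A [mA AE PA]] [B [mB BE PB]].
exists (fun n => A n `&` B n); split.
- by move=> n; exact: measurableI.
- by move=> n w [Aw Bw]; split; [exact: AE|exact: BE].
apply: (@squeeze_cvge _ _ _ _ (fun n => Pr n (A n) + Pr n (B n) - 1)%E _ (fun=> 1%E)).
- apply: nearW => n; apply/andP; split; last first.
    by apply: probability_le1; exact: measurableI.
  have fP (C : set (T n)) : measurable C -> Pr n C \is a fin_num.
    by move=> mC; exact: fin_num_measure.
  have mD : measurable (A n `\` B n) by exact: measurableD.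
  have mAB : measurable (A n `&` B n) by exact: measurableI.
  have e1 : Pr n (A n) = (Pr n (A n `\` B n) + Pr n (A n `&` B n))%E.
    exact: (measureDI (Pr n) (mA n) (mB n)).
  have e2 : (Pr n (A n `\` B n) <= 1 - Pr n (B n))%E.
    rewrite -probability_setC//; apply: le_measure; rewrite ?inE//.
      exact: measurableC.
  move: e1 e2.
  case: (Pr n (A n)) (fP _ (mA n)) => // x _; case: (Pr n (B n)) (fP _ (mB n)) => // y _.
  case: (Pr n _) (fP _ mD) => // z _; case: (Pr n _) (fP _ mAB) => // t _.
  by move=> [->]; rewrite -EFinD -!EFinB !lee_fin => h; lra.
- rewrite [X in _ --> X](_ : _ = (1 + 1 - 1)%E); last first.
    by rewrite addeK.
  by apply: cvgeB => //; [apply: cvgeD|exact: cvg_cst].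
- exact: cvg_cst.
Qed.

End HighProbability.

Section RealSegment.
Variable R : realType.
Local Notation C := R[i].

Lemma real_complex_continuous : continuous ((fun x : R => x%:C) : R -> C^o).
Proof.
move=> x; apply/cvgrPdist_lt => e e0.
have eE : e = (complex.Re e)%:C by rewrite RRe_real// gtr0_real.
have re0 : 0 < complex.Re e by move: e0; rewrite eE ltcR.
near=> y; rewrite -rmorphB eE.
have -> : `|(x - y)%:C| = `|x - y|%:C :> C.
  by rewrite normc_def /= expr0n addr0 sqrtr_sqr.
by rewrite ltcR; near: y; exact: cvgr_dist_lt.
Unshelve. all: by end_near. Qed.

Lemma real_segment_compact (p q : R) :
  compact ([set x%:C | x in `[p, q]%classic] : set C^o).
Proof.
apply: (@continuous_compact _ _ ((fun x : R => x%:C) : R -> C^o)).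
  by apply: continuous_subspaceT; exact: real_complex_continuous.
exact: segment_compact.
Qed.

Lemma sup_resolvent_le n m (X : 'M[C]_(n, m)) (K : set C) (h : C -> R) (e : R) z :
  (sup_resolvent X K h <= e%:E)%E -> K z ->
  z%:M - hermitization X \in unitmx /\ h z <= e.
Proof.
move=> supe Kz.
have : ((if (z%:M - hermitization X)%R \in unitmx then (h z)%:E else +oo) <= e%:E)%E.
  by apply: le_trans supe; apply: ereal_sup_ubound; right; exists z.
by case: ifP => // _; rewrite lee_fin.
Qed.
End RealSegment.

(** * Change of variables *)

Section DensityMeasure.
Import HBNNSimple.
Local Open Scope ereal_scope.
Context d (T : measurableType d) (R : realType).
Variables (mu : {measure set T -> \bar R}) (g : T -> R).
Hypotheses (mg : measurable_fun [set: T] g) (g0 : forall x, (0 <= g x)%R).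

Definition density_measure (A : set T) : \bar R := \int[mu]_(x in A) (g x)%:E.

Let meg : measurable_fun [set: T] (EFin \o g). Proof. exact/measurable_EFinP. Qed.

Let density0 : density_measure set0 = 0.
Proof. by rewrite /density_measure integral_set0. Qed.

Let density_ge0 A : 0 <= density_measure A.
Proof. by apply: integral_ge0 => x _; rewrite lee_fin. Qed.

Let density_sigma_additive : semi_sigma_additive density_measure.
Proof.
move=> F mF tF mUF; apply: cvg_toP.
  apply: ereal_nondecreasing_is_cvgn => m n mn.
  by apply: lee_sum_nneg_natr => // k _ _; exact: density_ge0.
rewrite /density_measure ge0_integral_bigcup//; first exact: measurable_funTS.
by move=> x _; rewrite lee_fin.
Qed.

HB.instance Definition _ := isMeasure.Build _ _ _ density_measure
  density0 density_ge0 density_sigma_additive.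

(** For simple [f] both sides are sums over the level sets; the general case follows
by monotone convergence. *)
Lemma ge0_integral_density_measure (f : T -> R) : measurable_fun [set: T] f ->
  (forall x, 0 <= f x)%R ->
  \int[density_measure]_x (f x)%:E = \int[mu]_x (f x * g x)%:E.
Proof.
move=> mf f0; have mef : measurable_fun [set: T] (EFin \o f) by exact/measurable_EFinP.
pose h := nnsfun_approx measurableT mef.
have hf x : (h n x)%:E @[n --> \oo] --> (f x)%:E.
  by apply: (cvg_nnsfun_approx measurableT mef) => // t _; rewrite lee_fin.
have nd x : {homo (fun n => h n x) : a b / (a <= b)%N >-> (a <= b)%R}.
  by move=> a b ab; exact/lefP/nd_nnsfun_approx.
have step n : \int[density_measure]_x (h n x)%:E = \int[mu]_x (h n x * g x)%:E.
  have hE x : (h n x)%:E = \sum_(y \in range (h n)) (y * \1_(h n @^-1` [set y]) x)%:E.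
    by rewrite [h n x in LHS]fimfunE -fsumEFin.
  have r0 y : y \in range (h n) -> (0 <= y)%R by rewrite inE => -[t _ <-].
  have ind0 (nu : {measure set T -> \bar R}) (q : T -> R) :
      measurable_fun [set: T] q -> (forall x, 0 <= q x)%R ->
      \int[nu]_x (h n x * q x)%:E =
      \sum_(y \in range (h n)) y%:E * \int[nu]_(x in h n @^-1` [set y]) (q x)%:E.
    move=> mq q0.
    transitivity (\int[nu]_x (\sum_(y \in range (h n))
        (y * (q \_ (h n @^-1` [set y])) x)%:E)).
      apply: eq_integral => x _; rewrite fsumEFin//; congr EFin.
      rewrite [h n x]fimfunE mulr_fsuml//; apply: eq_fsbigr => y _.
      by rewrite indicE patchE; case: ifP; rewrite ?mulr1 ?mulr0 ?mul0r.
    have mqy y : measurable_fun [set: T] (q \_ (h n @^-1` [set y])).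
      have mh : measurable (h n @^-1` [set y]) by exact: measurable_sfunP.
      by apply/(measurable_restrictT _ mh); exact: measurable_funTS.
    have qy0 y x : (0 <= (q \_ (h n @^-1` [set y])) x)%R.
      by rewrite patchE; case: ifP.
    rewrite ge0_integral_fsum//; first last.
    - move=> y x _; rewrite lee_fin patchE; case: ifPn => [|_]; last by rewrite mulr0.
      by rewrite inE => /= <-; exact: mulr_ge0.
    - by move=> y; apply/measurable_EFinP; exact: measurable_funM.
    apply: eq_fsbigr => y yr; under eq_integral do rewrite EFinM.
    rewrite ge0_integralZl//; last 3 first.
    - exact/measurable_EFinP.
    - by move=> x _; rewrite lee_fin.
    - by rewrite lee_fin r0.
    by congr (_ * _); rewrite [RHS]integral_mkcond; apply: eq_integral => x _;
      rewrite restrict_EFin.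
  have -> : \int[density_measure]_x (h n x)%:E = \int[density_measure]_x (h n x * 1)%:E.
    by apply: eq_integral => x _; rewrite mulr1.
  rewrite (ind0 _ (fun=> 1%R))// (ind0 mu g)//; apply: eq_fsbigr => y yr.
  by rewrite integral_cst//= mul1e.
transitivity (limn (fun n => \int[density_measure]_x (h n x)%:E)).
  rewrite -monotone_convergence//.
  - by apply: eq_integral => x _; apply/esym/cvg_lim => //; exact: hf.
  - by move=> n; exact/measurable_EFinP.
  - by move=> n x _; rewrite lee_fin.
  - by move=> x _ a b ab; rewrite lee_fin nd.
transitivity (limn (fun n => \int[mu]_x (h n x * g x)%:E)).
  by congr (limn _); apply/funext => n; exact: step.
rewrite -monotone_convergence//.
- apply: eq_integral => x _; apply/cvg_lim => //.
  by under eq_fun do rewrite EFinM; rewrite EFinM; apply: cvgeZr => //; exact: hf.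
- by move=> n; apply/measurable_EFinP; exact: measurable_funM.
- by move=> n x _; rewrite lee_fin mulr_ge0.
- by move=> x _ a b ab; rewrite lee_fin ler_wpM2r// nd.
Qed.

End DensityMeasure.

Section SignedIntegrals.
Local Open Scope ereal_scope.

Lemma funepos_mul (T : Type) (R : realType) (f g : T -> R) x : (0 <= g x)%R ->
  (fun x => (f x * g x)%:E)^\+ x = (Num.max (f x) 0 * g x)%R%:E.
Proof.
by move=> gx; rewrite funeposE -EFin_max maxr_pMl// mul0r.
Qed.

(** As [g >= 0], the identity holds for the positive and the negative parts
separately, and so also when the integrals are infinite. *)
Lemma integral_density_measure (d : measure_display) (T : measurableType d) (R : realType)
    (mu : {measure set T -> \bar R}) (g f : T -> R) (mg : measurable_fun [set: T] g)
    (g0 : forall x, (0 <= g x)%R) : measurable_fun [set: T] f ->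
  \int[density_measure mu g]_x (f x)%:E = \int[mu]_x (f x * g x)%:E.
Proof.
move=> mf.
have pos (h : T -> R) : measurable_fun [set: T] h ->
    \int[density_measure mu g]_x (fun x => (h x)%:E)^\+ x
    = \int[mu]_x (fun x => (h x * g x)%:E)^\+ x.
  move=> mh; have mp : measurable_fun [set: T] (fun x => Num.max (h x) 0)%R.
    exact: measurable_maxr.
  transitivity (\int[density_measure mu g]_x (Num.max (h x) 0%R)%:E).
    congr (integral _ _ _); apply/funext => x; by rewrite funeposE -EFin_max.
  rewrite (ge0_integral_density_measure mu mg g0 mp).
    by apply: eq_integral => x _; rewrite funepos_mul.
  by move=> x; rewrite le_max lexx orbT.
rewrite [LHS]integralE [RHS]integralE -(pos f mf); congr (_ - _).
have negE (h : T -> R) : (fun x => (h x)%:E)^\- = (fun x => (- h x)%:E)^\+.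
  by apply/funext => x; rewrite funenegE funeposE -EFinN.
rewrite !negE (pos (fun x => - f x)%R).
  by apply: eq_integral => x _; rewrite !funeposE mulNr.
exact: measurable_funN.
Qed.

Lemma integral_pushforward_real (d : measure_display) (T : measurableType d) (R : realType)
    (nu : {measure set T -> \bar R}) (h : T -> R) (f : R -> R) :
  measurable_fun [set: T] h -> measurable_fun [set: R] f ->
  \int[pushforward nu h]_x (f x)%:E = \int[nu]_x (f (h x))%:E.
Proof.
move=> mh mf; have mef : measurable_fun [set: R] (fun x => (f x)%:E).
  exact/measurable_EFinP.
rewrite [LHS]integralE [RHS]integralE; congr (_ - _).
  rewrite (ge0_integral_pushforward mh nu measurableT)//; last exact: measurable_funepos.
  by rewrite preimage_setT; apply: eq_integral => x _; rewrite /= !funeposE.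
rewrite (ge0_integral_pushforward mh nu measurableT)//; last exact: measurable_funeneg.
by rewrite preimage_setT; apply: eq_integral => x _; rewrite /= !funenegE.
Qed.

End SignedIntegrals.

Section Limits.
Variables (R : realType) (mu : probability R R) (c : R).
Local Notation C := R[i].
Local Notation S := (measure_support mu).
Hypothesis S_ge0 : S `<=` `[0, +oo[.
Hypothesis S_compact : compact S.
Hypotheses (c_gt0 : 0 < c) (c_le1 : c <= 1).
Hypothesis edge : edge_condition mu c.
Local Notation b := (noise_edge mu).
Local Notation th0 := (theta_star mu c).
Local Notation rho := (rho mu c).
Variable H : {finite_measure set R -> \bar R}.
Variables (f W kappa : R -> R).
Hypothesis tf : test_function `]b, +oo[%classic f.
Hypothesis cW : forall x, b < x -> {for x, continuous W}.
Hypothesis W_ge0 : forall x, b < x -> 0 <= W x.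
Hypothesis kappaE : forall t, th0 < t -> kappa t = W (rho t).

Let fW t := f (rho t) * W (rho t).

Lemma spike_test_function : test_function `]th0, +oo[%classic fW.
Proof.
exact: (test_function_rho S_ge0 S_compact c_gt0 c_le1 edge (test_functionM tf cW)).
Qed.

Lemma f_edge : f b = 0.
Proof.
have [_ [p [q [bp _ fpq]]]] := (test_functionP b f).1 tf.
by apply/eqP/negPn/negP => /fpq; rewrite leNgt bp.
Qed.

Lemma Rintegral_spike : \int[H]_(t in `]th0, +oo[) (f (rho t) * kappa t) =
  fine (\int[H]_t (fW t)%:E)%E.
Proof.
rewrite Rintegral_mkcond; congr fine; apply: eq_integral => t _; congr EFin.
rewrite patchE; case: ifPn; rewrite ?inE ?notin_setE /= in_itv /= andbT.
  by move=> ht; rewrite /fW kappaE.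
by move=> /negP; rewrite -leNgt => ht; rewrite /fW rho_sub// f_edge mul0r.
Qed.

Lemma rho_measurable : measurable_fun [set: R] rho.
Proof. by apply: nondecreasing_measurable => // x y; exact: rho_nondecreasing. Qed.

Let density t : R := (kappa \_ `]th0, +oo[) t.

Let density_ge0 t : 0 <= density t.
Proof.
rewrite /density patchE; case: ifPn => //; rewrite inE /= in_itv /= andbT => ht.
rewrite kappaE//; apply: W_ge0.
by have [] := rhoP S_ge0 S_compact c_gt0 c_le1 edge ht.
Qed.

Let density_measurable : measurable_fun [set: R] density.
Proof.
apply/(measurable_restrictT _ (measurable_itv _)).
apply: (eq_measurable_fun (fun t => W (rho t))).
  by move=> t; rewrite inE /= in_itv /= andbT => ht; rewrite kappaE.
apply: open_continuous_measurable_fun; first exact: itv_open_ends_open.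
move=> t; rewrite inE /= in_itv /= andbT => ht.
apply: continuous_comp; first exact: rho_continuous.
by apply: cW; have [] := rhoP S_ge0 S_compact c_gt0 c_le1 edge ht.
Qed.

(** The weight [kappa] has a meaning above [th0] only; elsewhere [rho t = b], where
[f] vanishes. *)
Lemma integral_image_density :
  (\int[pushforward (with_density mu c H kappa) rho]_x (f x)%:E =
   \int[H]_t (fW t)%:E)%E.
Proof.
have -> : with_density mu c H kappa = density_measure H density.
  apply/funext => A; rewrite /with_density /density_measure /density integral_mkcondr.
  by apply: eq_integral => t _; rewrite restrict_EFin.
have mf : measurable_fun [set: R] f.
  by apply: continuous_measurable_fun; case: tf.
rewrite integral_pushforward_real; [|exact: rho_measurable|exact: mf].
rewrite integral_density_measure//; last exact: measurableT_comp mf rho_measurable.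
apply: eq_integral => t _; congr EFin; rewrite /density patchE /fW.
case: ifPn; rewrite ?inE ?notin_setE /= in_itv /= andbT.
  by move=> ht; rewrite kappaE.
by move=> /negP; rewrite -leNgt => ht; rewrite rho_sub// f_edge !mul0r.
Qed.

End Limits.

Section Atoms.
Variable R : realType.
Local Notation C := R[i].

Lemma atomic_integral_restrict N k (s : 'rV[R]_k) (w : 'I_k -> C) (A : set R)
    (f : R -> R) : (forall x, ~ A x -> f x = 0) ->
  atomic_integral (atomic_restrict (weighted_atoms N s w) A) f =
  N%:R^-1 * \sum_j (f (s 0 j))%:C * w j.
Proof.
move=> f0; rewrite /atomic_integral /atomic_restrict big_filter /weighted_atoms.
rewrite big_map big_enum_cond /= mulr_sumr big_mkcond; apply: eq_bigr => j _.
case: asboolP => [_|/f0 ->]; first by rewrite -mulrA; congr (_ * _); rewrite mulrC.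
by rewrite mul0r mulr0.
Qed.

Lemma test_function_eq0 (O : set R) f x : test_function O f -> ~ O x -> f x = 0.
Proof.
move=> [_ _ sub] Ox; apply/eqP/negPn/negP => fx; apply: Ox; apply: sub.
exact: subset_closure.
Qed.
End Atoms.

(** * Convergence of the outlier statistics *)

Section Convergence.
Unset Implicit Arguments.
Variables (R : realType) (F : base_field) (m r : nat -> nat) (c : R)
  (d : nat -> measure_display) (T : forall n, measurableType (d n))
  (Pr : forall n, probability (T n) R).
Local Notation C := R[i].
Variables (X P : forall n, T n -> 'M[R[i]]_(n, m n))
  (U : forall n, T n -> 'M[R[i]]_(n, r n)) (theta : forall n, T n -> 'rV[R]_(r n))
  (V : forall n, T n -> 'M[R[i]]_(m n, r n))
  (uhat : forall n, T n -> 'M[R[i]]_n) (sigma : forall n, T n -> 'rV[R]_n)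
  (vhat : forall n, T n -> 'M[R[i]]_(m n, n)) (mu : probability R R).
Hypotheses (c_gt0 : 0 < c) (c_le1 : c <= 1).
Hypothesis P_svd : forall n w, is_thin_svd F (P n w) (U n w) (theta n w) (V n w).
Hypothesis W_svd : forall n w,
  is_svd F (X n w + P n w) (uhat n w) (sigma n w) (vhat n w).
Hypothesis noise : global_noise_law Pr mu X.
Hypothesis edge : edge_condition mu c.
Hypothesis local_law : subspace_local_law Pr mu c X U V.
Local Notation b := (noise_edge mu).
Local Notation th0 := (theta_star mu c).
Local Notation rho := (rho mu c).
Variable H : {finite_measure set R -> \bar R}.
Hypothesis spikes : vague_cvg_in_prob Pr `]th0, +oo[
    (fun n w => atomic_restrict (empirical (theta n w)) `]th0, +oo[) H.
Set Implicit Arguments.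

Let S_ge0 : measure_support mu `<=` `[0, +oo[. Proof. by case: noise. Qed.
Let S_compact : compact (measure_support mu). Proof. by case: noise. Qed.

(** The segment [[p, q]] is off the cut since [p > b]. *)
Lemma whp_local_law p q e : b < p -> p <= q -> 0 < e ->
  whp Pr (fun n => [set w | opnorm (X n w) <= (b + p) / 2 /\
     local_law_on mu c (X n w) (U n w) (V n w) p q e]).
Proof.
move=> bp pq e0.
pose K : set (C^o) := [set x%:C | x in `[p, q]%classic].
have offK : off_cut mu K.
  move=> z [x]; rewrite /= in_itv /= => /andP[px _] <- [y /andP[_ yb] /complexI xy].
  by move: bp; rewrite ltNge (le_trans px)// xy.
have [eps [_ eps0 law]] := local_law K (@real_segment_compact R p q) offK.
have [_ _ _ opn] := noise.
have pb : 0 < (p - b) / 2 by rewrite divr_gt0// subr_gt0.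
have {}opn := opn _ pb.
apply: whp_near (whpI law opn).
have near_e : \forall n \near \oo, eps n < e.
  by apply: (cvgr_lt 0).
near=> n => w [lw ow]; split.
  have : (`|(Normc.normc ((opnorm (X n w))%:C - b%:C))%:E| < ((p - b) / 2)%:E)%E := ow.
  by rewrite -rmorphB normc_real lte_fin normr_id ltr_norml => /andP[_]; lra.
move=> x xpq; have Kx : K x%:C by exists x; rewrite //= in_itv.
have [xu xd] := sup_resolvent_le lw Kx; split => //.
by apply: le_trans xd _; apply: ltW; near: n.
Unshelve. all: by end_near. Qed.

(** On the event of [whp_local_law] the estimate of [statistic_limit] holds, and the
spike measures converge at the test function [f (rho t) * W (rho t)]. *)
Lemma statistic_cvg w W (f : R -> R) : overlap_law mu c w W ->
  (forall x, b < x -> {for x, continuous W}) -> test_function `]b, +oo[%classic f ->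
  cvg_in_prob Pr (fun n om => (r n)%:R^-1 * \sum_(j < n) (f (sigma n om 0 j))%:C *
      w n (m n) (r n) (U n om) (V n om) (uhat n om) (vhat n om) j)
    (fine (\int[H]_t (f (rho t) * W (rho t))%:E)%E)%:C.
Proof.
move=> wW cW tf e e0; have e2 : 0 < e / 2 by rewrite divr_gt0.
have [p [q [e1 [bp pq e10 st]]]] :=
  statistic_limit S_ge0 S_compact c_gt0 c_le1 edge wW cW tf e2.
have tG := spike_test_function S_ge0 S_compact c_gt0 c_le1 edge tf cW.
have sp := spikes _ tG _ e2.
apply: whpS (whpI (whp_local_law bp pq e10) sp) => n om [/= [Xp law] spn].
have [rk svdP _] := P_svd n om.
have kn : (r n <= n)%N by rewrite -[X in (X <= _)%N]rk rank_leq_row.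
have s1 := st F n (m n) (r n) (X n om) (P n om) (U n om) (theta n om) (V n om) (uhat n om)
  (sigma n om) (vhat n om) kn svdP (W_svd n om) Xp law.
move: spn; rewrite atomic_integral_restrict; last first.
  by move=> x; exact: test_function_eq0 tG.
have -> : (r n)%:R^-1 * \sum_j (f (rho (theta n om 0 j)) * W (rho (theta n om 0 j)))%:C * 1
  = ((r n)%:R^-1 * \sum_i f (rho (theta n om 0 i)) * W (rho (theta n om 0 i)))%:C :> C.
  rewrite rmorphM /= fmorphV rmorph_nat rmorph_sum; congr (_ * _).
  by apply: eq_bigr => j _; rewrite mulr1.
rewrite !lte_fin !ger0_norm ?normc_ge0// => spn.
move: s1 spn; set A := _ * \sum_j _; set B := (_ * _)%:C; set L := _%:C => s1 spn.
have -> : A - L = (A - B) + (B - L) by rewrite addrA subrK.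
apply: le_lt_trans (le_normcD _ _) _; rewrite -/(A - B).
by apply: (@le_lt_trans _ _ (e / 2 + Normc.normc (B - L))); [rewrite lerD2r|lra].
Qed.

Lemma outlier_statistics w W kappa (nu : set R -> \bar R) :
  overlap_law mu c w W ->
  (forall x, b < x -> {for x, continuous W}) ->
  (forall t, th0 < t -> kappa t = W (rho t)) ->
  (forall f, test_function `]b, +oo[%classic f ->
     (\int[nu]_x (f x)%:E = \int[H]_t (f (rho t) * W (rho t))%:E)%E) ->
  let wt n om := w n (m n) (r n) (U n om) (V n om) (uhat n om) (vhat n om) in
  vague_cvg_in_prob Pr `]b, +oo[
    (fun n om => outlier_measure (r n) b (sigma n om) (wt n om)) nu /\
  forall f, test_function `]b, +oo[%classic f ->
    cvg_in_prob Pr (fun n om => (r n)%:R^-1 *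
        \sum_(j < n) (f (sigma n om 0 j))%:C * wt n om j)
      (\int[H]_(t in `]th0, +oo[) (f (rho t) * kappa t))%:C.
Proof.
move=> wW cW kE nuE wt; split=> f tf; last first.
  rewrite (Rintegral_spike H tf kE).
  exact: statistic_cvg.
have := statistic_cvg wW cW tf; rewrite -nuE//.
congr cvg_in_prob; apply: functional_extensionality_dep => n; apply/funext => om.
rewrite /outlier_measure atomic_integral_restrict//.
by move=> x; exact: test_function_eq0 tf.
Qed.

End Convergence.

Theorem theorem3p11 (R : realType) (F : base_field)
  (m r : nat -> nat) (c : R)
  (d : nat -> measure_display) (T : forall n, measurableType (d n))
  (Pr : forall n, probability (T n) R)
  (m_ge : forall n, (n <= m n)%N)
  (c_gt0 : 0 < c) (c_le1 : c <= 1)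
  (m_lim : (fun n => n%:R / (m n)%:R : R) @ \oo --> c)
  (X P : forall n, T n -> 'M[R[i]]_(n, m n))
  (X_random : forall n, random_matrix (X n))
  (P_random : forall n, random_matrix (P n))
  (X_over : forall n w, mx_over F (X n w))
  (P_over : forall n w, mx_over F (P n w))
  (U : forall n, T n -> 'M[R[i]]_(n, r n))
  (theta : forall n, T n -> 'rV[R]_(r n))
  (V : forall n, T n -> 'M[R[i]]_(m n, r n))
  (P_svd : forall n w, is_thin_svd F (P n w) (U n w) (theta n w) (V n w))
  (uhat : forall n, T n -> 'M[R[i]]_n)
  (sigma : forall n, T n -> 'rV[R]_n)
  (vhat : forall n, T n -> 'M[R[i]]_(m n, n))
  (W_svd : forall n w,
    is_svd F (X n w + P n w) (uhat n w) (sigma n w) (vhat n w))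
  (mu : probability R R)
  (noise : global_noise_law Pr mu X)
  (edge : edge_condition mu c)
  (local_law : subspace_local_law Pr mu c X U V)
  (compat : forall K : set (R[i])^o, compact K -> off_cut mu K ->
    weighted_compatibility Pr mu c X U theta V K)
  (r_lim : r @ \oo --> \oo)
  (H : {finite_measure set R -> \bar R})
  (H_carrier : H `]-oo, theta_star mu c]%classic = 0%E)
  (spikes : vague_cvg_in_prob Pr `]theta_star mu c, +oo[
    (fun n w => atomic_restrict (empirical (theta n w)) `]theta_star mu c, +oo[)
    H) :
  let b := noise_edge mu in
  let out n w (wt : 'I_n -> R[i]) := outlier_measure (r n) b (sigma n w) wt in
  let wL n w := overlap (U n w) (uhat n w) in
  let wR n w := overlap (V n w) (vhat n w) in
  let wLR n w := cross_overlap (U n w) (V n w) (uhat n w) (vhat n w) in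
  let law := vague_cvg_in_prob Pr `]b, +oo[ in
  [/\ law (fun n w => out n w (fun=> 1)) (pushforward H (rho mu c)),
      law (fun n w => out n w (wL n w))
        (pushforward (with_density mu c H (kappaL mu c)) (rho mu c)),
      law (fun n w => out n w (wR n w))
        (pushforward (with_density mu c H (kappaR mu c)) (rho mu c))
    & law (fun n w => out n w (wLR n w))
        (pushforward (with_density mu c H (kappaLR mu c)) (rho mu c))] /\
  forall f : R -> R, test_function `]b, +oo[ f ->
    let stat n w (wt : 'I_n -> R[i]) :=
      (r n)%:R^-1 * \sum_(j < n) (f (sigma n w 0 j))%:C * wt j in
    let limit (kappa : R -> R) : R[i] :=
      (\int[H]_(t in `]theta_star mu c, +oo[) (f (rho mu c t) * kappa t))%:C in
    [/\ cvg_in_prob Pr (fun n w => stat n w (fun=> 1)) (limit (fun=> 1)),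
        cvg_in_prob Pr (fun n w => stat n w (wL n w)) (limit (kappaL mu c)),
        cvg_in_prob Pr (fun n w => stat n w (wR n w)) (limit (kappaR mu c))
      & cvg_in_prob Pr (fun n w => stat n w (wLR n w)) (limit (kappaLR mu c))].
Proof.
move=> b out wL wR wLR law.
have [S_ge0 S_compact _ _] := noise.
pose st w W kappa nu := @outlier_statistics R F m r c d T Pr X P U theta V uhat sigma vhat mu
  c_gt0 c_le1 P_svd W_svd noise edge local_law H spikes w W kappa nu.
have one : [/\ forall x, b < x -> {for x, continuous (fun=> 1 : R)}
             & forall f, test_function `]b, +oo[%classic f ->
     (\int[pushforward H (rho mu c)]_x (f x)%:E = \int[H]_t (f (rho mu c t) * 1)%:E)%E].
  split=> [x _|f tf]; first exact: cst_continuous.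
  rewrite integral_pushforward_real.
  - by apply: eq_integral => t _; rewrite mulr1.
  - exact: rho_measurable.
  - by apply: continuous_measurable_fun; case: tf.
have [v1 s1] := st _ (fun=> 1) (fun=> 1) (pushforward H (rho mu c))
  (@overlap_law_one R mu c) one.1 (fun _ _ => erefl) one.2.
have imgL f : test_function `]b, +oo[%classic f ->
    (\int[pushforward (with_density mu c H (kappaL mu c)) (rho mu c)]_x (f x)%:E =
     \int[H]_t (f (rho mu c t) * weightL mu c (rho mu c t))%:E)%E.
  move=> tf; apply: integral_image_density => //.
  - by move=> x; exact: weightL_continuous.
  - by move=> x; exact: weightL_ge0.
  - by move=> t; exact: kappaL_rho.
have [v2 s2] : _ /\ _ := st _ _ (kappaL mu c) _ (overlap_law_left S_ge0 S_compact c_gt0 c_le1)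
  (fun x => @weightL_continuous _ mu c S_ge0 S_compact c_gt0 c_le1 x)
  (fun t => @kappaL_rho _ mu c S_ge0 S_compact c_gt0 c_le1 edge t) imgL.
have imgR f : test_function `]b, +oo[%classic f ->
    (\int[pushforward (with_density mu c H (kappaR mu c)) (rho mu c)]_x (f x)%:E =
     \int[H]_t (f (rho mu c t) * weightR mu c (rho mu c t))%:E)%E.
  move=> tf; apply: integral_image_density => //.
  - by move=> x; exact: weightR_continuous.
  - by move=> x; exact: weightR_ge0.
  - by move=> t; exact: kappaR_rho.
have [v3 s3] : _ /\ _ := st _ _ (kappaR mu c) _ (overlap_law_right S_ge0 S_compact c_gt0 c_le1)
  (fun x => @weightR_continuous _ mu c S_ge0 S_compact c_gt0 c_le1 x)
  (fun t => @kappaR_rho _ mu c S_ge0 S_compact c_gt0 c_le1 edge t) imgR.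
have imgLR f : test_function `]b, +oo[%classic f ->
    (\int[pushforward (with_density mu c H (kappaLR mu c)) (rho mu c)]_x (f x)%:E =
     \int[H]_t (f (rho mu c t) * weightLR mu c (rho mu c t))%:E)%E.
  move=> tf; apply: integral_image_density => //.
  - by move=> x; exact: weightLR_continuous.
  - by move=> x; exact: weightLR_ge0.
  - by move=> t; exact: kappaLR_rho.
have [v4 s4] : _ /\ _ := st _ _ (kappaLR mu c) _ (overlap_law_cross S_ge0 S_compact c_gt0 c_le1)
  (fun x => @weightLR_continuous _ mu c S_ge0 S_compact c_gt0 c_le1 x)
  (fun t => @kappaLR_rho _ mu c S_ge0 S_compact c_gt0 c_le1 edge t) imgLR.
split; first by split; [exact: v1|exact: v2|exact: v3|exact: v4].
by move=> f tf stat limit; split; [exact: s1|exact: s2|exact: s3|exact: s4].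
Qed.
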